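(* There is an absolute constant $c > 0$ such that for every sufficiently large $s \in \mathbb{N}$ there is $\gamma_s \geq c (\log \log s)^{1/2} (\log \log \log s)^{-1/2}$ with the following property. For every finite set $A \subseteq \mathbb{Z}$ there exist disjoint sets $B, C$ with $A = B \cup C$ and \[ \max\{E_s(B), M_s(C), E_s(B,C), M_s(B,C)\} \ll_s |A|^{2s - \gamma_s}. \] Moreover, if $0 \notin A$, then for every choice of $A_1, \dots, A_{2s} \in \{B, C\}$ we have either \[ E_s(A_1, \dots, A_{2s}) \ll_s |A|^{2s - \gamma_s} \quad \text{or} \quad M_s(A_1, \dots, A_{2s}) \ll_s |A|^{2s - \gamma_s}. \]
   Context: For finite sets $A_1, \dots, A_{2s}$ of reals, $E_s(A_1,\dots,A_{2s}) = |\{(a_1,\dots,a_{2s}) \in A_1 \times \dots \times A_{2s} : a_1 + \dots + a_s = a_{s+1} + \dots + a_{2s}\}|$ and $M_s(A_1,\dots,A_{2s}) = |\{(a_1,\dots,a_{2s}) \in A_1 \times \dots \times A_{2s} : a_1 \cdots a_s = a_{s+1} \cdots a_{2s}\}|$. $E_s(X) = E_s(X,\dots,X)$ and $M_s(X) = M_s(X,\dots,X)$. For finite sets $B, C$, $E_s(B,C) = E_s(B,\dots,B,C,\dots,C)$ and $M_s(B,C) = M_s(B,\dots,B,C,\dots,C)$ with $s$ copies of $B$ followed by $s$ copies of $C$. The notation $X \ll_z Y$ means $|X| \leq C_z |Y|$ for a positive constant $C_z$ depending only on $z$. *)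

(* Defs.v *)
From HB Require Import structures.
From mathcomp Require Import all_boot all_order all_algebra.
From mathcomp Require Import finmap.
From mathcomp Require Import all_classical all_reals all_analysis.
Set Implicit Arguments. Unset Strict Implicit. Unset Printing Implicit Defensive.
Import Order.TTheory GRing.Theory Num.Theory.
Local Open Scope ring_scope.
Local Open Scope fset_scope.

Fixpoint choices (L : seq (seq int)) : seq (seq int) :=
  match L with
  | [::] => [:: [::]]
  | a :: L' => [seq x :: t | x <- a, t <- choices L']
  end.

Definition tuples_of (As : seq {fset int}) : seq (seq int) :=
  choices [seq (enum_fset A) | A <- As].

Definition Egen (s : nat) (As : seq {fset int}) : nat :=
  count (fun t : seq int => \sum_(x <- take s t) x == \sum_(x <- drop s t) x)
        (tuples_of As).

Definition Mgen (s : nat) (As : seq {fset int}) : nat :=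
  count (fun t : seq int => \prod_(x <- take s t) x == \prod_(x <- drop s t) x)
        (tuples_of As).

Definition E1 (s : nat) (X : {fset int}) : nat := Egen s (nseq (2 * s) X).
Definition M1 (s : nat) (X : {fset int}) : nat := Mgen s (nseq (2 * s) X).
Definition E2 (s : nat) (B C : {fset int}) : nat := Egen s (nseq s B ++ nseq s C).
Definition M2 (s : nat) (B C : {fset int}) : nat := Mgen s (nseq s B ++ nseq s C).

(* Main.v *)
(* Fix k, and let t' << t be powers of 2 with t' >= 4k. The 2r-th root of the
   energy E_r is a norm by Hoelder, so it suffices to bound E_{t'/2}(B) and
   M_{t/2}(C): all other variables may be frozen.

   Additive side. In a vanishing signed sum of integers the least p-adic valuation
   occurs twice, hence for the additive norm N and the fibres h_j of v_p one has
   N(h)^2 <= t'^2 sum_j N(h_j)^2. Dualising, a set A in which one can query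
   valuations, prime after prime, so as to reach many elements at a price t'^2
   per query contains a subset A' with N(1_A') <= |A'| |A|^(-1/8) up to constants.
   Remove such subsets greedily; their union is B, and the rest C has small
   "query dimension" D(C) <= 2 |A|^(1/4).

   Multiplicative side. With d = k/t one shows that the multiplicative norm of C is
   at most 2^d |C|^(1-d) D(C)^(2d), by induction on the primes. By Hoelder the norm
   of C is at most that of the sequence u_j of norms of the fibres, viewed as a
   measure on Z, so the claim reduces to the one-dimensional inequality
     energy(u) <= max ((sum u_j^s)^(t-k), t'^(-2k) (sum u_j)^t),   s = t/(t-k).
   If u is far from a point mass, t independent copies of u spread out and the
   second bound holds; if u is close to a point mass, the first one holds by
   expanding around the mode. Here t doubly exponential in k^2 is enough. *)
Require Import Defs.
From HB Require Import structures.
From mathcomp Require Import all_boot all_order all_algebra.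
From mathcomp Require Import finmap.
From mathcomp Require Import all_classical all_reals all_analysis.
From mathcomp Require Import ring lra zify.
Set Implicit Arguments. Unset Strict Implicit. Unset Printing Implicit Defensive.
Import Order.TTheory GRing.Theory Num.Theory.
Local Open Scope ring_scope.

(** * Energies of finitely supported measures *)

(* A list of pairs (point, weight) stands for the measure in which the weights
   of repeated points add up. *)
Section Convolution.
Variables (R : realType) (G : zmodType).
Implicit Types (mu nu : seq (G * R)) (F : G -> R) (z : G).

(** Both classes save |A|^(k/2), whence gamma = k/2. Additively N(1_B) <= 9 |A|^(7/8), and t' >= 4k
    copies save |A|^(t'/8). Multiplicatively |A|^(1-d) D^(2d) with D <= 2 |A|^(1/4) is |A|^(1-d/2)
    up to a constant, and its power t = k/d saves |A|^(k/2). The two terms of the one-dimensional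
    inequality answer the two ways of querying a prime: the first is for keeping a single fibre, the
    second must absorb L^k with L = t'^2, the k-th power of the price of a split. This absorption is
    the obstacle: independent copies gain only a factor 1 - 1/4000 per tripling, so i of order k^2
    triplings are needed, and t must be exponential in 3^i for the nearly point-mass case to go
    through. Powers of 2 let Hoelder be iterated Cauchy-Schwarz. The group is arbitrary because the
    same norm is used on Z, on exponent vectors and on the levels of one valuation. *)

Definition conv mu F : G -> R := fun z => \sum_(p <- mu) p.2 * F (z - p.1).
Definition dirac0 : G -> R := fun z => (z == 0)%:R.
Definition convs (mus : seq (seq (G * R))) : G -> R := foldr conv dirac0 mus.
Definition opp mu : seq (G * R) := [seq (- p.1, p.2) | p <- mu].
Definition mass mu : R := \sum_(p <- mu) p.2.
Definition nonneg mu : bool := all (fun p => 0 <= p.2) mu.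
Definition val_at mu : G -> R := conv mu dirac0.
Definition mprod mu nu : seq (G * R) := [seq (p.1 + q.1, p.2 * q.2) | p <- mu, q <- nu].
Definition autocorr mu := mprod mu (opp mu).

Lemma val_atE mu z : val_at mu z = \sum_(p <- mu | p.1 == z) p.2.
Proof.
rewrite /val_at /conv [RHS]big_mkcond /=; apply: eq_bigr => p _.
by rewrite /dirac0 subr_eq0 eq_sym; case: eqP; rewrite ?mulr1 ?mulr0.
Qed.

Lemma convC mu nu F : conv mu (conv nu F) = conv nu (conv mu F).
Proof.
apply/funext => z; rewrite /conv.
under eq_bigr do rewrite mulr_sumr.
rewrite exchange_big /=; apply: eq_bigr => q _.
rewrite mulr_sumr; apply: eq_bigr => p _.
by rewrite mulrCA addrAC.
Qed.

Lemma conv_cat mu nu F z : conv (mu ++ nu) F z = conv mu F z + conv nu F z.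
Proof. by rewrite /conv big_cat. Qed.

Lemma conv_mprod mu nu F : conv (mprod mu nu) F = conv mu (conv nu F).
Proof.
apply/funext => z; rewrite /conv /mprod big_allpairs_dep; apply: eq_bigr => p _.
rewrite mulr_sumr; apply: eq_bigr => q _ /=.
by rewrite mulrA opprD addrA.
Qed.

Lemma oppK mu : opp (opp mu) = mu.
Proof. by rewrite /opp -map_comp map_id_in // => -[x w] _ /=; rewrite opprK. Qed.

Lemma conv_opp_mprod mu nu F : conv (opp (mprod mu nu)) F = conv (opp mu) (conv (opp nu) F).
Proof.
apply/funext => z; rewrite /conv /mprod big_map big_allpairs_dep big_map; apply: eq_bigr => p _.
rewrite big_map mulr_sumr; apply: eq_bigr => q _ /=.
by rewrite mulrA !opprK addrA.
Qed.

Lemma conv_opp_autocorr mu F : conv (opp (autocorr mu)) F = conv (autocorr mu) F.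
Proof. by rewrite /autocorr conv_opp_mprod oppK convC conv_mprod. Qed.

Lemma conv_foldr mu mus F : conv mu (foldr conv F mus) = foldr conv (conv mu F) mus.
Proof. by elim: mus => //= nu mus IH; rewrite convC IH. Qed.

Lemma convs_cat mus nus : convs (mus ++ nus) = foldr conv (convs nus) mus.
Proof. by rewrite /convs foldr_cat. Qed.

Lemma convs_perm mus nus : perm_eq mus nus -> convs mus = convs nus.
Proof.
apply: catCA_perm_subst => s1 s2 s3.
rewrite !convs_cat; move: (convs s3) => F.
elim: s2 F => //= mu s2 IH F.
by rewrite -conv_foldr IH.
Qed.

Lemma nonneg_opp mu : nonneg (opp mu) = nonneg mu.
Proof. by rewrite /nonneg all_map. Qed.

Lemma nonneg_mprod mu nu : nonneg mu -> nonneg nu -> nonneg (mprod mu nu).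
Proof.
move=> /allP h1 /allP h2; apply/allP => _ /allpairsP[[p q] [/= hp hq ->]] /=.
by apply: mulr_ge0; [exact: h1 | exact: h2].
Qed.

Lemma nonneg_autocorr mu : nonneg mu -> nonneg (autocorr mu).
Proof. by move=> h; rewrite nonneg_mprod ?nonneg_opp. Qed.

Lemma ler_conv mu F F' z : nonneg mu -> (forall y, F y <= F' y) -> conv mu F z <= conv mu F' z.
Proof.
move=> /allP h hF; rewrite /conv !big_seq; apply: ler_sum => p hp.
by rewrite ler_wpM2l ?h.
Qed.

Lemma conv_ge0 mu F z : nonneg mu -> (forall y, 0 <= F y) -> 0 <= conv mu F z.
Proof.
move=> /allP h hF; rewrite /conv big_seq; apply: sumr_ge0 => p hp.
by rewrite mulr_ge0 ?h.
Qed.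

Lemma dirac0_ge0 z : 0 <= dirac0 z.
Proof. by rewrite /dirac0. Qed.

Lemma foldr_conv_ge0 mus F z : all nonneg mus -> (forall y, 0 <= F y) ->
  0 <= foldr conv F mus z.
Proof.
move=> + h; elim: mus z => //= mu mus IH z /andP[h1 h2].
by apply: conv_ge0 => // y; apply: IH.
Qed.

Lemma convs_ge0 mus z : all nonneg mus -> 0 <= convs mus z.
Proof. by move=> h; apply: foldr_conv_ge0 => // y; apply: dirac0_ge0. Qed.

Lemma val_at_ge0 mu z : nonneg mu -> 0 <= val_at mu z.
Proof. by move=> h; apply: conv_ge0 => // y; apply: dirac0_ge0. Qed.

Lemma sum_val_at mu (h : G -> R) (s : seq G) : uniq s -> (forall p, p \in mu -> p.1 \in s) ->
  \sum_(p <- mu) p.2 * h p.1 = \sum_(y <- s) val_at mu y * h y.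
Proof.
move=> us hs.
under [RHS]eq_bigr do rewrite val_atE mulr_suml big_mkcond /=.
rewrite exchange_big /= big_seq [RHS]big_seq; apply: eq_bigr => p hp.
rewrite (bigD1_seq p.1) ?hs //= eqxx big1 ?addr0 // => y.
by rewrite eq_sym => /negbTE ->.
Qed.

Definition supp mu : seq G := undup [seq p.1 | p <- mu].

Lemma mem_supp mu p : p \in mu -> p.1 \in supp mu.
Proof. by move=> h; rewrite mem_undup map_f. Qed.

Lemma conv_val_at mu F z (s : seq G) : uniq s -> (forall p, p \in mu -> p.1 \in s) ->
  conv mu F z = \sum_(y <- s) val_at mu y * F (z - y).
Proof. by move=> us hs; rewrite /conv (sum_val_at (fun y => F (z - y)) us hs). Qed.

Lemma conv_supp mu F z : conv mu F z = \sum_(y <- supp mu) val_at mu y * F (z - y).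
Proof. by apply: conv_val_at; [apply: undup_uniq | apply: mem_supp]. Qed.

Lemma val_at_opp mu z : val_at (opp mu) z = val_at mu (- z).
Proof.
by rewrite !val_atE big_map; apply: eq_bigl => p /=; rewrite eqr_oppLR.
Qed.

Lemma val_at_supp0 mu z : z \notin supp mu -> val_at mu z = 0.
Proof.
move=> h; rewrite val_atE big_seq_cond big1 // => p /andP[hp /eqP e].
by move: h; rewrite -e mem_supp.
Qed.

Lemma val_at_autocorr mu : val_at (autocorr mu) 0 = \sum_(y <- supp mu) val_at mu y ^+ 2.
Proof.
rewrite /val_at conv_mprod conv_supp; apply: eq_bigr => y _.
by rewrite -/(val_at _) -/(val_at _ _) val_at_opp sub0r opprK expr2.
Qed.

Lemma cauchy_schwarz_sum (I : Type) (s : seq I) (a b : I -> R) :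
  (\sum_(i <- s) a i * b i) ^+ 2 <= (\sum_(i <- s) a i ^+ 2) * (\sum_(i <- s) b i ^+ 2).
Proof.
set A := \sum_(i <- s) a i ^+ 2; set B := \sum_(i <- s) b i ^+ 2; set C := \sum_(i <- s) _.
have key x y : 0 <= x ^+ 2 * A - 2 * x * y * C + y ^+ 2 * B.
  have -> : x ^+ 2 * A - 2 * x * y * C + y ^+ 2 * B = \sum_(i <- s) (x * a i - y * b i) ^+ 2.
    rewrite !mulr_sumr -sumrB -big_split /=; apply: eq_bigr => i _; ring.
  by apply: sumr_ge0 => i _; apply: sqr_ge0.
have B0 : 0 <= B by apply: sumr_ge0 => i _; apply: sqr_ge0.
have A0 : 0 <= A by apply: sumr_ge0 => i _; apply: sqr_ge0.
have [B00|] := eqVneq B 0.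
  (* If B = 0 the form is affine in y, and at x = C, y = A + 1 it equals -C^2 (A + 2), which forces
     C = 0. *)
  rewrite B00 mulr0; have := key C (A + 1); rewrite B00 mulr0 addr0.
  have -> : C ^+ 2 * A - 2 * C * (A + 1) * C = - (C ^+ 2 * (A + 2)) by ring.
  by rewrite oppr_ge0 pmulr_lle0 //; lra.
move=> Bn; have Bp : 0 < B by rewrite lt_def Bn.
have := key B C.
have -> : B ^+ 2 * A - 2 * B * C * C + C ^+ 2 * B = B * (A * B - C ^+ 2) by ring.
by rewrite pmulr_rge0 // subr_ge0.
Qed.

(** [val_at (autocorr mu) 0] is the squared l2 norm of mu, so this is Cauchy-Schwarz, uniform in z:
    y -> z - y is injective, and points of the reflected support outside [supp nu] contribute 0. *)
Lemma conv_val_at_sqr_le mu nu z :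
  conv mu (val_at nu) z ^+ 2 <= val_at (autocorr mu) 0 * val_at (autocorr nu) 0.
Proof.
rewrite conv_supp; apply: le_trans (cauchy_schwarz_sum _ _ _) _.
rewrite val_at_autocorr ler_wpM2l ?sumr_ge0 // => [i _|]; first exact: sqr_ge0.
rewrite val_at_autocorr.
rewrite -(big_map (fun y => z - y) xpredT (fun w => val_at nu w ^+ 2)).
rewrite (bigID (mem (supp nu))) /= [X in _ + X]big1 ?addr0; last first.
  by move=> y /val_at_supp0 ->; rewrite expr0n.
rewrite -big_filter; apply: (@le_trans _ _ (\sum_(i <- [seq i <- supp nu | i \in [seq z - y | y <- supp mu]]) val_at nu i ^+ 2)).
  rewrite le_eqVlt; apply/orP; left; apply/eqP; apply: perm_big; apply: uniq_perm.
  - by rewrite filter_uniq // map_inj_uniq ?undup_uniq // => a b /(addrI z) /oppr_inj.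
  - by rewrite filter_uniq ?undup_uniq.
  - by move=> y; rewrite !mem_filter andbC.
by rewrite big_filter [leRHS](bigID (mem [seq z - y | y <- supp mu])) /= lerDl sumr_ge0 // => i _; apply: sqr_ge0.
Qed.

Fixpoint mprods (mus : seq (seq (G * R))) : seq (G * R) :=
  if mus is mu :: mus' then mprod mu (mprods mus') else [:: (0, 1)].

Lemma conv_mprods mus F : conv (mprods mus) F = foldr conv F mus.
Proof.
elim: mus => [|mu mus IH] /=; last by rewrite conv_mprod IH.
by apply/funext => z; rewrite /conv big_seq1 /= mul1r subr0.
Qed.

Lemma conv_opp_mprods mus F : conv (opp (mprods mus)) F = foldr conv F (map opp mus).
Proof.
elim: mus => [|mu mus IH] /=; last by rewrite conv_opp_mprod IH.
by apply/funext => z; rewrite /conv big_seq1 /= mul1r oppr0 subr0.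
Qed.

Lemma foldr_conv_opp mus F : foldr conv (foldr conv F (map opp mus)) mus =
  foldr conv F (map autocorr mus).
Proof.
elim: mus F => //= mu mus IH F.
rewrite /autocorr conv_mprod -[in RHS]IH.
congr (conv mu _); exact/esym/conv_foldr.
Qed.

(** Cauchy-Schwarz for the products of the two lists. The squared l2 norm of a product of measures
    is the convolution at 0 of the autocorrelations of its factors, because convolution commutes. *)
Lemma convs_sqr_le mus nus z :
  convs (mus ++ nus) z ^+ 2 <= convs (map autocorr mus) 0 * convs (map autocorr nus) 0.
Proof.
have E s : val_at (autocorr (mprods s)) 0 = convs (map autocorr s) 0.
  by rewrite /val_at /autocorr conv_mprod conv_opp_mprods conv_mprods foldr_conv_opp.
have -> : convs (mus ++ nus) = conv (mprods mus) (val_at (mprods nus)).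
  by rewrite convs_cat conv_mprods /val_at conv_mprods.
by apply: le_trans (conv_val_at_sqr_le _ _ _) _; rewrite !E.
Qed.

Definition sgn_meas (b : bool) mu := if b then mu else opp mu.
(* [signs m] is balanced for m > 0, so for a set X the energy of its uniform
   measure at level m is E_r(X) with 2r = 2^m. *)
Fixpoint signs (m : nat) : seq bool :=
  if m is m'.+1 then flatten [seq [:: b; ~~ b] | b <- signs m'] else [:: true].
Definition energy (m : nat) mu : R := convs [seq sgn_meas b mu | b <- signs m] 0.
Definition enorm (m : nat) mu : R := energy m mu `^ ((2 ^ m)%:R)^-1.

Lemma size_signs m : size (signs m) = (2 ^ m)%N.
Proof.
elim: m => //= m IH; rewrite expnS -IH.
by elim: (signs m) => //= b s ->; lia.
Qed.

(** Level m + 1 replaces each sign b by the pair b, ~~ b, that is, each copy of mu by mu convolved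
    with its reflection; the autocorrelation is symmetric, so its own sign is immaterial. *)
Lemma energyS m mu : energy m.+1 mu = energy m (autocorr mu).
Proof.
rewrite /energy /= /convs; congr (_ 0); elim: (signs m) => //= b s IH.
rewrite IH; case: b => /=; first by rewrite /autocorr conv_mprod.
by rewrite conv_opp_autocorr /autocorr conv_mprod convC.
Qed.

Lemma nonneg_sgn b mu : nonneg (sgn_meas b mu) = nonneg mu.
Proof. by case: b => //=; rewrite nonneg_opp. Qed.

Lemma energy_ge0 m mu : nonneg mu -> 0 <= energy m mu.
Proof.
by move=> h; apply: convs_ge0; rewrite all_map; apply/allP => b _ /=; rewrite nonneg_sgn.
Qed.

Lemma enorm_ge0 m mu : 0 <= enorm m mu.
Proof. exact: powR_ge0. Qed.

Lemma enormX m mu : nonneg mu -> enorm m mu ^+ (2 ^ m) = energy m mu.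
Proof.
by move=> h; rewrite /enorm -powR_mulrn ?powR_ge0 // -powRrM mulVf ?powRr1 ?energy_ge0 ?pnatr_eq0 ?expn_eq0.
Qed.

Lemma enorm_autocorr m mu : nonneg mu -> enorm m (autocorr mu) = enorm m.+1 mu ^+ 2.
Proof.
move=> h; rewrite /enorm energyS -powR_mulrn ?powR_ge0 // -powRrM; congr (_ `^ _).
by rewrite expnS natrM invfM mulrAC mulVf ?mul1r ?pnatr_eq0.
Qed.

(** Induction by Cauchy-Schwarz: the two halves of the list become lists of autocorrelations, whose
    norms are squares of norms one level up. Only values at 0 come back, so z can be arbitrary. *)
Theorem convs_hoelder m mus z : size mus = (2 ^ m.+1)%N -> all nonneg mus ->
  convs mus z <= \prod_(mu <- mus) enorm m.+1 mu.
Proof.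
have sq (x y : R) : 0 <= y -> x ^+ 2 <= y ^+ 2 -> x <= y.
  move=> y0 hxy; rewrite leNgt; apply/negP => hlt.
  by move: hxy; rewrite !expr2; nra.
elim: m mus z => [|m IH] mus z hs hp; apply: sq.
- by apply: prodr_ge0 => mu _; apply: enorm_ge0.
- case: mus hs hp => [|mu [|nu []]] //= _ /and3P[h1 h2 _].
  rewrite big_cons big_seq1 exprMn !(enormX 1) //.
  apply: le_trans (convs_sqr_le [:: mu] [:: nu] z) _ => /=.
  by rewrite !energyS /energy.
- by apply: prodr_ge0 => mu _; apply: enorm_ge0.
set n := (2 ^ m.+1)%N.
have sz : size (take n mus) = n by rewrite size_takel // hs [in leqRHS]expnS /n; lia.
have szd : size (drop n mus) = n by rewrite size_drop hs [(2 ^ m.+2)%N]expnS /n; lia.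
have step s : size s = n -> all nonneg s ->
    convs (map autocorr s) 0 <= \prod_(mu <- s) enorm m.+2 mu ^+ 2.
  move=> ss sp; apply: le_trans (IH _ _ _ _) _; first by rewrite size_map.
    by rewrite all_map; apply: sub_all sp => mu; apply: nonneg_autocorr.
  rewrite big_map !big_seq le_eqVlt; apply/orP; left; apply/eqP; apply: eq_bigr => mu hmu.
  by rewrite enorm_autocorr // (allP sp).
rewrite -(cat_take_drop n mus); move: hp; rewrite -(cat_take_drop n mus) all_cat => /andP[p1 p2].
rewrite !cat_take_drop in p1 p2 *.
rewrite -[in leLHS](cat_take_drop n mus).
apply: le_trans (convs_sqr_le _ _ _) _.
rewrite -[in leRHS](cat_take_drop n mus) big_cat exprMn -!prodrXl.
apply: ler_pM; try exact: step.
- by apply: convs_ge0; rewrite all_map; apply: sub_all p1 => mu; apply: nonneg_autocorr.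
- by apply: convs_ge0; rewrite all_map; apply: sub_all p2 => mu; apply: nonneg_autocorr.
Qed.

End Convolution.

Arguments conv {R G} mu F z.
Arguments dirac0 {R G} z.
Arguments opp {R G} mu.
Arguments autocorr {R G} mu.
Arguments nonneg {R G} mu.

Section Energy.
Variables (R : realType) (G : zmodType).
Implicit Types (mu nu : seq (G * R)) (mus : seq (seq (G * R))) (F : G -> R) (z : G).

Lemma ler_conv_val_at mu nu F z : (forall y, 0 <= F y) ->
  (forall y, val_at mu y <= val_at nu y) -> conv mu F z <= conv nu F z.
Proof.
move=> F0 h; set s := undup (supp mu ++ supp nu).
have us : uniq s by apply: undup_uniq.
rewrite (@conv_val_at _ _ mu _ _ s) // ?(@conv_val_at _ _ nu _ _ s) //.
- by apply: ler_sum => y _; rewrite ler_wpM2r.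
- by move=> p hp; rewrite mem_undup mem_cat [X in _ || X]mem_supp // orbT.
- by move=> p hp; rewrite mem_undup mem_cat mem_supp.
Qed.

Lemma ler_val_at_opp mu nu : (forall y, val_at mu y <= val_at nu y) ->
  forall y, val_at (opp mu) y <= val_at (opp nu) y.
Proof. by move=> h y; rewrite !val_at_opp. Qed.

Lemma ler_val_at_sgn b mu nu : (forall y, val_at mu y <= val_at nu y) ->
  forall y, val_at (sgn_meas b mu) y <= val_at (sgn_meas b nu) y.
Proof. by case: b => // h y; apply: ler_val_at_opp. Qed.

Lemma all_nonneg_sgn mu (bs : seq bool) : nonneg mu -> all nonneg [seq sgn_meas b mu | b <- bs].
Proof. by move=> p; rewrite all_map; apply/allP => b _ /=; rewrite nonneg_sgn. Qed.

Lemma ler_foldr_conv_sgn mu nu (bs : seq bool) F z : nonneg mu -> nonneg nu -> (forall y, 0 <= F y) ->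
  (forall y, val_at mu y <= val_at nu y) ->
  foldr conv F [seq sgn_meas b mu | b <- bs] z <= foldr conv F [seq sgn_meas b nu | b <- bs] z.
Proof.
move=> p1 p2 F0 h; elim: bs z => //= b s IH z.
apply: le_trans (ler_conv_val_at z (nu := sgn_meas b nu) _ _) _.
- by move=> y; apply: foldr_conv_ge0 => //; apply: all_nonneg_sgn.
- exact: ler_val_at_sgn.
- by apply: ler_conv; rewrite ?nonneg_sgn.
Qed.

Lemma ler_energy m mu nu : nonneg mu -> nonneg nu ->
  (forall y, val_at mu y <= val_at nu y) -> energy m mu <= energy m nu.
Proof. by move=> p1 p2 h; apply: ler_foldr_conv_sgn => // y; apply: dirac0_ge0. Qed.

Lemma ler_enorm m mu nu : nonneg mu -> nonneg nu ->
  (forall y, val_at mu y <= val_at nu y) -> enorm m mu <= enorm m nu.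
Proof.
move=> p1 p2 h; apply: ge0_ler_powR; rewrite ?invr_ge0 ?nnegrE ?energy_ge0 //.
exact: ler_energy.
Qed.

Lemma eq_enorm m mu nu : nonneg mu -> nonneg nu ->
  (forall y, val_at mu y = val_at nu y) -> enorm m mu = enorm m nu.
Proof. by move=> p1 p2 h; apply/eqP; rewrite eq_le !ler_enorm // => y; rewrite h. Qed.

Lemma enorm_opp m mu : nonneg mu -> enorm m.+1 (opp mu) = enorm m.+1 mu.
Proof.
move=> p; rewrite /enorm !energyS; congr (_ `^ _); apply/eqP.
have p' : nonneg (opp mu) by rewrite nonneg_opp.
rewrite eq_le !ler_energy ?nonneg_autocorr // => y;
  by rewrite /autocorr /val_at !conv_mprod oppK convC.
Qed.

Lemma enorm_sgn m b mu : nonneg mu -> enorm m.+1 (sgn_meas b mu) = enorm m.+1 mu.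
Proof. by case: b => //=; apply: enorm_opp. Qed.

Lemma prod_enorm_sgn m mu bs : nonneg mu ->
  \prod_(nu <- [seq sgn_meas b mu | b <- bs]) enorm m.+1 nu = enorm m.+1 mu ^+ size bs.
Proof.
move=> p; rewrite big_map; under eq_bigr do rewrite enorm_sgn //.
by rewrite big_const_seq count_predT iter_mulr mulr1.
Qed.

Lemma sgn_meas_cat b mu nu : sgn_meas b (mu ++ nu) = sgn_meas b mu ++ sgn_meas b nu.
Proof. by case: b => //=; rewrite /opp map_cat. Qed.

Lemma nonneg_cat mu nu : nonneg (mu ++ nu) = nonneg mu && nonneg nu.
Proof. exact: all_cat. Qed.

Lemma perm_mid (T : eqType) (s1 : seq T) x s2 : perm_eq (s1 ++ x :: s2) (x :: s1 ++ s2).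
Proof. by rewrite perm_sym -cat1s perm_catCA. Qed.

Lemma convs_mid s1 mu s2 : convs (s1 ++ mu :: s2) = conv mu (convs (s1 ++ s2)).
Proof. by rewrite (convs_perm (perm_mid _ _ _)). Qed.

Lemma convs_mid_cat s1 mu nu s2 z : convs (s1 ++ (mu ++ nu) :: s2) z =
  convs (s1 ++ mu :: s2) z + convs (s1 ++ nu :: s2) z.
Proof. by rewrite !convs_mid conv_cat. Qed.

Lemma mass_ge0 mu : nonneg mu -> 0 <= mass mu.
Proof. by move=> /allP h; rewrite /mass big_seq; apply: sumr_ge0 => p /h. Qed.

Lemma mass_sgn b mu : mass (sgn_meas b mu) = mass mu.
Proof. by case: b => //=; rewrite /mass /opp big_map. Qed.

Lemma mass_cat mu nu : mass (mu ++ nu) = mass mu + mass nu.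
Proof. by rewrite /mass big_cat. Qed.

Lemma mass_val_at mu (s : seq G) : uniq s -> (forall p, p \in mu -> p.1 \in s) ->
  mass mu = \sum_(y <- s) val_at mu y.
Proof.
move=> us hs; have E := sum_val_at (fun=> 1) us hs.
rewrite (eq_bigr (fun p : G * R => p.2)) in E; last by move=> p _; rewrite mulr1.
by rewrite /mass E; apply: eq_bigr => y _; rewrite mulr1.
Qed.

Lemma conv_le_mass mu F z c : nonneg mu -> (forall y, F y <= c) -> conv mu F z <= mass mu * c.
Proof.
move=> /allP h hF; rewrite /mass mulr_suml /conv !big_seq; apply: ler_sum => p hp.
by rewrite ler_wpM2l ?h.
Qed.

Lemma foldr_conv_le_mass mus F z c : all nonneg mus -> (forall y, F y <= c) ->
  foldr conv F mus z <= (\prod_(mu <- mus) mass mu) * c.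
Proof.
move=> + hF; elim: mus z => [|mu mus IH] z /=; first by rewrite big_nil mul1r.
move=> /andP[h1 h2]; rewrite big_cons -mulrA; apply: conv_le_mass => // y; exact: IH.
Qed.

Lemma convs_le_mass mus z : all nonneg mus -> convs mus z <= \prod_(mu <- mus) mass mu.
Proof.
move=> h; rewrite -[leRHS]mulr1; apply: (@foldr_conv_le_mass mus dirac0 z 1) => // y.
by rewrite /dirac0; case: eqP.
Qed.

Lemma ler_expX (n : nat) (x y : R) : 0 <= x -> x <= y -> x ^+ n <= y ^+ n.
Proof. by move=> x0 h; apply: lerXn2r; rewrite ?nnegrE // (le_trans x0). Qed.

Lemma le_root (n : nat) (x y : R) : (0 < n)%N -> 0 <= y -> x ^+ n <= y ^+ n -> x <= y.
Proof.
move=> n0 y0 h; rewrite leNgt; apply/negP => hlt.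
by move: h; rewrite leNgt ltrXn2r // -lt0n n0.
Qed.

Lemma enorm_le_mass m mu : nonneg mu -> enorm m mu <= mass mu.
Proof.
move=> p; apply: (@le_root (2 ^ m)%N); rewrite ?expn_gt0 ?mass_ge0 // enormX //.
apply: le_trans (convs_le_mass _ _) _; first exact: all_nonneg_sgn.
rewrite big_map; under eq_bigr do rewrite mass_sgn.
by rewrite big_const_seq count_predT iter_mulr mulr1 size_signs.
Qed.

Lemma enorm_nil m : enorm m ([::] : seq (G * R)) = 0.
Proof.
by apply/eqP; rewrite eq_le enorm_ge0 andbT; apply: le_trans (enorm_le_mass _ _) _;
  rewrite // /mass big_nil.
Qed.

(** Only one of the t = 2^(m+1) factors of the energy is split; Hoelder leaves the power t - 1 of
    the norm of the sum on the right, which is then divided out. *)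
Theorem enorm_cat m mu nu : nonneg mu -> nonneg nu ->
  enorm m.+1 (mu ++ nu) <= enorm m.+1 mu + enorm m.+1 nu.
Proof.
move=> p1 p2; set h := mu ++ nu; have ph : nonneg h by rewrite nonneg_cat p1.
have [->|hn0] := eqVneq (enorm m.+1 h) 0; first by rewrite addr_ge0 ?enorm_ge0.
have hn : 0 < enorm m.+1 h by rewrite lt_def hn0 enorm_ge0.
have E : enorm m.+1 h ^+ (2 ^ m.+1) <= (enorm m.+1 mu + enorm m.+1 nu) * enorm m.+1 h ^+ (2 ^ m.+1).-1.
  rewrite enormX // /energy -(size_signs m.+1).
  have : size (signs m.+1) = (2 ^ m.+1)%N by rewrite size_signs.
  case: (signs m.+1) => [|b bs]; first by move/eqP; rewrite eq_sym expn_eq0.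
  move=> sz; rewrite [map _ _]/= {1}/h sgn_meas_cat -[X in convs X]cat0s convs_mid_cat !cat0s mulrDl.
  have H x : nonneg x -> convs (sgn_meas b x :: [seq sgn_meas b0 h | b0 <- bs]) 0 <=
      enorm m.+1 x * enorm m.+1 h ^+ (size (b :: bs)).-1.
    move=> px; apply: le_trans (convs_hoelder (m := m) _ _ _) _.
    - by rewrite /= size_map -sz.
    - by rewrite /= nonneg_sgn px all_nonneg_sgn.
    - by rewrite big_cons prod_enorm_sgn // enorm_sgn.
  by apply: lerD; apply: H.
rewrite -[X in _ ^+ X <= _]prednK ?expn_gt0 // exprSr mulrC in E.
by rewrite -(ler_pM2r (exprn_gt0 (2 ^ m.+1).-1 hn)).
Qed.

Definition scale (c : R) mu : seq (G * R) := [seq (p.1, c * p.2) | p <- mu].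

Lemma conv_scale c mu F z : conv (scale c mu) F z = c * conv mu F z.
Proof. by rewrite /conv big_map mulr_sumr; apply: eq_bigr => p _; rewrite mulrA. Qed.

Lemma nonneg_scale c mu : 0 <= c -> nonneg mu -> nonneg (scale c mu).
Proof.
by move=> c0 /allP h; rewrite /nonneg all_map; apply/allP => p hp /=; rewrite mulr_ge0 ?h.
Qed.

Lemma mass_scale c mu : mass (scale c mu) = c * mass mu.
Proof. by rewrite /mass big_map mulr_sumr. Qed.

Lemma conv_scaler c mu F z : conv mu (fun y => c * F y) z = c * conv mu F z.
Proof. by rewrite /conv mulr_sumr; apply: eq_bigr => p _; rewrite mulrCA. Qed.

Lemma convs_sgn_scale c mu (bs : seq bool) z :
  convs [seq sgn_meas b (scale c mu) | b <- bs] z = c ^+ size bs * convs [seq sgn_meas b mu | b <- bs] z.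
Proof.
elim: bs z => [|b s IH] z /=; first by rewrite expr0 mul1r.
have -> : sgn_meas b (scale c mu) = scale c (sgn_meas b mu).
  by case: b; rewrite //= /opp /scale -!map_comp.
rewrite conv_scale exprS -mulrA; congr (_ * _).
rewrite -conv_scaler; congr (conv _ _ _); apply/funext => y; exact: IH.
Qed.

Lemma energy_scale m c mu : energy m (scale c mu) = c ^+ (2 ^ m) * energy m mu.
Proof. by rewrite /energy convs_sgn_scale size_signs. Qed.

Lemma enorm_scale m c mu : 0 <= c -> nonneg mu -> enorm m (scale c mu) = c * enorm m mu.
Proof.
move=> c0 p; have p' := nonneg_scale c0 p.
apply/eqP; rewrite -(eqrXn2 (n := (2 ^ m)%N)) ?expn_gt0 ?mulr_ge0 ?enorm_ge0 //.
by rewrite exprMn !enormX // energy_scale.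
Qed.

Lemma energy_dirac m (a : G) (v : R) : energy m.+1 [:: (a, v)] = v ^+ (2 ^ m.+1).
Proof.
have E0 k w : energy k [:: (0 : G, w)] = w ^+ (2 ^ k).
  elim: k w => [|k IH] w.
    by rewrite /energy /= /convs /= /conv big_seq1 /dirac0 /= subr0 eqxx mulr1.
  rewrite energyS /autocorr /mprod /opp /= oppr0 addr0 IH expnS exprM expr2 //.
by rewrite energyS /autocorr /mprod /opp /= subrr E0 -expr2 -exprM -expnS.
Qed.

Lemma val_at_le_enorm m mu a : nonneg mu -> val_at mu a <= enorm m.+1 mu.
Proof.
move=> p; apply: (@le_root (2 ^ m.+1)%N); rewrite ?expn_gt0 ?enorm_ge0 // enormX //.
rewrite -(energy_dirac m a); apply: ler_energy => //.
  by rewrite /nonneg /= val_at_ge0.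
move=> y; rewrite {1}val_atE big_cons big_nil /=; case: eqP => [->|_].
  by rewrite addr0.
exact: val_at_ge0.
Qed.

Definition translate (c : G) mu : seq (G * R) := [seq (p.1 - c, p.2) | p <- mu].

Lemma energy_translate m c mu : energy m.+1 (translate c mu) = energy m.+1 mu.
Proof.
rewrite !energyS; congr energy; rewrite /autocorr /mprod; congr flatten.
rewrite /translate -map_comp; apply: eq_map => p /=.
rewrite /opp -!map_comp; apply: eq_map => q /=.
by rewrite opprB addrA subrK.
Qed.

Section TwoOf.
Variables (m : nat) (rho g : seq (G * R)).
Hypotheses (p_rho : nonneg rho) (p_g : nonneg g).
Hypothesis one_zero : forall bs1 b bs2,
  convs ([seq sgn_meas b' g | b' <- bs1] ++ sgn_meas b rho :: [seq sgn_meas b' g | b' <- bs2]) 0 = 0.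
Let kap := rho ++ g.
Let t := (2 ^ m.+1)%N.
Variable n : R.
Hypothesis hn : enorm m.+1 kap <= n.
Let c := enorm m.+1 rho ^+ 2 * n ^+ (t - 2).

Let p_kap : nonneg kap. Proof. by rewrite nonneg_cat p_rho. Qed.
Let n0 : 0 <= n. Proof. exact: le_trans (enorm_ge0 _ _) hn. Qed.
Let hg : enorm m.+1 g <= n.
Proof.
apply: le_trans hn; apply: ler_enorm => // y.
by rewrite /val_at conv_cat lerDr; apply: val_at_ge0.
Qed.

(** The first rho is already chosen, and bs2 holds the later factors that chose g. Expanding the
    remaining kap one at a time either produces a second rho, where Hoelder stops the expansion at
    cost c, or ends with a single rho, where [one_zero] applies. *)
Let oneP bs1 b bs2 bs3 : (size bs1 + size bs2 + size bs3).+1 = t ->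
  convs ([seq sgn_meas b' g | b' <- bs1] ++ sgn_meas b rho :: [seq sgn_meas b' g | b' <- bs2]
          ++ [seq sgn_meas b' kap | b' <- bs3]) 0 <= (size bs3)%:R * c.
Proof.
elim: bs3 bs2 => [|b' bs3 IH] bs2 /= sz; first by rewrite cats0 one_zero mul0r.
rewrite {1}/kap sgn_meas_cat -cat_cons catA convs_mid_cat -natr1 mulrDl mul1r addrC.
apply: lerD.
  rewrite -catA cat_cons.
  have := IH (rcons bs2 b'); rewrite map_rcons cat_rcons; apply.
  by rewrite size_rcons -sz; lia.
apply: le_trans (convs_hoelder (m := m) _ _ _) _.
- by rewrite size_cat /= size_cat /= !size_map -/t -sz; lia.
- by rewrite ?all_cat /= ?all_cat /= !all_nonneg_sgn // !nonneg_sgn p_rho.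
rewrite big_cat big_cat /= !big_cons !prod_enorm_sgn // !enorm_sgn //.
rewrite /c -sz (_ : (_.+1 - 2 = size bs1 + size bs2 + size bs3)%N) ?exprD; last by lia.
set r := enorm _ rho; set G1 := _ ^+ size bs1; set G2 := _ ^+ size bs2; set G3 := _ ^+ size bs3.
have -> : G1 * (r * G2) * (r * G3) = r ^+ 2 * (G1 * G2 * G3) by ring.
rewrite ler_wpM2l ?sqr_ge0 //.
by do 2?[apply: ler_pM; rewrite ?mulr_ge0 ?exprn_ge0 ?enorm_ge0 //]; apply: ler_expX; rewrite ?enorm_ge0.
Qed.

(** The expansion of kap = rho + g is sorted by the first factor that chooses rho: at most t
    positions for it and at most t for the second one, hence the t^2. *)
Lemma energy_two_of : energy m.+1 kap <= energy m.+1 g + (t ^ 2)%:R * c.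
Proof.
have c0 : 0 <= c by rewrite mulr_ge0 ?sqr_ge0 ?exprn_ge0.
have H bs1 bs2 : (size bs1 + size bs2)%N = t ->
   convs ([seq sgn_meas b' g | b' <- bs1] ++ [seq sgn_meas b' kap | b' <- bs2]) 0 <=
   convs [seq sgn_meas b' g | b' <- bs1 ++ bs2] 0 + (size bs2 * t)%:R * c.
  elim: bs2 bs1 => [|b bs2 IH] bs1 /= sz; first by rewrite !cats0 mul0n mul0r addr0.
  rewrite {1}/kap sgn_meas_cat convs_mid_cat addrC.
  have -> : bs1 ++ b :: bs2 = rcons bs1 b ++ bs2 by rewrite cat_rcons.
  rewrite mulSn addnC natrD mulrDl addrA; apply: lerD.
    have := IH (rcons bs1 b); rewrite map_rcons cat_rcons; apply.
    by rewrite size_rcons -sz; lia.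
  apply: le_trans (oneP (bs2 := [::]) b _) _ => /=; first by rewrite -sz /=; lia.
  by rewrite ler_wpM2r // ler_nat -sz; lia.
have := H [::] (signs m.+1); rewrite /= -/(signs m.+1) size_signs -mulnn; apply.
by rewrite add0n.
Qed.
End TwoOf.
End Energy.

(** * Valuations and the additive energy *)

Section Query.
Variable R : realType.
Implicit Types (mu nu h : seq (int * R)) (A : seq int) (z : int).

Definition lev (p : nat) (z : int) : nat := logn p `|z|%N.

Lemma convs_dvdz (d : nat) (mus : seq (seq (int * R))) z :
  (forall mu x, mu \in mus -> x \in mu -> (d %| `|x.1|)%N) ->
  ~~ (d %| `|z|)%N -> convs mus z = 0.
Proof.
elim: mus z => [|mu mus IH] z hd hz.
  rewrite /convs /= /dirac0; case: eqP => // z0.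
  by move: hz; rewrite z0 dvdn0.
rewrite /= /conv big_seq big1 // => x hx; rewrite -/(convs _) IH ?mulr0 //.
  by move=> nu y hn; apply: hd; rewrite inE hn orbT.
have h1 : (d %| `|x.1|)%N by apply: (hd mu) => //; rewrite inE eqxx.
apply: contra hz => h2; have : (d%:Z %| z)%Z; last by rewrite dvdzE.
rewrite -(subrK x.1 z) rpredD // dvdzE //.
Qed.

Lemma mem_sgn_meas b mu x : x \in sgn_meas b mu -> exists2 y, y \in mu & `|x.1|%N = `|y.1|%N.
Proof.
case: b => /=; first by exists x.
by case/mapP => y hy -> /=; exists y; rewrite // abszN.
Qed.

(** Modulo p^(J+1) only the point of rho survives, so the signed sum cannot be 0. *)
Lemma convs_one_low (p J : nat) (rho g : seq (int * R)) bs1 b bs2 : prime p ->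
  (forall x, x \in rho -> x.1 != 0 /\ lev p x.1 = J) ->
  (forall x, x \in g -> x.1 != 0 /\ (J < lev p x.1)%N) ->
  convs ([seq sgn_meas b' g | b' <- bs1] ++ sgn_meas b rho :: [seq sgn_meas b' g | b' <- bs2]) 0 = 0.
Proof.
move=> pp hr hg; rewrite convs_mid -map_cat /conv big_seq big1 // => x /mem_sgn_meas [y hy e].
rewrite (convs_dvdz (d := (p ^ J.+1)%N)) ?mulr0 //.
  move=> mu w /mapP[b' _ ->] /mem_sgn_meas[v hv ->].
  have [v0 hJ] := hg _ hv; rewrite pfactor_dvdn //; lia.
rewrite sub0r abszN e; have [y0 hJ] := hr _ hy.
rewrite pfactor_dvdn -/(lev p y.1) ?hJ ?ltnn //; lia.
Qed.

Definition mfib (p j : nat) mu := [seq x <- mu | lev p x.1 == j].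

Lemma val_at_filter (P : pred int) mu z :
  val_at [seq x <- mu | P x.1] z = if P z then val_at mu z else 0.
Proof.
rewrite !val_atE big_filter_cond; case: ifP => hz.
  by apply: eq_bigl => x; case: eqP => [->|]; rewrite ?hz ?andbF.
by rewrite big1 // => x /andP[h /eqP e]; move: h; rewrite e hz.
Qed.

Lemma nonneg_filter (P : pred (int * R)) mu : nonneg mu -> nonneg (seq.filter P mu).
Proof. by move=> /allP h; apply/allP => x; rewrite mem_filter => /andP[_ /h]. Qed.

(* The p-adic valuation is attained at least twice at its minimum in any
   vanishing signed sum, so peeling off one level costs at most t^2 pairs. *)
Lemma enorm_query m (p B : nat) h : prime p -> nonneg h ->
  (forall x, x \in h -> x.1 != 0 /\ (lev p x.1 < B)%N) ->
  enorm m.+1 h ^+ 2 <= ((2 ^ m.+1) ^ 2)%:R * \sum_(0 <= j < B) enorm m.+1 (mfib p j h) ^+ 2.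
Proof.
move=> pp hp hx; set t := (2 ^ m.+1)%N; set n := enorm m.+1 h.
have n0 : 0 <= n := enorm_ge0 _ _.
have t2 : (2 <= t)%N by rewrite /t expnS; have := expn_gt0 2 m; lia.
pose up J := [seq x <- h | (J <= lev p x.1)%N].
have pup J : nonneg (up J) by apply: nonneg_filter.
(* Descends through the levels: [up (B - d)] keeps the valuations at least B - d, and each further
   level is one application of [energy_two_of]. No [up J] has norm above n, so a common factor
   n^(t-2) comes out. *)
have key d : (d <= B)%N -> energy m.+1 (up (B - d)%N) <=
    (t ^ 2)%:R * (\sum_((B - d)%N <= j < B) enorm m.+1 (mfib p j h) ^+ 2) * n ^+ (t - 2).
  elim: d => [|d IH] dB.
    rewrite subn0 big_geq // mulr0 mul0r -enormX //.
    have -> : up B = [::].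
      apply/eqP; rewrite -(negbK (_ == _)) -has_filter -all_predC; apply/allP => x /hx[_] /=.
      by rewrite -ltnNge.
    by rewrite enorm_nil expr0n expn_eq0.
  set J := (B - d.+1)%N; have eJ : (B - d = J.+1)%N by rewrite /J; lia.
  rewrite eJ in IH; have JB : (J < B)%N by rewrite /J; lia.
  rewrite big_ltn // mulrDr mulrDl.
  have eup y : val_at (up J) y = val_at (mfib p J h ++ up J.+1) y.
    rewrite /val_at conv_cat -!/(val_at _ _).
    rewrite (val_at_filter (fun z => J <= lev p z)%N) (val_at_filter (fun z => lev p z == J)).
    rewrite (val_at_filter (fun z => J < lev p z)%N).
    by case: ltngtP; rewrite ?addr0 ?add0r.
  have pm : nonneg (mfib p J h) by apply: nonneg_filter.
  have pc : nonneg (mfib p J h ++ up J.+1) by rewrite nonneg_cat pm pup.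
  apply: le_trans (_ : energy m.+1 (mfib p J h ++ up J.+1) <= _).
    by apply: ler_energy => // y; rewrite eup.
  apply: le_trans (energy_two_of (n := n) pm (pup _) _ _) _.
  - move=> bs1 b bs2; apply: (convs_one_low _ _ _ pp (J := J)) => x;
      rewrite mem_filter => /andP[h1 /hx[h2 h3]]; split => //; exact/eqP.
  - apply: ler_enorm => // y; rewrite -eup (val_at_filter (fun z => J <= lev p z)%N).
    by case: ifP => _ //; apply: val_at_ge0.
  by rewrite addrC -!mulrA lerD2l !mulrA; apply: IH; lia.
have := key B (leqnn _); rewrite subnn.
have -> : up 0%N = h by apply/all_filterP/allP.
rewrite -enormX // -/n -/t.
set S := \sum_(_ <= _ < _) _.
have [->|nn0] := eqVneq n 0.
  rewrite [0 ^+ 2]expr0n /= => _; apply: mulr_ge0 => //; apply: sumr_ge0 => j _; exact: sqr_ge0.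
have np : 0 < n by rewrite lt_def nn0.
have -> : n ^+ t = n ^+ 2 * n ^+ (t - 2) by rewrite -exprD; congr (_ ^+ _); lia.
by rewrite ler_pM2r ?exprn_gt0.
Qed.

Definition fib (p j : nat) A := [seq a <- A | lev p a == j].

(* The dual of a bound on the additive energy norm: along a fixed list of primes,
   each step either keeps a single fibre of the valuation or splits into all
   fibres at the price L of enorm_query. *)
Fixpoint qdim (L : R) (B : nat) (ps : seq nat) (A : seq int) : R :=
  if ps is p :: ps' then
    Num.max (\big[Num.max/0]_(0 <= j < B) qdim L B ps' (fib p j A))
            (Num.sqrt (L^-1 * \sum_(0 <= j < B) qdim L B ps' (fib p j A) ^+ 2))
  else (A != [::])%:R.

Lemma qdim_ge0 L B ps A : 0 <= qdim L B ps A.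
Proof.
by case: ps => [|p ps] /=; [apply: ler0n | rewrite le_max sqrtr_ge0 orbT].
Qed.

Lemma ler_bigmax_nat (B : nat) (f : nat -> R) j : (j < B)%N -> f j <= \big[Num.max/0]_(0 <= i < B) f i.
Proof.
move=> jB; have : j \in index_iota 0 B by rewrite mem_index_iota.
elim: (index_iota 0 B) => // i r IH; rewrite inE big_cons le_max => /orP[/eqP <-|/IH ->].
  by rewrite lexx.
by rewrite orbT.
Qed.

Lemma qdim_fib L B p ps A j : (j < B)%N -> qdim L B ps (fib p j A) <= qdim L B (p :: ps) A.
Proof. by move=> h; rewrite /= le_max (ler_bigmax_nat (fun j => qdim L B ps (fib p j A))). Qed.

Lemma sum_qdim_fib L B p ps A : 0 < L ->
  \sum_(0 <= j < B) qdim L B ps (fib p j A) ^+ 2 <= L * qdim L B (p :: ps) A ^+ 2.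
Proof.
move=> L0; set S := \sum_(_ <= _ < _) _.
have S0 : 0 <= L^-1 * S.
  apply: mulr_ge0; first by rewrite invr_ge0 ltW.
  by apply: sumr_ge0 => j _; apply: sqr_ge0.
rewrite -ler_pdivrMl //; apply: le_trans (_ : Num.sqrt (L^-1 * S) ^+ 2 <= _).
  by rewrite sqr_sqrtr.
by apply: ler_expX; rewrite ?sqrtr_ge0 //= le_max lexx orbT.
Qed.

Lemma filter_bigcat (T : Type) (P : pred T) (B : nat) (f : nat -> seq T) :
  seq.filter P (\big[cat/[::]]_(0 <= i < B) f i) = \big[cat/[::]]_(0 <= i < B) seq.filter P (f i).
Proof.
elim: B => [|B IH]; first by rewrite !big_geq.
by rewrite !big_nat_recr //= filter_cat IH.
Qed.

Lemma mass_bigcat (B : nat) (f : nat -> seq (int * R)) :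
  mass (\big[cat/[::]]_(0 <= i < B) f i) = \sum_(0 <= i < B) mass (f i).
Proof.
elim: B => [|B IH]; first by rewrite !big_geq // /mass big_nil.
by rewrite !big_nat_recr //= mass_cat IH.
Qed.

Lemma mem_bigcat_nat (T : eqType) (B : nat) (f : nat -> seq T) x :
  x \in \big[cat/[::]]_(0 <= i < B) f i -> exists2 i, (i < B)%N & x \in f i.
Proof.
elim: B => [|B IH]; first by rewrite big_geq.
rewrite big_nat_recr //= mem_cat => /orP[/IH[i h1 h2]|h]; last by exists B.
by exists i => //; apply: ltnW.
Qed.

Lemma bigcat_only (T : Type) (B j : nat) (f : nat -> seq T) : (j < B)%N ->
  (forall i, i != j -> f i = [::]) -> \big[cat/[::]]_(0 <= i < B) f i = f j.
Proof.
move=> + h; elim: B => // B IH; rewrite big_nat_recr //= ltnS leq_eqVlt => /orP[/eqP e|hj].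
  rewrite -e big_nat big1 // => i /andP[_ ij]; apply: h; lia.
by rewrite IH // [f B]h ?cats0 //; lia.
Qed.

(** The test measure follows the recursion: a maximum passes on the better witness. For a split,
    with D_j the dimensions of the fibres and S the sum of D_j^2, the fibre witnesses get the
    weights c_j = D_j / sqrt(L S), the equality case of Cauchy-Schwarz: L times the sum of c_j^2 is
    1, which [enorm_query] turns into norm at most 1, and the mass is at least sqrt(S / L). *)
Lemma qdim_dual m B ps A : all prime ps ->
  (forall a, a \in A -> a != 0 /\ forall p, p \in ps -> (lev p a < B)%N) ->
  exists F : seq (int * R), [/\ nonneg F, (forall x, x \in F -> x.1 \in A),
    enorm m.+1 F <= 1 & qdim ((2 ^ m.+1) ^ 2)%:R B ps A <= mass F].
Proof.
set L : R := _%:R; have L0 : 0 < L by rewrite ltr0n !expn_gt0.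
elim: ps A => [|p ps IH] A.
  move=> _ _; case: A => [|a A] /=.
    by exists [::]; split=> //; rewrite ?enorm_nil // /mass big_nil.
  exists [:: (a, 1)]; split.
  - by rewrite /nonneg /= ler01.
  - by move=> x; rewrite inE => /eqP -> /=; rewrite inE eqxx.
  - by apply: le_trans (enorm_le_mass _ _) _; rewrite /nonneg /= ?ler01 // /mass big_seq1.
  - by rewrite /mass big_seq1.
move=> /andP[pp pps] hA.
have /choice[F hF] : forall j, exists F : seq (int * R), [/\ nonneg F,
    (forall x, x \in F -> x.1 \in fib p j A),
    enorm m.+1 F <= 1 & qdim L B ps (fib p j A) <= mass F].
  move=> j; apply: IH => // a; rewrite mem_filter => /andP[_ /hA[h1 h2]]; split=> // r hr.
  by apply: h2; rewrite inE hr orbT.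
have Fsub j x : x \in F j -> x.1 \in A.
  by move=> hx; case: (hF j) => _ /(_ _ hx) + _ _; rewrite mem_filter => /andP[].
pose good (y : R) := exists F : seq (int * R), [/\ nonneg F, (forall x, x \in F -> x.1 \in A),
    enorm m.+1 F <= 1 & y <= mass F].
have good0 : good 0.
  by exists [::]; split=> //; rewrite ?enorm_nil // /mass big_nil.
have goodmax x y : good x -> good y -> good (Num.max x y) by move=> hx hy; rewrite /Num.max; case: ifP.
rewrite -/(good _) [qdim _ _ _ _]/=; apply: (goodmax).
  apply: (big_ind good) => // j _; case: (hF j) => h1 h2 h3 h4.
  by exists (F j); split => // x; apply: Fsub.
set D := fun j => qdim L B ps (fib p j A); set S := \sum_(_ <= _ < _) _.
have D0 j : 0 <= D j := qdim_ge0 _ _ _ _.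
have S0 : 0 <= S by apply: sumr_ge0 => j _; apply: sqr_ge0.
have [S00|Sn0] := eqVneq S 0; first by rewrite S00 mulr0 sqrtr0.
have Sp : 0 < S by rewrite lt_def Sn0.
set r := Num.sqrt (L * S); have rp : 0 < r by rewrite sqrtr_gt0 mulr_gt0.
have r2 : r ^+ 2 = L * S by rewrite sqr_sqrtr // mulr_ge0 // ltW.
pose c j := D j / r; have c0 j : 0 <= c j by rewrite divr_ge0 // ltW.
pose E := \big[cat/[::]]_(0 <= j < B) scale (c j) (F j).
have pF j : nonneg (F j) by case: (hF j).
have hE x : x \in E -> x.1 \in A.
  by move=> /mem_bigcat_nat[j _ /mapP[y hy ->]]; apply: Fsub hy.
have pE : nonneg E.
  rewrite /E; elim: (B) => [|b IHb]; first by rewrite big_geq.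
  by rewrite big_nat_recr //= nonneg_cat IHb nonneg_scale.
exists E; split => //.
- apply: (@le_root _ 2) => //; rewrite expr1n.
  apply: le_trans (enorm_query _ pp pE _) _ => [x /hE /hA[h1 h2]|].
    by split => //; apply: h2; rewrite inE eqxx.
  apply: (@le_trans _ _ (L * \sum_(0 <= j < B) c j ^+ 2)).
    apply: ler_wpM2l; first exact: ltW.
    rewrite !big_nat; apply: ler_sum => j jB.
    apply: ler_expX; rewrite ?enorm_ge0 // /mfib /E filter_bigcat.
    rewrite (bigcat_only (j := j)) //; last first.
      move=> i ij; apply/eqP; rewrite -(negbK (_ == _)) -has_filter -all_predC.
      apply/allP => x /mapP[y hy ->] /=; case: (hF i) => _ /(_ _ hy) + _ _.
      by rewrite mem_filter => /andP[/eqP -> _].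
    have -> : [seq x <- scale (c j) (F j) | lev p x.1 == j] = scale (c j) (F j).
      apply/all_filterP/allP => x /mapP[y hy ->] /=; case: (hF j) => _ /(_ _ hy) + _ _.
      by rewrite mem_filter => /andP[].
    rewrite enorm_scale // -[leRHS]mulr1 ler_wpM2l //; by case: (hF j).
  rewrite /c; under eq_bigr do rewrite expr_div_n.
  by rewrite -mulr_suml -/S r2 mulrA divff // mulf_neq0 // gt_eqF.
- rewrite mass_bigcat; apply: (@le_trans _ _ (\sum_(0 <= j < B) D j ^+ 2 / r)).
    rewrite -mulr_suml -/S; apply: (@le_root _ 2) => //; first by rewrite divr_ge0 ?ltW.
    rewrite sqr_sqrtr; last by rewrite mulr_ge0 ?invr_ge0 ?ltW.
    rewrite expr_div_n r2.
    have -> : L^-1 * S = S ^+ 2 / (L * S);last exact: lexx.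
    have Ln0 : L != 0 by rewrite gt_eqF.
    by clearbody L; field; rewrite Sn0 Ln0.
  apply: ler_sum => j _; rewrite mass_scale /c [leRHS]mulrAC ler_pM2r ?invr_gt0 //.
  by rewrite expr2 ler_wpM2l //; case: (hF j).
Qed.
End Query.

(** * Greedy removal of subsets with small additive norm *)

Section GreedyRemoval.
Variable R : realType.
Implicit Types (A S : seq int).

(** Counting measure of A pushed forward by phi: [id] gives the additive energy, [valuations] the
    multiplicative one. Weights of colliding images add up. *)
Definition unif (G : zmodType) (phi : int -> G) A : seq (G * R) := [seq (phi a, 1) | a <- A].

Lemma nonneg_unif (G : zmodType) (phi : int -> G) A : nonneg (unif phi A).
Proof. by rewrite /nonneg all_map; apply/allP => a _ /=; apply: ler01. Qed.

Lemma mass_unif (G : zmodType) (phi : int -> G) A : mass (unif phi A) = (size A)%:R.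
Proof. by rewrite /mass big_map big_const_seq count_predT iter_addr addr0. Qed.

Lemma val_at_unif_id A z : uniq A -> val_at (unif id A) z = (z \in A)%:R.
Proof.
move=> uA; rewrite val_atE big_map /= -big_filter; case: (boolP (z \in A)) => hz.
  by rewrite (eq_filter (a2 := pred1 z)) // filter_pred1_uniq // big_seq1.
rewrite big_filter big_seq_cond big1 // => a /andP[ha /eqP e].
by move: hz; rewrite -e ha.
Qed.

Lemma enorm_unif_perm (G : zmodType) (phi : int -> G) m A S : perm_eq A S ->
  enorm m.+1 (unif phi A) = enorm m.+1 (unif phi S).
Proof.
move=> h; apply: eq_enorm; rewrite ?nonneg_unif // => y.
by rewrite !val_atE !big_map; apply: perm_big.
Qed.

Lemma level_cover (q v : R) n : 1 <= q -> 0 <= v -> v <= 1 ->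
  v <= q ^- n \/ exists2 j, (j < n)%N & (q ^- j.+1 < v <= q ^- j).
Proof.
move=> q1 v0 v1; elim: n => [|n [IH|[j h1 h2]]].
- by left; rewrite expr0 invr1.
- have [h|h] := leP v (q ^- n.+1); first by left.
  by right; exists n; rewrite // h IH.
- by right; exists j => //; apply: ltnW.
Qed.

(* Otherwise each of the eight level sets of F between q^-8 and 1 is small,
   and the mass of F is at most 8 * (q^2/8) + 1. *)
Lemma level_set_concentration m (q : R) A (F : seq (int * R)) : uniq A -> 1 <= q ->
  (size A)%:R <= q ^+ 8 -> nonneg F -> (forall x, x \in F -> x.1 \in A) ->
  enorm m.+1 F <= 1 -> 2 * q ^+ 2 < mass F ->
  exists P : pred int, [seq a <- A | P a] != [::] /\
    enorm m.+1 (unif id [seq a <- A | P a]) <= 8 / q * (size [seq a <- A | P a])%:R.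
Proof.
move=> uA q1 szA pF hF nF mF; have q0 : 0 < q by apply: lt_le_trans q1.
have q0' : 0 <= q := ltW q0.
pose P j a := q ^- j.+1 < val_at F a <= q ^- j.
pose S j := [seq a <- A | P j a].
have [[j [h1 h2]]|/forallNP hno] := pselect (exists j, S j != [::] /\
    enorm m.+1 (unif id (S j)) <= 8 / q * (size (S j))%:R); first by exists (P j).
exfalso; have small j : (size (S j))%:R <= q ^+ j.+2 / 8.
  have [->|/eqP Sn] := eqVneq (S j) [::]; first by rewrite divr_ge0 ?exprn_ge0.
  have hlt : 8 / q * (size (S j))%:R < enorm m.+1 (unif id (S j)).
    by rewrite ltNge; apply/negP => h; apply: (hno j); split => //; apply/eqP.
  (* F exceeds q^-(j+1) on S_j, so the indicator of S_j is at most q^(j+1) F, and F has norm at most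
     1. *)
  have : enorm m.+1 (unif id (S j)) <= q ^+ j.+1.
    apply: (@le_trans _ _ (enorm m.+1 (scale (q ^+ j.+1) F))); last first.
      by rewrite enorm_scale ?exprn_ge0 // ler_piMr ?exprn_ge0 //.
    apply: ler_enorm; rewrite ?nonneg_unif ?nonneg_scale ?exprn_ge0 // => y.
    rewrite val_at_unif_id ?filter_uniq // [leRHS]conv_scale -/(val_at _ _) mem_filter.
    case: (boolP (P j y)) => [/andP[h _]|_] /=; last by rewrite mulr_ge0 ?exprn_ge0 ?val_at_ge0.
    apply: (@le_trans _ _ 1); first by case: (_ \in _).
    by rewrite -ler_pdivrMl ?exprn_gt0 // mulr1 ltW.
  move=> h; have := lt_le_trans hlt h; rewrite mulrAC ltr_pdivrMr // -exprSr.
  lra.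
have : mass F <= q ^+ 2 + 1.
  rewrite (mass_val_at uA hF).
  apply: (@le_trans _ _ (\sum_(a <- A) (\sum_(0 <= j < 8) (P j a)%:R * q ^- j + q ^- 8))).
    apply: ler_sum => a _; have v0 := val_at_ge0 a pF.
    have v1 : val_at F a <= 1 := le_trans (val_at_le_enorm m a pF) nF.
    have ge0 j : 0 <= (P j a)%:R * q ^- j by rewrite mulr_ge0 ?invr_ge0 ?exprn_ge0.
    case: (level_cover 8 q1 v0 v1) => [h|[j j8 h]].
      by apply: (le_trans h); rewrite lerDr; apply: sumr_ge0.
    apply: (@le_trans _ _ ((P j a)%:R * q ^- j)).
      by have -> : P j a by []; rewrite mul1r; case/andP: h.
    rewrite -[leLHS]addr0; apply: lerD; last by rewrite invr_ge0 exprn_ge0.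
    by rewrite (bigD1_seq j) /= ?mem_index_iota ?iota_uniq // lerDl sumr_ge0.
  rewrite big_split /= exchange_big /=; apply: lerD.
    apply: (@le_trans _ _ (\sum_(0 <= j < 8) q ^+ 2 / 8)).
      apply: ler_sum => j _; rewrite -mulr_suml.
      have -> : \sum_(a <- A) (P j a)%:R = (size (S j))%:R :> R.
        by rewrite -natr_sum size_filter -sum1_count [in RHS]big_mkcond.
      rewrite ler_pdivrMr ?exprn_gt0 // mulrAC -exprD; exact: small.
    by rewrite sumr_const_nat subn0; lra.
  rewrite big_const_seq count_predT iter_addr addr0 -mulr_natl ler_pdivrMr ?exprn_gt0 // mul1r.
  exact: szA.
have : 1 <= q ^+ 2 by rewrite exprn_ege1.
lra.
Qed.

(** While the query dimension exceeds 2 q^2, the dual witness has mass above 2 q^2 and supplies a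
    nonempty set to remove. The ratio 8 / q does not degrade over the removals: sizes of disjoint
    pieces add up and norms are subadditive. *)
Lemma greedy_removal m B ps (q : R) A : uniq A -> 1 <= q -> (size A)%:R <= q ^+ 8 -> all prime ps ->
  (forall a, a \in A -> a != 0 /\ forall p, p \in ps -> (lev p a < B)%N) ->
  exists P : pred int,
    enorm m.+1 (unif id [seq a <- A | P a]) <= 8 / q * (size [seq a <- A | P a])%:R /\
    qdim ((2 ^ m.+1) ^ 2)%:R B ps [seq a <- A | ~~ P a] <= 2 * q ^+ 2.
Proof.
move=> + q1 + pps; have [n] := ubnP (size A); elim: n A => // n IH A szn uA szA hA.
have [h|hlt] := leP (qdim ((2 ^ m.+1) ^ 2)%:R B ps A) (2 * q ^+ 2).
  exists pred0; rewrite filter_pred0 /unif /= enorm_nil mulr0; split => //.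
  by rewrite (eq_filter (a2 := predT)) // filter_predT.
have [F [pF hF nF mF]] := @qdim_dual R m B ps A pps hA.
have [P [hP1 hP2]] := level_set_concentration uA q1 szA pF hF nF (lt_le_trans hlt mF).
set A' := [seq a <- A | ~~ P a].
have sz' : (size A' + size [seq a <- A | P a])%N = size A.
  by rewrite !size_filter addnC count_predC.
have szP : (0 < size [seq a <- A | P a])%N by rewrite lt0n size_eq0.
have [||||Q [hQ1 hQ2]] := IH A'.
- by rewrite ltnS in szn; apply: leq_trans szn; rewrite -sz' -addn1 leq_add2l.
- by rewrite filter_uniq.
- by apply: le_trans szA; rewrite ler_nat -sz' leq_addr.
- by move=> a; rewrite mem_filter => /andP[_]; apply: hA.
exists (fun a => P a || Q a); split; last first.
  rewrite (eq_filter (a2 := predI (predC Q) (predC P))) ?filter_predI //.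
  by move=> a /=; rewrite negb_or andbC.
have pe : perm_eq [seq a <- A | P a || Q a] ([seq a <- A | P a] ++ [seq a <- A' | Q a]).
  rewrite perm_sym; have /permPl := perm_filterC P [seq a <- A | P a || Q a].
  have -> : [seq a <- [seq a <- A | P a || Q a] | P a] = [seq a <- A | P a].
    by rewrite -filter_predI; apply: eq_filter => a /=; case: (P a).
  have -> // : [seq a <- [seq a <- A | P a || Q a] | predC P a] = [seq a <- A' | Q a].
  by rewrite /A' -!filter_predI; apply: eq_filter => a /=; case: (P a); case: (Q a).
rewrite (enorm_unif_perm _ _ pe) (perm_size pe) size_cat natrD mulrDr /unif map_cat.
apply: le_trans (enorm_cat _ _ _) _; rewrite ?nonneg_unif //.
by apply: lerD.
Qed.
End GreedyRemoval.

(** * Anticoncentration on the integers *)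

Section ThreeSum.
Variable R : realType.
Implicit Types (mu : seq (int * R)) (X T : seq int) (z : int).

Lemma exists_min_seq T : T != [::] -> exists2 w0, w0 \in T & forall w, w \in T -> w0 <= w.
Proof.
elim: T => // a [|b T] IH _.
  by exists a; rewrite ?inE // => w; rewrite inE => /eqP ->.
case: IH => // w0 h1 h2; have [h|h] := leP a w0.
  exists a; first by rewrite inE eqxx.
  by move=> w; rewrite inE => /orP[/eqP -> //|/h2]; apply: le_trans.
exists w0; first by rewrite inE h1 orbT.
by move=> w; rewrite inE => /orP[/eqP ->|/h2 //]; apply: ltW.
Qed.

Lemma count_le_pairs X : uniq X ->
  ((\sum_(x <- X) count (fun x' => (x' <= x)%R) X).*2 = size X ^ 2 + size X)%N.
Proof.
move=> uX; have H (P : rel int) : (\sum_(x <- X) count (P x) X =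
    \sum_(x <- X) \sum_(x' <- X) P x x')%N.
  by apply: eq_bigr => x _; rewrite -sum1_count big_mkcond; apply: eq_bigr => y _; case: (P x y).
rewrite -addnn (H (fun x x' => (x' <= x)%R)) {2}exchange_big -big_split /=.
have E x : x \in X -> (\sum_(x' <- X) (x' <= x)%R + \sum_(x' <- X) (x <= x')%R = size X + 1)%N.
  move=> hx; rewrite -big_split /= (eq_bigr (fun x' : int => 1 + (x' == x))%N); last first.
    by move=> y _; case: (ltgtP y x).
  rewrite big_split /= sum1_size; congr (_ + _)%N.
  by rewrite (bigD1_seq x) //= eqxx big1 // => y /negbTE ->.
rewrite big_seq (eq_bigr (fun=> (size X + 1)%N)); last exact: E.
rewrite -big_seq.
by rewrite big_const_seq count_predT iter_addn_0 mulnDl mul1n mulnn.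
Qed.

(** The order of Z enters here. All shifts w - w0 are nonnegative, so for fixed x the map w -> x -
    (w - w0) injects the counted w into the elements of X that are at most x. In a finite group X
    could be stable under all the shifts. *)
Lemma sum_shift_count_le X T w0 : uniq X -> uniq T -> (forall w, w \in T -> w0 <= w) ->
  (\sum_(w <- T) count (fun x => (x - (w - w0))%R \in X) X <=
   \sum_(x <- X) count (fun x' => (x' <= x)%R) X)%N.
Proof.
move=> uX uT hT.
have -> : (\sum_(w <- T) count (fun x => (x - (w - w0))%R \in X) X =
  \sum_(x <- X) count (fun w => (x - (w - w0))%R \in X) T)%N.
  transitivity (\sum_(w <- T) \sum_(x <- X) ((x - (w - w0))%R \in X))%N.
    by apply: eq_bigr => w _; rewrite -sum1_count big_mkcond; apply: eq_bigr => x _; case: ifP.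
  rewrite exchange_big; apply: eq_bigr => x _.
  by rewrite -sum1_count [in RHS]big_mkcond; apply: eq_bigr => w _; case: ifP.
apply: leq_sum => x _; rewrite -!size_filter.
rewrite -(size_map (fun w => x - (w - w0))); apply: uniq_leq_size.
  by rewrite map_inj_uniq ?filter_uniq // => a b; lia.
move=> y /mapP[w]; rewrite mem_filter => /andP[h1 h2] ->; rewrite mem_filter h1 andbT.
by have := hT _ h2; lia.
Qed.

(* Markov's inequality for b - h *)
Lemma heavy_part mu (h : int -> R) (b eps lam : R) : nonneg mu -> mass mu = 1 ->
  (forall y, h y <= b) -> 0 < lam -> b - eps <= \sum_(p <- mu) p.2 * h p.1 ->
  1 - eps / lam <= \sum_(p <- mu | b - lam < h p.1) p.2.
Proof.
move=> /allP p1 m1 hb lam0 hs.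
have H : \sum_(p <- mu) p.2 * h p.1 <= (b - lam) * mass mu + lam * \sum_(p <- mu | b - lam < h p.1) p.2.
  rewrite /mass [X in lam * X]big_mkcond !mulr_sumr -big_split /= !big_seq.
  apply: ler_sum => p hp; have := p1 _ hp; have := hb p.1; case: ltP => h1 h2 h3; nra.
rewrite m1 mulr1 in H; have := le_trans hs H => E.
by rewrite lerBlDr -lerBlDl ler_pdivlMr //; lra.
Qed.

Lemma sum_le_count mu (q : R) (P : pred int) (Y : seq int) : nonneg mu -> (forall z, val_at mu z <= q) ->
  uniq Y -> (forall p, p \in mu -> P p.1 -> p.1 \in Y) ->
  \sum_(p <- mu | P p.1) p.2 <= q * (size Y)%:R.
Proof.
move=> p1 hq uY hY.
have q0 : 0 <= q := le_trans (val_at_ge0 0 p1) (hq 0).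
apply: (@le_trans _ _ (\sum_(y <- Y) val_at mu y)); last first.
  apply: (@le_trans _ _ (\sum_(y <- Y) q)); first exact: ler_sum.
  by rewrite big_const_seq count_predT iter_addr addr0 mulr_natr.
under [leRHS]eq_bigr do rewrite val_atE big_mkcond /=.
rewrite exchange_big /= [leLHS]big_mkcond /= !big_seq; apply: ler_sum => p hp.
have p0 : 0 <= p.2 by apply: (allP p1).
case: ifP => h; last by apply: sumr_ge0 => y _; case: ifP.
by rewrite (bigD1_seq p.1) ?(hY _ hp) //= eqxx lerDl sumr_ge0 // => y _; case: ifP.
Qed.

(** In units of q^-2, s is at least (9/10)^2 = 0.81; since N >= 3 gives (N^2 + N) / 2 <= 2 N^2 / 3,
    it is also at most (2/3) (20/19)^2 < 0.74. *)
Lemma three_sum_arith (n N s q : R) : 0 < q -> 9 / 10 <= q * n -> N * (q * (19 / 20)) <= 1 ->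
  n * (9 / 10 / q) <= s -> 2 * s <= N ^+ 2 + N -> 3 <= N -> False.
Proof.
move=> q0 nT nX; rewrite mulrA ler_pdivrMr // => Sq hS N3.
have a1 : (9 / 10) ^+ 2 <= s * q ^+ 2 by nra.
have a0 : 3 * N <= N ^+ 2 by rewrite expr2 ler_wpM2r //; lra.
have a2 : s <= 2 / 3 * N ^+ 2 by lra.
have a3 : (N * q) ^+ 2 <= (20 / 19) ^+ 2 by apply: ler_expX; [rewrite mulr_ge0 //; lra|lra].
have a4 : s * q ^+ 2 <= 2 / 3 * (N * q) ^+ 2.
  by rewrite exprMn [leRHS]mulrA ler_wpM2r // exprn_ge0 // ltW.
lra.
Qed.

(* If q(f*g*e) were close to q, all three laws would be nearly uniform on sets
   of about 1/q integers; but in Z the difference set of such a set is too large. *)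
Lemma three_sum (f g e : seq (int * R)) (q : R) z : nonneg f -> nonneg g -> nonneg e ->
  mass f = 1 -> mass g = 1 -> mass e = 1 ->
  (forall z, val_at f z <= q) -> (forall z, val_at g z <= q) -> (forall z, val_at e z <= q) ->
  q <= 8 / 9 -> conv f (conv g (val_at e)) z <= (1 - 4000^-1) * q.
Proof.
move=> pf pg pe mf mg me hf hg he q89.
rewrite leNgt; apply/negP => hlt.
have inj (w : int) : injective (fun y => w - y) := inv_inj (subKr w).
pose F := conv g (val_at f).
have hF w : F w <= q by rewrite -[q]mul1r -mg; apply: conv_le_mass.
have E : conv f (conv g (val_at e)) z = conv e F z.
  by rewrite /val_at convC (convC f) convC convC.
have q0 : 0 < q.
  have : conv e F z <= q by rewrite -[q]mul1r -me; apply: conv_le_mass.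
  rewrite -E; lra.
(* Two nested uses of Markov: the deficit q / 4000 leaves mass 9/10 of e where F is within q / 400
   of q, and for each such value w mass 19/20 of g sits where f is within q / 20 of q. *)
pose T := [seq w <- undup [seq z - y | y <- supp e] | q - q / 400 < F w].
have uT : uniq T by rewrite filter_uniq ?undup_uniq.
have nT : 9 / 10 <= q * (size T)%:R.
  have q400 : 0 < q / 400 by clear - q0; lra.
  have h := @heavy_part e (fun y => F (z - y)) q (q / 4000) (q / 400) pe me (fun y => hF _) q400.
  apply: (@le_trans _ _ (\sum_(p <- e | q - q / 400 < F (z - p.1)) p.2)).
    apply: le_trans (h _); last by rewrite -[leRHS]/(conv e F z) -E; clear - hlt; lra.
    have -> : q / 4000 / (q / 400) = 1 / 10 by field; rewrite gt_eqF.
    clear; lra.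
  have -> : (size T) = size [seq z - w | w <- T] by rewrite size_map.
  apply: (@sum_le_count e q (fun y => q - q / 400 < F (z - y))) => //.
    by rewrite (map_inj_uniq (inj z)).
  move=> p hp h1; apply/mapP; exists (z - p.1); last by rewrite subKr.
  rewrite mem_filter h1 mem_undup; apply: (map_f (fun y => z - y)); exact: mem_supp.
pose X := [seq x <- supp f | q - q / 20 < val_at f x].
have uX : uniq X by rewrite filter_uniq ?undup_uniq.
have nX : (size X)%:R * (q * (19 / 20)) <= 1.
  apply: (@le_trans _ _ (mass f)); last by rewrite mf.
  rewrite (mass_val_at (undup_uniq _) (@mem_supp _ _ f)).
  apply: (@le_trans _ _ (\sum_(y <- X) q * (19 / 20))).
    by rewrite big_const_seq count_predT iter_addr addr0 [leLHS]mulr_natl.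
  rewrite big_filter [leRHS](bigID (fun y => q - q / 20 < val_at f y)) /=.
  rewrite -[leLHS]addr0; apply: lerD; last by apply: sumr_ge0 => y _; apply: val_at_ge0.
  by apply: ler_sum => y; clear; lra.
have good w : w \in T -> 19 / 20 <= \sum_(p <- g | w - p.1 \in X) p.2.
  rewrite mem_filter => /andP[hw _].
  have q20 : 0 < q / 20 by clear - q0; lra.
  have h := @heavy_part g (fun y => val_at f (w - y)) q (q / 400) (q / 20) pg mg (fun y => hf _) q20.
  apply: (@le_trans _ _ (\sum_(p <- g | q - q / 20 < val_at f (w - p.1)) p.2)).
    apply: le_trans (h _); last by rewrite -[leRHS]/(F w) ltW.
    have -> : q / 400 / (q / 20) = 1 / 20 by field; rewrite gt_eqF.
    clear; lra.
  rewrite big_mkcond [leRHS]big_mkcond /= !big_seq; apply: ler_sum => p hp.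
  have p0 : 0 <= p.2 by apply: (allP pg).
  case: ifP => h1; last by case: ifP.
  suff -> : w - p.1 \in X by [].
  rewrite mem_filter h1 /=; apply: contraLR h1 => /val_at_supp0 ->; rewrite -leNgt; clear - q0; lra.
(* By the union bound w - y and w' - y both lie in X for mass 9/10 of g, so X and its translate by w
   - w' share at least 9 / (10 q) points. *)
have two w w' : w \in T -> w' \in T -> 9 / 10 <= q * (count (fun x => x - (w - w') \in X) X)%:R.
  move=> hw hw'; have h1 := good _ hw; have h2 := good _ hw'.
  have h3 : 9 / 10 <= \sum_(p <- g | (w - p.1 \in X) && (w' - p.1 \in X)) p.2.
    have : \sum_(p <- g | w - p.1 \in X) p.2 + \sum_(p <- g | w' - p.1 \in X) p.2 <=
       mass g + \sum_(p <- g | (w - p.1 \in X) && (w' - p.1 \in X)) p.2.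
      rewrite big_mkcond [X in _ + X]big_mkcond [X in _ <= _ + X]big_mkcond /mass -!big_split /= !big_seq.
      apply: ler_sum => p hp; have p0 : 0 <= p.2 by apply: (allP pg).
      by move: (p.2) p0 (w - p.1 \in X) (w' - p.1 \in X) => v v0 [] [] /=; clear - v0; lra.
    rewrite mg; clear - h1 h2; lra.
  apply: le_trans h3 _; rewrite -size_filter -(size_map (fun x => w - x)).
  apply: (@sum_le_count g q (fun y => (w - y \in X) && (w' - y \in X))) => //.
    by rewrite (map_inj_uniq (inj w)) filter_uniq.
  move=> p hp /andP[a1 a2]; apply/mapP; exists (w - p.1); last by rewrite subKr.
  by rewrite mem_filter a1 andbT (_ : _ - _ = w' - p.1) //; clear; ring.
(* Since q <= 8/9 < 9/10, a single point is never enough. *)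
have big_nat_ge2 (n : nat) : 9 / 10 <= q * n%:R -> (2 <= n)%N.
  by case: n => [|[|n]] //; rewrite ?mulr0 ?mulr1; clear - q89; lra.
have nT2 := big_nat_ge2 _ nT.
have [|w0 hw0 minw0] := @exists_min_seq T; first by case: (T) nT2.
have : (2 * \sum_(w <- T) count (fun x => (x - (w - w0))%R \in X) X <= size X ^ 2 + size X)%N.
  by rewrite -(count_le_pairs uX) -mul2n leq_mul2l /= sum_shift_count_le.
have NX : (2 <= size X)%N.
  by apply: leq_trans (count_size (fun x => (x - (w0 - w0))%R \in X) X); apply: big_nat_ge2; apply: two.
have lo (c : R) : (forall w, w \in T -> c <= (count (fun x => x - (w - w0) \in X) X)%:R) ->
   (size T)%:R * c <= (\sum_(w <- T) count (fun x => (x - (w - w0))%R \in X) X)%:R.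
  move=> h; rewrite natr_sum mulr_natl -[X in c *+ X](count_predT T) -[c *+ _]addr0 -iter_addr -big_const_seq.
  by rewrite !big_seq; apply: ler_sum.
set S := (\sum_(w <- T) _)%N => hS.
have S2 : (size T * 2 <= S)%N.
  rewrite -(ler_nat R) natrM; apply: lo => w hw; rewrite ler_nat.
  by apply: big_nat_ge2; apply: two.
have Sq : (size T)%:R * (9 / 10 / q) <= S%:R.
  by apply: lo => w hw; rewrite ler_pdivrMr // [leRHS]mulrC; apply: two.
(* The arithmetic needs at least three points in X. With two points, at least two shifts with at
   least two common points each give S >= 4, against S <= 3. *)
have [X3|X3] := leqP (size X) 2; first by move: (size X) (size T) hS S2 NX nT2 X3 => {}N {}n; clear; nia.
have hS' : 2 * S%:R <= (size X)%:R ^+ 2 + (size X)%:R :> R.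
  by rewrite -natrX -natrD -(natrM R 2) ler_nat.
have X3' : 3 <= (size X)%:R :> R by rewrite (ler_nat R 3).
exact: three_sum_arith q0 nT nX Sq hS' X3'.
Qed.
End ThreeSum.

(** * Concentration of repeated sums of a law with a heavy mode *)

Section Mode.
Variables (R : realType) (G : zmodType).
Implicit Types (mu rho : seq (G * R)) (z : G) (bs : seq bool).

Lemma bernoulli_sub (y : R) n : 0 <= y <= 1 -> 1 - n%:R * y <= (1 - y) ^+ n.
Proof.
move=> /andP[y0 y1]; elim: n => [|n IH]; first by rewrite mul0r subr0 expr0.
rewrite exprS; apply: (@le_trans _ _ ((1 - y) * (1 - n%:R * y))); last by rewrite ler_wpM2l // subr_ge0.
have : 0 <= n%:R * y * y by rewrite !mulr_ge0.
by rewrite -natr1; lra.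
Qed.

Lemma mass_mprods (mus : seq (seq (G * R))) : mass (mprods mus) = \prod_(mu <- mus) mass mu.
Proof.
elim: mus => [|mu mus IH] /=; first by rewrite big_nil /mass big_seq1.
rewrite big_cons -IH /mass /mprod big_allpairs_dep mulr_suml /=.
by apply: eq_bigr => p _; rewrite mulr_sumr.
Qed.

Lemma nonneg_mprods (mus : seq (seq (G * R))) : all nonneg mus -> nonneg (mprods mus).
Proof.
elim: mus => [_|mu mus IH /andP[h1 h2]] /=; first by rewrite /nonneg /= ler01.
by rewrite nonneg_mprod // IH.
Qed.

Lemma val_at_mprods (mus : seq (seq (G * R))) : val_at (mprods mus) = convs mus.
Proof. by rewrite /val_at conv_mprods. Qed.

Lemma prod_mass_sgn mu bs : \prod_(nu <- [seq sgn_meas b mu | b <- bs]) mass nu = mass mu ^+ size bs.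
Proof.
rewrite big_map; under eq_bigr do rewrite mass_sgn.
by rewrite big_const_seq count_predT iter_mulr mulr1.
Qed.

Lemma val_at_le_mass mu z : nonneg mu -> val_at mu z <= mass mu.
Proof.
by move=> p; rewrite -[leRHS]mulr1; apply: conv_le_mass => // y; rewrite /dirac0; case: eqP.
Qed.

Lemma val_at_two_le mu z z' : nonneg mu -> z != z' -> val_at mu z + val_at mu z' <= mass mu.
Proof.
move=> /allP p1 zz; rewrite !val_atE !(big_mkcond (fun p => p.1 == _)) -big_split /= /mass !big_seq.
apply: ler_sum => p hp; have p0 := p1 _ hp.
have [->|_] := eqVneq p.1 z; first by rewrite (negbTE zz) addr0.
by case: ifP => _; rewrite add0r.
Qed.

Section Modal.
Variable rho : seq (G * R).
Hypotheses (p_rho : nonneg rho) (rho0 : forall p, p \in rho -> p.1 != 0).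
Let nu := (0, 1) :: rho.
Let a := mass rho.

Lemma nonneg_modal : nonneg nu.
Proof. by rewrite /nonneg /= ler01. Qed.

Lemma mass_modal : mass nu = 1 + a.
Proof. by rewrite /mass big_cons. Qed.

Lemma conv_sgn_modal b F z : conv (sgn_meas b nu) F z = F z + conv (sgn_meas b rho) F z.
Proof. by rewrite /nu; case: b; rewrite /= /conv big_cons /= ?oppr0 ?addr0 ?oppr0 mul1r ?subr0 ?addr0. Qed.

Lemma convs_modal_ge1 bs : 1 <= convs [seq sgn_meas b nu | b <- bs] 0.
Proof.
elim: bs => [|b bs IH] /=; first by rewrite /convs /= /dirac0 eqxx.
rewrite conv_sgn_modal; apply: (le_trans IH); rewrite lerDl.
by apply: conv_ge0; rewrite ?nonneg_sgn // => y; apply: convs_ge0; apply: all_nonneg_sgn; apply: nonneg_modal.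
Qed.

Lemma convs_modal_off bs z : z != 0 ->
  convs [seq sgn_meas b nu | b <- bs] z + convs [seq sgn_meas b nu | b <- bs] 0 <= (1 + a) ^+ size bs.
Proof.
move=> z0; rewrite -mass_modal -prod_mass_sgn -mass_mprods -val_at_mprods.
by apply: val_at_two_le => //; apply: nonneg_mprods; apply: all_nonneg_sgn; apply: nonneg_modal.
Qed.

(** The tuples with exactly one nonzero entry have total weight n a and miss 0. In the induction a
    new nonzero entry p needs the other entries to reach -p up to sign, and the mass there is at
    most the total minus the mass at 0, which is at least 1. *)
Lemma convs_modal_at0 bs :
  convs [seq sgn_meas b nu | b <- bs] 0 + (size bs)%:R * a <= (1 + a) ^+ size bs.
Proof.
have a0 : 0 <= a by apply: mass_ge0.
elim: bs => [|b bs IH]; first by rewrite /convs /= /dirac0 eqxx mul0r addr0 expr0.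
set W := convs [seq sgn_meas b nu | b <- bs].
have -> : convs [seq sgn_meas b nu | b <- b :: bs] 0 = W 0 + conv (sgn_meas b rho) W 0.
  exact: conv_sgn_modal.
have : conv (sgn_meas b rho) W 0 <= mass (sgn_meas b rho) * ((1 + a) ^+ size bs - 1).
  rewrite /conv [X in X * _]/mass mulr_suml !big_seq; apply: ler_sum => p hp.
  have p0 : 0 <= p.2 by have : nonneg (sgn_meas b rho) by [rewrite nonneg_sgn]; move/allP; apply.
  have pn : p.1 != 0.
    by case: (b) hp => /=; [apply: rho0 | case/mapP => y /rho0 h -> /=; rewrite oppr_eq0].
  rewrite ler_wpM2l // lerBrDr.
  apply: le_trans _ (convs_modal_off bs (z := 0 - p.1) _); first by rewrite lerD2l convs_modal_ge1.
  by rewrite sub0r oppr_eq0.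
rewrite mass_sgn -/a /= exprS -natr1 => h; rewrite -/W in IH; lra.
Qed.
End Modal.

Lemma convs_sgn_translate c mu bs : exists d, forall z,
  convs [seq sgn_meas b (translate c mu) | b <- bs] z = convs [seq sgn_meas b mu | b <- bs] (z + d).
Proof.
elim: bs => [|b bs [d IH]]; first by exists 0 => z; rewrite addr0.
exists (if b then d + c else d - c) => z /=; rewrite /conv.
case: b => /=; rewrite /opp /translate !big_map; apply: eq_bigr => p _ /=.
  congr (_ * _); rewrite -!/(convs _) IH; congr (convs _ _).
  by rewrite opprB [in RHS](addrC d) !addrA [LHS]addrAC.
congr (_ * _); rewrite -!/(convs _) IH; congr (convs _ _).
by rewrite !opprK !addrA [LHS]addrAC [RHS]addrAC; congr (_ - c); rewrite addrAC.
Qed.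

Lemma val_at_translate c mu z : val_at (translate c mu) z = val_at mu (z + c).
Proof. by rewrite !val_atE big_map; apply: eq_bigl => p /=; rewrite subr_eq. Qed.

Definition off (mu : seq (G * R)) := [seq p <- mu | p.1 != 0].

Lemma val_at_off mu z : val_at (off mu) z = if z == 0 then 0 else val_at mu z.
Proof.
rewrite !val_atE big_filter_cond; case: eqP => [->|/eqP z0].
  by rewrite big1 // => p /andP[/negbTE ->].
by apply: eq_bigl => p; case: (eqVneq p.1 z) => [->|]; rewrite ?z0 ?andbF.
Qed.

Lemma mass_off mu : mass mu = val_at mu 0 + mass (off mu).
Proof. by rewrite /mass val_atE big_filter [LHS](bigID (fun p => p.1 == 0)). Qed.

Lemma val_at_scale c mu z : val_at (scale c mu) z = c * val_at mu z.
Proof. exact: conv_scale. Qed.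

Lemma val_at_modal rho z : val_at ((0, 1) :: rho) z = (z == 0)%:R + val_at rho z.
Proof. by rewrite !val_atE big_cons /= eq_sym; case: eqP; rewrite ?add0r. Qed.

(** The concentration function of n copies, uniform in the signs as well, so that any block of a
    sign pattern can be treated alike. *)
Definition conc mu (n : nat) (q : R) := forall bs z, size bs = n ->
  convs [seq sgn_meas b mu | b <- bs] z <= q.

(** n is tuned so that all copies stay at the mode with weight u0^n >= 1/2, while one exception is
    not rare. After centring, the tuples with one exception remove at least 1/8 of the mass from the
    point 0, leaving 7/8; at any other point the weight u0^n of the centre is missing, leaving
    1/2. *)
Lemma conc_mode mu j0 n : nonneg mu -> mass mu = 1 ->
  1 / 4 <= n%:R * (1 - val_at mu j0) <= 1 / 2 -> conc mu n (8 / 9).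
Proof.
move=> pm m1; set u0 := val_at mu j0; set eta := 1 - u0 => /andP[e1 e2] bs z sz.
have u01 : u0 <= 1.
  by rewrite -m1; apply: val_at_le_mass.
have n1 : 1 <= n%:R :> R.
  by rewrite (ler_nat R 1) lt0n; apply/eqP => n0; move: e1; rewrite n0 mul0r; lra.
have eta0 : 0 <= eta by rewrite subr_ge0.
have eta12 : eta <= 1 / 2 by nra.
have u0p : 0 < u0 by rewrite /eta in eta12; lra.
set mu' := translate j0 mu.
have [d Hd] := convs_sgn_translate j0 mu bs.
pose rho := scale u0^-1 (off mu').
have pm' : nonneg mu' by rewrite /nonneg all_map.
have poff : nonneg (off mu') by apply/allP => p; rewrite mem_filter => /andP[_ /(allP pm')].
have prho : nonneg rho by apply: nonneg_scale => //; rewrite invr_ge0 ltW.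
have rho0 p : p \in rho -> p.1 != 0 by case/mapP => y + ->; rewrite mem_filter => /andP[].
set a := mass rho.
have ea : u0 * (1 + a) = 1.
  rewrite mulrDr mulr1 /a mass_scale mulrA divff ?gt_eqF // mul1r.
  by rewrite {1}/u0 -[j0]add0r -val_at_translate -mass_off -m1 /mass big_map.
have -> : z = z - d + d by rewrite subrK.
rewrite -Hd; move: (z - d) => {}z.
have : convs [seq sgn_meas b mu' | b <- bs] z <=
    u0 ^+ n * convs [seq sgn_meas b ((0, 1) :: rho) | b <- bs] z.
  rewrite -sz -convs_sgn_scale; apply: ler_foldr_conv_sgn => //.
  - by apply: nonneg_scale; [apply: ltW | apply: nonneg_modal].
  - move=> y; rewrite val_at_scale val_at_modal /rho val_at_scale mulrDr mulrA divff ?gt_eqF // mul1r.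
    rewrite val_at_off; case: eqP => [->|_]; last by rewrite mulr0 add0r.
    by rewrite mulr1 addr0 val_at_translate add0r.
move/le_trans; apply.
have un : 1 / 2 <= u0 ^+ n.
  have -> : u0 = 1 - eta by rewrite /eta; ring.
  apply: le_trans _ (bernoulli_sub _ _); first lra.
  by rewrite eta0; lra.
have full : u0 ^+ n * (1 + a) ^+ n = 1 by rewrite -exprMn ea expr1n.
have up : 0 <= u0 ^+ n by apply: exprn_ge0; apply: ltW.
have [->|z0] := eqVneq z 0.
  have h := convs_modal_at0 prho rho0 bs; rewrite -/a sz in h.
  have {}h := ler_wpM2l up h; rewrite mulrDr full in h.
  have ae : eta <= a by rewrite /eta; nra.
  have na : 1 / 4 <= n%:R * a by apply: (le_trans e1); rewrite ler_wpM2l.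
  have : 1 / 2 * (1 / 4) <= u0 ^+ n * (n%:R * a) by apply: ler_pM => //; rewrite divr_ge0.
  lra.
have h := convs_modal_off prho bs z0; rewrite -/a sz in h.
have {}h := ler_wpM2l up h; rewrite mulrDr full in h.
have := ler_wpM2l up (convs_modal_ge1 prho bs); lra.
Qed.

(** Further copies of mass 1 only average the earlier values. *)
Lemma conc_mono mu n n' q : nonneg mu -> mass mu = 1 -> (n <= n')%N -> conc mu n q -> conc mu n' q.
Proof.
move=> pm m1 nn h bs z sz.
rewrite -(cat_take_drop (n' - n) bs) map_cat convs_cat.
apply: le_trans (foldr_conv_le_mass (c := q) _ _ _) _; last first.
- by rewrite prod_mass_sgn m1 expr1n mul1r.
- by move=> y; apply: h; rewrite size_drop sz; lia.
- exact: all_nonneg_sgn.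
Qed.
End Mode.

Section Anticoncentration.
Variable R : realType.
Implicit Types (mu : seq (int * R)) (z : int) (bs : seq bool).

Lemma conc_triple mu n q : nonneg mu -> mass mu = 1 -> q <= 8 / 9 -> conc mu n q ->
  conc mu (3 * n) ((1 - 4000^-1) * q).
Proof.
move=> pm m1 q8 h bs z sz; set b1 := take n bs; set b2 := take n (drop n bs); set b3 := drop n (drop n bs).
have s1 : size b1 = n by rewrite size_takel // sz; lia.
have s2 : size b2 = n by rewrite size_takel // size_drop sz; lia.
have s3 : size b3 = n by rewrite !size_drop sz; lia.
have -> : bs = b1 ++ b2 ++ b3 by rewrite !cat_take_drop.
pose M bs := mprods [seq sgn_meas b mu | b <- bs].
have pM b : nonneg (M b) by apply: nonneg_mprods; apply: all_nonneg_sgn.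
have mM b : mass (M b) = 1 by rewrite mass_mprods prod_mass_sgn m1 expr1n.
rewrite !map_cat !convs_cat -2!conv_mprods -val_at_mprods.
by apply: three_sum => //; rewrite ?pM ?mM // => y; rewrite val_at_mprods; apply: h.
Qed.

Lemma conc_pow3 mu n i : nonneg mu -> mass mu = 1 -> conc mu n (8 / 9) ->
  conc mu (3 ^ i * n) ((1 - 4000^-1) ^+ i * (8 / 9)).
Proof.
move=> pm m1 h; elim: i => [|i IH]; first by rewrite mul1n mul1r.
rewrite expnS -mulnA exprS -mulrA; apply: conc_triple => //.
have : (1 - 4000^-1) ^+ i <= 1 :> R by apply: exprn_ile1; clear; lra.
by move: (_ ^+ i) => p; clear; lra.
Qed.

(** About 1 / (4 eta) copies bring the concentration down to 8/9, and each of i triplings gains 1 -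
    1/4000. The start has n eta <= 5/4 < 2, so 3^i n <= t. *)
Lemma anticoncentration mu j0 i t : nonneg mu -> mass mu = 1 ->
  (forall z, val_at mu z <= val_at mu j0) -> (2 * 3 ^ i)%:R <= t%:R * (1 - val_at mu j0) ->
  conc mu t ((1 - 4000^-1) ^+ i).
Proof.
move=> pm m1 hmax; set u0 := val_at mu j0; set eta := 1 - u0 => ht.
have i0 : 0 < (3 ^ i)%:R :> R by rewrite ltr0n expn_gt0.
have eta0 : 0 < eta.
  rewrite ltNge; apply/negP => e0; have : t%:R * eta <= 0 by rewrite mulr_ge0_le0.
  by move: ht; rewrite natrM; lra.
have eta1 : eta <= 1 by rewrite /eta lerBlDr lerDl; apply: val_at_ge0.
have [n hn1 hn2] : exists2 n : nat, conc mu n (8 / 9) & n%:R * eta <= 5 / 4.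
  (* For eta >= 1/9 one copy already has concentration u0 <= 8/9; otherwise rounding 1 / (4 eta) up
     keeps n eta between 1/4 and 1/4 + 1/9 < 1/2. *)
  have [e9|e9] := leP (1 / 9) eta.
    exists 1%N; last by rewrite mul1r; lra.
    case=> [|b []] // z _ /=; apply: (@le_trans _ _ u0); last by rewrite /eta in e9; lra.
    by case: b => /=; [|rewrite -/(val_at _ _) val_at_opp]; apply: hmax.
  pose n := (Num.truncn ((4 * eta)^-1)).+1.
  have l1 : (4 * eta)^-1 < n%:R by apply: truncnS_gt.
  have l2 : n%:R <= (4 * eta)^-1 + 1.
    by rewrite /n -natr1 lerD2r truncn_le // invr_ge0 mulr_ge0 // ltW.
  have e4 : (4 * eta)^-1 * eta = 1 / 4 by field; rewrite gt_eqF.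
  exists n; last first.
    apply: (@le_trans _ _ (((4 * eta)^-1 + 1) * eta)); first by rewrite ler_wpM2r // ltW.
    by rewrite mulrDl e4; lra.
  apply: (conc_mode (j0 := j0)) => //; rewrite -/u0 -/eta; apply/andP; split.
    by rewrite -e4 ler_wpM2r // ltW.
  apply: (@le_trans _ _ (((4 * eta)^-1 + 1) * eta)); first by rewrite ler_wpM2r // ltW.
  by rewrite mulrDl e4; lra.
apply: (conc_mono (n := (3 ^ i * n)%N)) => //.
  rewrite -(ler_nat R) -(ler_pM2r eta0) natrM -mulrA.
  apply: le_trans ht; rewrite natrM mulrC ler_wpM2r //.
  by apply: (le_trans hn2); lra.
move=> bs z sz; apply: le_trans (conc_pow3 pm m1 hn1 (i := i) z sz) _.
have : 0 <= (1 - 4000^-1) ^+ i :> R by apply: exprn_ge0; clear; lra.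
by move: (_ ^+ i) => p; clear; lra.
Qed.
End Anticoncentration.

(** * The one-dimensional multiplicative estimate *)

Section Telescoping.
Variables (R : realType) (G : zmodType).
Implicit Types (mu rho : seq (G * R)) (z : G) (bs : seq bool).

(** If every copy picks the mode 0, the value F z remains. Otherwise one copy of rho is moved next
    to F, which makes the function at most c everywhere, and the other copies contribute at most
    their mass. *)
Lemma foldr_modal_le rho (F : G -> R) bs z c : nonneg rho -> 0 <= c ->
  (forall b y, conv (sgn_meas b rho) F y <= c) ->
  foldr conv F [seq sgn_meas b ((0, 1) :: rho) | b <- bs] z <=
  F z + (size bs)%:R * c * (1 + mass rho) ^+ size bs.
Proof.
move=> pr c0 hc; have x0 := mass_ge0 pr.
elim: bs z => [|b bs IH] z /=; first by rewrite !mul0r addr0.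
rewrite conv_sgn_modal conv_foldr.
set P := (1 + mass rho) ^+ size bs.
have P0 : 0 <= P by rewrite exprn_ge0 // addr_ge0.
have h1 := IH z; rewrite -/P in h1.
have h2 : foldr conv (conv (sgn_meas b rho) F) [seq sgn_meas b ((0, 1) :: rho) | b <- bs] z <= P * c.
  apply: le_trans (foldr_conv_le_mass (c := c) _ _ _) _ => //.
    by apply: all_nonneg_sgn; apply: nonneg_modal.
  by rewrite prod_mass_sgn mass_modal.
apply: le_trans (lerD h1 h2) _; rewrite -addrA lerD2l exprS -/P -natr1.
have : 0 <= (size bs)%:R * c * P * mass rho by rewrite !mulr_ge0.
have : 0 <= c * P * mass rho by rewrite !mulr_ge0.
lra.
Qed.

Lemma val_at_autocorr_sgn b mu : val_at (autocorr (sgn_meas b mu)) 0 = val_at (autocorr mu) 0.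
Proof. by case: b => //; rewrite /val_at /autocorr /= !conv_mprod oppK convC. Qed.

Lemma conv_val_at_autocorr_le b b' mu z :
  conv (sgn_meas b mu) (val_at (sgn_meas b' mu)) z <= val_at (autocorr mu) 0.
Proof.
apply: (@le_root _ 2) => //.
  by rewrite val_at_autocorr; apply: sumr_ge0 => y _; apply: sqr_ge0.
by apply: le_trans (conv_val_at_sqr_le _ _ _) _; rewrite !val_at_autocorr_sgn expr2.
Qed.

Variables (big tiny : seq (G * R)) (th : R).
Hypotheses (p_big : nonneg big) (p_tiny : nonneg tiny).
Hypotheses (big0 : forall p, p \in big -> p.1 != 0) (tiny0 : forall p, p \in tiny -> p.1 != 0).
Hypothesis tiny_le : forall z, val_at tiny z <= th.
Let a := mass big.
Let x := mass (big ++ tiny).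
Let c := th * a + val_at (autocorr tiny) 0.
Let nu := (0, 1) :: big.
Let kap := (0, 1) :: (big ++ tiny).

Let p_bt : nonneg (big ++ tiny). Proof. by rewrite nonneg_cat p_big. Qed.
Let th0 : 0 <= th. Proof. exact: le_trans (val_at_ge0 0 p_tiny) (tiny_le 0). Qed.
Let c0 : 0 <= c.
Proof.
rewrite addr_ge0 ?mulr_ge0 ?mass_ge0 // val_at_autocorr.
by apply: sumr_ge0 => y _; apply: sqr_ge0.
Qed.

(** The tiny atom is nonzero, so another factor has to cancel it: one from big does so with weight
    at most th a, one from tiny with at most the squared l2 norm, by Cauchy-Schwarz. The constant c
    is the sum of both. *)
Let tiny_bound b bs : convs (sgn_meas b tiny :: [seq sgn_meas b' kap | b' <- bs]) 0 <=
  (size bs)%:R * c * (1 + x) ^+ size bs.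
Proof.
rewrite /= /convs conv_foldr -/(val_at _).
apply: le_trans (foldr_modal_le (c := c) _ _ p_bt c0 _) _.
  move=> b' y; rewrite sgn_meas_cat conv_cat; apply: lerD.
    rewrite mulrC /a -(mass_sgn b'); apply: conv_le_mass; rewrite ?nonneg_sgn // => w.
    by case: (b) => //=; rewrite val_at_opp.
  exact: conv_val_at_autocorr_le.
suff -> : val_at (sgn_meas b tiny) 0 = 0 by rewrite add0r.
rewrite val_atE big_seq_cond big1 // => p /andP[hp /eqP e].
suff : p.1 != 0 by rewrite e eqxx.
by case: (b) hp => /=; [apply: tiny0 | case/mapP => y /tiny0 h -> /=; rewrite oppr_eq0].
Qed.

(* Replacing kap by nu one factor at a time costs, for each factor, the chance
   that a tiny atom is cancelled by another nonzero atom. *)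
Lemma convs_big_tiny bs : convs [seq sgn_meas b kap | b <- bs] 0 <=
  (1 + a) ^+ size bs - (size bs)%:R * a + (size bs)%:R ^+ 2 * c * (1 + x) ^+ size bs.
Proof.
set n := size bs; have x0 : 0 <= x := mass_ge0 p_bt.
have pk : nonneg kap by apply: nonneg_modal.
have pn : nonneg nu by apply: nonneg_modal.
have vle y : val_at nu y <= val_at kap y.
  by rewrite !val_at_modal lerD2l /val_at conv_cat lerDl; apply: val_at_ge0.
set U := n%:R * c * (1 + x) ^+ n; have U0 : 0 <= U by rewrite !mulr_ge0 // exprn_ge0 // addr_ge0.
have H b1 b2 : (size b1 + size b2)%N = n ->
   convs ([seq sgn_meas b nu | b <- b1] ++ [seq sgn_meas b kap | b <- b2]) 0 <=
   convs [seq sgn_meas b nu | b <- b1 ++ b2] 0 + (size b2)%:R * U.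
  elim: b2 b1 => [|b b2 IH] b1 /= sz; first by rewrite !cats0 mul0r addr0.
  rewrite -[X in sgn_meas b X]/(nu ++ tiny) sgn_meas_cat convs_mid_cat.
  have -> : b1 ++ b :: b2 = rcons b1 b ++ b2 by rewrite cat_rcons.
  rewrite -natr1 mulrDl mul1r addrA; apply: lerD.
    have := IH (rcons b1 b); rewrite map_rcons cat_rcons; apply.
    by rewrite size_rcons -sz; clear; lia.
  rewrite (convs_perm (perm_mid _ _ _)).
  apply: (@le_trans _ _ (convs (sgn_meas b tiny :: [seq sgn_meas b' kap | b' <- b1 ++ b2]) 0)).
    rewrite /= map_cat; apply: ler_conv; rewrite ?nonneg_sgn // => y.
    rewrite !convs_cat; apply: ler_foldr_conv_sgn => // w.
    by apply: foldr_conv_ge0; rewrite ?all_nonneg_sgn // => v; apply: dirac0_ge0.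
  apply: le_trans (tiny_bound _ _) _; have sle : (size (b1 ++ b2) <= n)%N by rewrite size_cat -sz; clear; lia.
  have q1 : (size (b1 ++ b2))%:R * c <= n%:R * c by rewrite ler_wpM2r // ler_nat.
  have q2 : (1 + x) ^+ size (b1 ++ b2) <= (1 + x) ^+ n by apply: ler_weXn2l => //; rewrite lerDl.
  by apply: ler_pM => //; [rewrite mulr_ge0 | rewrite exprn_ge0 // addr_ge0].
have h1 := H [::] bs erefl; have h2 := convs_modal_at0 p_big big0 bs.
have -> : n%:R ^+ 2 * c * (1 + x) ^+ n = n%:R * U by rewrite /U; ring.
by apply: (le_trans h1); rewrite lerD2r lerBrDr.
Qed.
End Telescoping.

Section SmallCase.
Variable R : realType.

(** The saving t a on the left is spent in two parts. Three quarters cover the passage from exponent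
    t to t - k and from f to f^s on the big atoms, by the last hypothesis; the last quarter covers
    the term in vt^2 a, since t^2 vt^2 M = 1 / (4 M). The term in tau is paid by the summand (t - k)
    YT of the right side. *)
Lemma small_case_numeric (t k : nat) (a YB YT tau vt M eps : R) :
  (2 * k <= t)%N -> (0 < t)%N -> 0 <= a -> (1 + a) ^+ t <= M -> 1 <= M -> 0 <= eps -> eps * a <= 1 ->
  (1 - eps) * a <= YB -> 0 <= YB -> 0 <= YT -> vt = (2 * t%:R * M)^-1 -> tau <= vt * YT ->
  M * (t%:R * eps + k%:R) <= 3 / 4 * t%:R ->
  (1 + a) ^+ t - t%:R * a + t%:R ^+ 2 * (vt ^+ 2 * a + tau) * M <= (1 + YB + YT) ^+ (t - k).
Proof.
move=> kt t0 a0 hM M1 e0 ea hYB YB0 YT0 vtE htau hnum.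
set n := (t - k)%N.
have tp : 1 <= t%:R :> R by rewrite (ler_nat R 1).
have nt : 2 * n%:R >= t%:R :> R by rewrite -natrM ler_nat /n; clear - kt; lia.
have nt' : n%:R <= t%:R :> R by rewrite ler_nat /n; clear; lia.
have M0 : 0 < M by lra.
have s1 : (1 + YB) ^+ n + n%:R * YT <= (1 + YB + YT) ^+ n.
  elim: (n) => [|j IH]; first by rewrite !expr0 mul0r addr0.
  have P1 : 1 <= (1 + YB) ^+ j by apply: exprn_ege1; lra.
  rewrite !exprS -natr1; apply: (@le_trans _ _ ((1 + YB + YT) * ((1 + YB) ^+ j + j%:R * YT))).
    have : 0 <= (YB + YT) * (j%:R * YT) by rewrite !mulr_ge0 // addr_ge0.
    have : YT <= YT * (1 + YB) ^+ j by rewrite ler_peMr.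
    lra.
  by rewrite ler_wpM2l //; lra.
have s2 : (1 + a) ^+ n * (1 - n%:R * eps * a) <= (1 + YB) ^+ n.
  apply: (@le_trans _ _ ((1 + a) ^+ n * (1 - eps * a) ^+ n)).
    rewrite ler_wpM2l ?exprn_ge0 //; first lra.
    by rewrite -mulrA; apply: bernoulli_sub; rewrite mulr_ge0 //= ea.
  rewrite -exprMn; apply: ler_expX; first by rewrite mulr_ge0 //; lra.
  have : 0 <= eps * a * a by rewrite !mulr_ge0.
  lra.
have s3 : (1 + a) ^+ t * (1 - k%:R * a) <= (1 + a) ^+ n.
  have -> : t = (n + k)%N by rewrite /n; clear - kt; lia.
  rewrite exprD -mulrA ler_piMr ?exprn_ge0 //; first lra.
  have ek : (1 + a) ^+ k <= expR (k%:R * a).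
    rewrite expRM_natl; apply: ler_expX; [lra | exact: expR_ge1Dx].
  have ek' : 1 - k%:R * a <= expR (- (k%:R * a)) by apply: le_trans (expR_ge1Dx _); lra.
  apply: (@le_trans _ _ ((1 + a) ^+ k * expR (- (k%:R * a)))).
    by rewrite ler_wpM2l // exprn_ge0 //; lra.
  by apply: le_trans (ler_wpM2r (expR_ge0 _) ek) _; rewrite expRxMexpNx_1.
have n1 : (1 + a) ^+ n <= M.
  apply: le_trans hM; apply: ler_weXn2l; [lra | rewrite /n; clear; lia].
have s4 : (1 + a) ^+ t - M * (k%:R * a) - M * (t%:R * eps * a) <= (1 + YB) ^+ n.
  apply: le_trans s2; rewrite mulrBr mulr1.
  apply: lerB.
    apply: le_trans s3; rewrite mulrBr mulr1 lerD2l lerN2 ler_wpM2r // mulr_ge0 //.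
  by apply: ler_pM; rewrite ?exprn_ge0 ?mulr_ge0 //; [lra | rewrite ler_wpM2r // ler_wpM2r].
have s5 : M * (k%:R * a) + M * (t%:R * eps * a) <= 3 / 4 * t%:R * a.
  have := ler_wpM2r a0 hnum; lra.
have vtM : vt * (2 * t%:R * M) = 1 by rewrite vtE mulVf // gt_eqF // !mulr_gt0 //; lra.
have vt0 : 0 < vt by rewrite vtE invr_gt0 !mulr_gt0 //; lra.
have s6 : t%:R ^+ 2 * tau * M <= n%:R * YT.
  apply: (@le_trans _ _ (t%:R ^+ 2 * (vt * YT) * M)).
    by rewrite ler_pM2r // ler_pM2l ?exprn_gt0 //; lra.
  have -> : t%:R ^+ 2 * (vt * YT) * M = (vt * (2 * t%:R * M)) * (t%:R * YT) / 2 by field.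
  rewrite vtM mul1r; have := ler_wpM2r YT0 nt; lra.
have s7 : t%:R ^+ 2 * (vt ^+ 2 * a) * M <= 1 / 4 * t%:R * a.
  have -> : t%:R ^+ 2 * (vt ^+ 2 * a) * M = (vt * (2 * t%:R * M)) ^+ 2 * a / 4 / M by field; rewrite gt_eqF.
  rewrite vtM expr1n mul1r ler_pdivrMr //.
  have : a <= t%:R * a * M.
    by have -> : t%:R * a * M = a * (t%:R * M); [ring | rewrite ler_peMr // mulr_ege1].
  lra.
lra.
Qed.
End SmallCase.

Section OneDim.
Variable R : realType.
Implicit Types (f : int -> R) (X : seq int).

Definition wmeas f X : seq (int * R) := [seq (y, f y) | y <- X].

Lemma val_at_wmeas f X z : uniq X -> val_at (wmeas f X) z = if z \in X then f z else 0.
Proof.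
move=> uX; rewrite val_atE big_map /=; case: ifP => hz.
  by rewrite -big_filter (eq_filter (a2 := pred1 z)) // filter_pred1_uniq // big_seq1.
by rewrite big_seq_cond big1 // => a /andP[ha /eqP e]; move: hz; rewrite -e ha.
Qed.

Lemma mass_wmeas f X : mass (wmeas f X) = \sum_(y <- X) f y.
Proof. by rewrite /mass big_map. Qed.

Lemma nonneg_wmeas f X : (forall y, 0 <= f y) -> nonneg (wmeas f X).
Proof. by move=> h; rewrite /nonneg all_map; apply/allP => y _ /=. Qed.

Lemma supp_wmeas f X : uniq X -> supp (wmeas f X) = X.
Proof. by move=> uX; rewrite /supp -map_comp map_id undup_id. Qed.

Lemma ln2_le1 : ln (2 : R) <= 1.
Proof.
rewrite -[leRHS]expRK ler_ln ?posrE ?expR_gt0 //.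
by apply: le_trans (expR_ge1Dx _); lra.
Qed.

Lemma powR_ge_linear (th e B : R) : 0 < th -> 0 <= e -> - B <= ln th -> 1 - e * B <= th `^ e.
Proof.
move=> t0 e0 hB; rewrite /powR gt_eqF //; apply: le_trans (expR_ge1Dx _).
by rewrite lerD2l -mulrN ler_wpM2l.
Qed.

(* The atoms away from the mode 0 are split at th. Cancellations between tiny
   atoms cost the sum of f^2, which is at most vt times the sum of f^s; the big
   atoms lose only th^(s-1), less than what the configurations with exactly one
   nonzero entry save. *)
Lemma small_case m k (r : R) f X : uniq X -> 0 \in X -> (forall y, 0 <= f y <= 1) -> f 0 = 1 ->
  (3 * k <= 2 ^ m.+1)%N -> 0 <= r ->
  (2 ^ m.+1)%:R * (\sum_(y <- X) f y - 1) <= r ->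
  expR r * (4 * k%:R * (m%:R + 2 + r) + k%:R) <= 3 / 4 * (2 ^ m.+1)%:R ->
  energy m.+1 (wmeas f X) <=
    (\sum_(y <- X) f y `^ ((2 ^ m.+1)%:R / (2 ^ m.+1 - k)%:R)) ^+ (2 ^ m.+1 - k).
Proof.
move=> uX X0 hf f0 kt r0; set t := (2 ^ m.+1)%N; set n := (t - k)%N; set s : R := t%:R / n%:R => hx hnum.
have t2 : (2 <= t)%N by rewrite /t expnS; have := expn_gt0 2 m; lia.
have np : (0 < n)%N by rewrite /n -/t in kt *; lia.
have n0 : 0 < n%:R :> R by rewrite ltr0n.
have tp : 0 < t%:R :> R by rewrite ltr0n; lia.
have fge y : 0 <= f y by case/andP: (hf y).
set M := expR r; have M1 : 1 <= M by rewrite -expR0 ler_expR.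
(* On tiny atoms f^(2-s) <= sqrt f <= sqrt th = vt, because 3k <= t gives s <= 3/2. *)
set vt := (2 * t%:R * M)^-1; set th := vt ^+ 2.
have vt0 : 0 < vt by rewrite invr_gt0 !mulr_gt0 // (lt_le_trans ltr01).
have th0 : 0 < th by rewrite exprn_gt0.
pose pb y := (y != 0) && (th < f y); pose pt y := (y != 0) && (f y <= th).
pose big := wmeas f [seq y <- X | pb y]; pose tiny := wmeas f [seq y <- X | pt y].
have split_sum (g : int -> R) : \sum_(y <- X) g y =
    g 0 + \sum_(y <- X | pb y) g y + \sum_(y <- X | pt y) g y.
  rewrite (bigD1_seq 0) //= -addrA; congr (_ + _).
  rewrite (bigID (fun y => th < f y)) /=; congr (_ + _).
  by apply: eq_bigl => y; rewrite /pt leNgt.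
have nb : nonneg big by apply: nonneg_wmeas.
have nt : nonneg tiny by apply: nonneg_wmeas.
have b0 p : p \in big -> p.1 != 0 by case/mapP => y + ->; rewrite mem_filter => /andP[/andP[]].
have t0 p : p \in tiny -> p.1 != 0 by case/mapP => y + ->; rewrite mem_filter => /andP[/andP[]].
have tle z : val_at tiny z <= th.
  rewrite val_at_wmeas ?filter_uniq // mem_filter; case: ifP => [/andP[/andP[_ h] _] //|_]; exact: ltW.
set a := \sum_(y <- X | pb y) f y; set w := \sum_(y <- X | pt y) f y.
have Ea : mass big = a by rewrite mass_wmeas big_filter.
have Ew : mass tiny = w by rewrite mass_wmeas big_filter.
have a0 : 0 <= a by apply: sumr_ge0.
have w0 : 0 <= w by apply: sumr_ge0.
have Ex : \sum_(y <- X) f y = 1 + a + w by rewrite split_sum f0.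
have hE : energy m.+1 (wmeas f X) <= energy m.+1 ((0, 1) :: (big ++ tiny)).
  apply: ler_energy; [exact: nonneg_wmeas | by apply: nonneg_modal; rewrite nonneg_cat nb |].
  move=> y; rewrite val_at_modal /val_at conv_cat -!/(val_at _ _) !val_at_wmeas ?filter_uniq //.
  rewrite !mem_filter /pb /pt; case: (y \in X); rewrite ?andbF ?andbT /= ?addr0 //.
  have [->|y0] := eqVneq y 0; first by rewrite f0 !addr0.
  by rewrite /=; case: ltP; rewrite ?addr0 ?add0r.
apply: (le_trans hE).
have := convs_big_tiny nb nt b0 t0 tle (signs m.+1).
rewrite size_signs -/t mass_cat Ea Ew => /le_trans; apply.
pose YB := \sum_(y <- X | pb y) f y `^ s; pose YT := \sum_(y <- X | pt y) f y `^ s.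
have -> : \sum_(y <- X) f y `^ s = 1 + YB + YT by rewrite split_sum f0 powR1.
have hM : (1 + (a + w)) ^+ t <= M.
  apply: (@le_trans _ _ (expR (t%:R * (a + w)))).
    by rewrite expRM_natl; apply: ler_expX; [rewrite !addr_ge0 | exact: expR_ge1Dx].
  by rewrite ler_expR; apply: le_trans hx; rewrite Ex; lra.
set tau := val_at (autocorr tiny) 0.
have tau0 : 0 <= tau by rewrite /tau val_at_autocorr; apply: sumr_ge0 => y _; apply: sqr_ge0.
(* s - 1 <= 2k / t and ln th >= -2 (m + 2 + r), so th^(s-1) >= 1 - eps. *)
pose eps : R := 4 * k%:R * (m%:R + 2 + r) / t%:R.
have c0 : 0 <= th * a + tau by rewrite addr_ge0 // mulr_ge0 // ltW.
apply: (@le_trans _ _ ((1 + a) ^+ t - t%:R * a + t%:R ^+ 2 * (vt ^+ 2 * a + tau) * M)).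
  by rewrite lerD2l ler_wpM2l // mulr_ge0 // exprn_ge0.
have nt2 : 2 * n%:R >= t%:R :> R by rewrite -natrM ler_nat /n; clear - kt; lia.
have s_eq : s = 1 + k%:R / n%:R.
  have Et : t%:R = n%:R + k%:R :> R by rewrite -natrD /n subnK //; clear - kt; lia.
  by rewrite /s Et mulrDl divff // gt_eqF.
have e_le : k%:R / n%:R <= 2 * k%:R / t%:R :> R.
  rewrite ler_pdivrMr // mulrAC ler_pdivlMr //; have := ler_wpM2l (ler0n R k) nt2; lra.
have eps0 : 0 <= eps by rewrite divr_ge0 ?ler0n // !mulr_ge0 // !addr_ge0.
have ek0 : 0 <= k%:R / n%:R :> R by rewrite divr_ge0.
have ek_half : k%:R / n%:R <= 1 / 2 :> R.
  by rewrite ler_pdivrMr // mulrC mulrA mulr1 ler_pdivlMr // -natrM ler_nat /n; clear - kt; lia.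
have lnth : - (2 * (m%:R + 2 + r)) <= ln th.
  rewrite /th /vt lnXn // lnV ?posrE ?mulr_gt0 ?expR_gt0 // lnM ?posrE ?mulr_gt0 ?expR_gt0 // expRK.
  rewrite -(natrM R 2) /t -expnS natrX lnXn // -[X in X *+ m.+2]mulr1 -mulrnAr.
  have : ln 2 * m.+2%:R <= 1 * m.+2%:R :> R by rewrite ler_wpM2r // ln2_le1.
  rewrite -!natr1 -mulr_natl; lra.
have hYB : (1 - eps) * a <= YB.
  rewrite mulr_sumr; apply: ler_sum => y /andP[y0 hy].
  have fp : 0 < f y := lt_trans th0 hy.
  rewrite s_eq powRD; last by rewrite (gt_eqF fp) implybT.
  rewrite powRr1 // mulrC ler_wpM2l //.
  apply: (@le_trans _ _ (th `^ (k%:R / n%:R))); last first.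
    by apply: ge0_ler_powR; rewrite ?nnegrE // ltW.
  apply: le_trans (powR_ge_linear th0 ek0 lnth); rewrite lerD2l lerN2 /eps.
  have : 0 <= m%:R + 2 + r by rewrite !addr_ge0.
  move/(ler_wpM2r): e_le => /[apply]; lra.
have hYT : tau <= vt * YT.
  rewrite /tau val_at_autocorr supp_wmeas ?filter_uniq // big_filter mulr_sumr.
  rewrite !(big_mkcond pt) !big_seq; apply: ler_sum => y hy; case: ifP => // hpy.
  rewrite val_at_wmeas ?filter_uniq // mem_filter hpy hy /=.
  have [->|fn0] := eqVneq (f y) 0; first by rewrite expr0n mulr_ge0 ?powR_ge0 // ltW.
  have -> : f y ^+ 2 = f y `^ (2 - s) * f y `^ s.
    by rewrite -powRD ?subrK ?powR_mulrn // fn0 implybT.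
  rewrite ler_wpM2r ?powR_ge0 //.
  have fth : f y <= th by case/andP: hpy.
  apply: (@le_trans _ _ (f y `^ (1 / 2))).
    apply: ger_powR; last by rewrite s_eq; lra.
    by rewrite lt_def fn0 fge /=; case/andP: (hf y).
  apply: (@le_trans _ _ (th `^ (1 / 2))).
    have h12 : 0 <= 1 / 2 :> R by rewrite divr_ge0.
    by apply: (ge0_ler_powR h12) => //; rewrite nnegrE // ltW.
  by rewrite div1r powR12_sqrt ?(ltW th0) // /th sqrtr_sqr gtr0_norm.
have eps_t : t%:R * eps = 4 * k%:R * (m%:R + 2 + r) by rewrite /eps mulrC divfK // gt_eqF.
apply: (small_case_numeric (eps := eps)) => //.
- by rewrite -/t in kt; clear - kt; lia.
- by clear - t2; lia.
- apply: le_trans hM; apply: ler_expX; first by rewrite addr_ge0.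
  by rewrite lerD2l lerDl.
- have aM : a <= M.
    apply: (@le_trans _ _ r); last by apply: le_trans (expR_ge1Dx r); rewrite lerDr.
    apply: le_trans hx; apply: (@le_trans _ _ (t%:R * a)).
      by rewrite ler_peMl // (ler_nat R 1); clear - t2; lia.
    by rewrite ler_pM2l // Ex; lra.
  apply: (@le_trans _ _ (eps * M)); first by rewrite ler_wpM2l.
  rewrite -(ler_pM2l tp) mulr1 mulrA eps_t mulrC.
  have k0 : 0 <= k%:R :> R by [].
  have kM : 0 <= M * k%:R by rewrite mulr_ge0 // ltW // (lt_le_trans ltr01).
  move: hnum; rewrite -/M -/t mulrDr => h; clear - h kM tp; lra.
- by apply: sumr_ge0 => y _; apply: powR_ge0.
- by apply: sumr_ge0 => y _; apply: powR_ge0.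
- by rewrite eps_t.
Qed.
End OneDim.

Section OneDimTheorem.
Variable R : realType.
Implicit Types (f : int -> R) (X : seq int).

Lemma exists_argmax f X : X != [::] -> exists2 j, j \in X & forall y, y \in X -> f y <= f j.
Proof.
elim: X => // a [|b X] IH _.
  by exists a; rewrite ?inE // => y; rewrite inE => /eqP ->.
case: IH => // j h1 h2; have [h|h] := leP (f a) (f j).
  by exists j => [|y]; rewrite inE ?h1 ?orbT // => /orP[/eqP ->|/h2].
exists a; rewrite ?inE ?eqxx // => y; rewrite inE => /orP[/eqP -> //|/h2].
by move/le_trans; apply; apply: ltW.
Qed.

(** Here r = 4 3^i bounds t (S - 1) in the nearly point-mass case, S being the mass relative to the
    mode. The first condition keeps s <= 3/2, the second makes S <= 2 there, the third is the
    numerical hypothesis of [small_case]. *)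
Definition admissible (m k i : nat) : Prop :=
  [/\ (3 * k <= 2 ^ m.+1)%N, (4 * 3 ^ i <= 2 ^ m.+1)%N &
    expR (4 * 3 ^ i)%:R * (4 * k%:R * (m%:R + 2 + (4 * 3 ^ i)%:R) + k%:R) <= 3 / 4 * (2 ^ m.+1)%:R :> R].

(** t (1 - 1/S) is the expected number of copies that leave the mode. If it is at least 2 3^i, there
    is room for i triplings; otherwise S <= 2, so t (S - 1) <= 4 3^i and the expansion around the
    mode applies. *)
Lemma onedim_normalised m k i f X : admissible m k i -> uniq X -> 0 \in X ->
  (forall y, 0 <= f y <= 1) -> f 0 = 1 ->
  energy m.+1 (wmeas f X) <=
    Num.max ((\sum_(y <- X) f y `^ ((2 ^ m.+1)%:R / (2 ^ m.+1 - k)%:R)) ^+ (2 ^ m.+1 - k))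
            ((1 - 4000^-1) ^+ i * (\sum_(y <- X) f y) ^+ (2 ^ m.+1)).
Proof.
move=> [kt it hnum] uX X0 hf f0; rewrite le_max; set t := (2 ^ m.+1)%N; set S := \sum_(y <- X) f y.
have fge y : 0 <= f y by case/andP: (hf y).
have S1 : 1 <= S by rewrite /S (bigD1_seq 0) //= f0 lerDl; apply: sumr_ge0.
have Sp : 0 < S := lt_le_trans ltr01 S1.
have tp : 0 < t%:R :> R by rewrite ltr0n expn_gt0.
set Q : R := (2 * 3 ^ i)%:R.
have rQ : (4 * 3 ^ i)%:R = 2 * Q by rewrite /Q -natrM mulnA.
have rt : 2 * Q <= t%:R by rewrite -rQ ler_nat.
have [hQ|hQ] := leP Q (t%:R * (1 - S^-1)).
  apply/orP; right; set mu := scale S^-1 (wmeas f X).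
  have pm : nonneg mu by apply: nonneg_scale; [rewrite invr_ge0 ltW | apply: nonneg_wmeas].
  have m1 : mass mu = 1 by rewrite mass_scale mass_wmeas mulVf // gt_eqF.
  have v0 : val_at mu 0 = S^-1 by rewrite val_at_scale val_at_wmeas // X0 f0 mulr1.
  have vle z : val_at mu z <= val_at mu 0.
    rewrite v0 val_at_scale val_at_wmeas // -[leRHS]mulr1 ler_wpM2l ?invr_ge0 ?(ltW Sp) //.
    by case: ifP => // _; case/andP: (hf z).
  have := anticoncentration pm m1 vle (i := i) (t := t).
  rewrite v0 => /(_ hQ (signs m.+1) 0 (size_signs _)).
  rewrite -/(energy m.+1 mu) /mu energy_scale -/t exprVn mulrC ler_pdivrMr ?exprn_gt0 //.
apply/orP; left; apply: (small_case (r := (4 * 3 ^ i)%:R)) => //.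
rewrite -/t -/S rQ.
have hS : t%:R * (S - 1) < Q * S.
  have := hQ; rewrite -(ltr_pM2r Sp) -mulrA mulrBl mul1r mulVf //; by rewrite gt_eqF.
have : S <= 2.
  rewrite leNgt; apply/negP => S2.
  have : 2 * Q * (S - 1) <= t%:R * (S - 1) by rewrite ler_wpM2r //; lra.
  have : 0 < Q by rewrite ltr0n muln_gt0 expn_gt0.
  move=> Qp h; have := le_lt_trans h hS; nra.
have : 0 < Q by rewrite ltr0n muln_gt0 expn_gt0.
by move=> Qp S2; have : Q * S <= Q * 2 by [rewrite ler_pM2l]; lra.
Qed.

(** The mode is moved to 0 and scaled to weight 1. All terms are invariant under translation and
    homogeneous of degree t in f, because s (t - k) = t. *)
Theorem onedim m k i f X : admissible m k i -> uniq X -> (forall y, 0 <= f y) ->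
  energy m.+1 (wmeas f X) <=
    Num.max ((\sum_(y <- X) f y `^ ((2 ^ m.+1)%:R / (2 ^ m.+1 - k)%:R)) ^+ (2 ^ m.+1 - k))
            ((1 - 4000^-1) ^+ i * (\sum_(y <- X) f y) ^+ (2 ^ m.+1)).
Proof.
move=> adm uX f0; set t := (2 ^ m.+1)%N; set s : R := _ / _.
have [kt _ _] := adm.
have np : (0 < t - k)%N by have := expn_gt0 2 m.+1; rewrite -/t in kt *; lia.
have tp : (0 < t)%N by rewrite expn_gt0.
have lam0 : 0 <= (1 - 4000^-1) ^+ i :> R by apply: exprn_ge0; lra.
have pw := nonneg_wmeas X f0.
have trivial : mass (wmeas f X) = 0 -> energy m.+1 (wmeas f X) <=
   Num.max ((\sum_(y <- X) f y `^ s) ^+ (t - k)) ((1 - 4000^-1) ^+ i * (\sum_(y <- X) f y) ^+ t).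
  move=> m0; rewrite -enormX // (_ : enorm _ _ = 0).
    by rewrite expr0n -/t gtn_eqF // le_max exprn_ge0 // sumr_ge0 // => y _; apply: powR_ge0.
  by apply/eqP; rewrite eq_le enorm_ge0 andbT -m0 enorm_le_mass.
have [X0|X0] := eqVneq X [::]; first by apply: trivial; rewrite mass_wmeas X0 big_nil.
have [j jX jmax] := exists_argmax f X0.
set v := f j; have [v0|v0] := eqVneq v 0.
  apply: trivial; rewrite mass_wmeas big_seq big1 // => y hy.
  by apply/eqP; rewrite eq_le f0 andbT -v0; apply: jmax.
have vp : 0 < v by rewrite lt_def v0 f0.
pose X' := [seq y - j | y <- X]; pose g y := if y + j \in X then f (y + j) / v else 0.
have gX y : y \in X -> g (y - j) = f y / v by move=> hy; rewrite /g subrK hy.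
have uX' : uniq X' by rewrite map_inj_uniq // => y z /addIr.
have X'0 : 0 \in X' by rewrite -(subrr j); apply: (map_f (fun y => y - j)).
have hg y : 0 <= g y <= 1.
  rewrite /g; case: ifP => hy; last by rewrite lexx ler01.
  by rewrite divr_ge0 // ?(ltW vp) //= ler_pdivrMr // mul1r jmax.
have g0 : g 0 = 1 by rewrite -(subrr j) gX // divff.
have := onedim_normalised adm uX' X'0 hg g0; rewrite -/t -/s.
have -> : wmeas g X' = scale v^-1 (translate j (wmeas f X)).
  rewrite /wmeas /scale /translate -!map_comp; apply/eq_in_map => y hy /=.
  by rewrite gX // mulrC.
rewrite energy_scale energy_translate -/t.
have -> : \sum_(y <- X') g y = v^-1 * \sum_(y <- X) f y.
  by rewrite big_map mulr_sumr !big_seq; apply: eq_bigr => y hy; rewrite gX // mulrC.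
have -> : \sum_(y <- X') g y `^ s = v^-1 `^ s * \sum_(y <- X) f y `^ s.
  rewrite big_map mulr_sumr !big_seq; apply: eq_bigr => y hy.
  by rewrite gX // mulrC powRM // invr_ge0 ltW.
have vt : 0 < v^-1 ^+ t by rewrite exprn_gt0 // invr_gt0.
rewrite !exprMn [X in Num.max _ X]mulrCA.
have -> : v^-1 `^ s ^+ (t - k) = v^-1 ^+ t.
  rewrite -powR_mulrn ?powR_ge0 // -powRrM /s divfK ?powR_mulrn // ?invr_ge0 ?(ltW vp) //.
  by rewrite pnatr_eq0 -lt0n.
by rewrite -maxr_pMr ?(ltW vt) // ler_pM2l.
Qed.
End OneDimTheorem.

(** * Tensorisation over the primes *)

Section Tensor.
Variables (R : realType) (G : zmodType) (ell : {additive G -> int}).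
Implicit Types (mu : seq (G * R)) (X : seq int) (bs : seq bool).

Definition pure (q : int * seq (G * R)) := nonneg q.2 && all (fun x => ell x.1 == q.1) q.2.

Lemma convs_pure_level (qs : seq (int * seq (G * R))) z : all pure qs ->
  ell z != \sum_(q <- qs) q.1 -> convs (map snd qs) z = 0.
Proof.
elim: qs z => [|q qs IH] z /=.
  rewrite big_nil => _; rewrite /convs /= /dirac0; case: (eqVneq z 0) => // ->.
  by rewrite raddf0 eqxx.
move=> /andP[/andP[_ hq] hqs]; rewrite big_cons => hz.
rewrite /conv big_seq big1 // => x hx; rewrite -/(convs _) IH ?mulr0 //.
rewrite raddfB (eqP (allP hq _ hx)); apply: contra hz => /eqP <-.
by rewrite addrC subrK.
Qed.

Definition fiber mu (y : int) : seq (G * R) := [seq p <- mu | ell p.1 == y].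

Lemma conv_sgn_fibers b mu X F z : uniq X -> (forall p, p \in mu -> ell p.1 \in X) ->
  conv (sgn_meas b mu) F z = \sum_(y <- X) conv (sgn_meas b (fiber mu y)) F z.
Proof.
move=> uX hX.
have E nu : conv (sgn_meas b nu) F z = \sum_(p <- nu) p.2 * F (z - (if b then p.1 else - p.1)).
  by case: b; rewrite /conv //= big_map.
rewrite E; under [RHS]eq_bigr do rewrite E big_filter big_mkcond.
rewrite exchange_big /= !big_seq; apply: eq_bigr => p hp.
by rewrite (bigD1_seq (ell p.1)) ?hX //= eqxx big1 ?addr0 // => y; rewrite eq_sym => /negbTE ->.
Qed.

(* Hoelder on each tuple of fibres; only tuples of levels with vanishing signed
   sum contribute. *)
Lemma energy_le_fibers m mu X : nonneg mu -> uniq X -> (forall p, p \in mu -> ell p.1 \in X) ->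
  energy m.+1 mu <= energy m.+1 (wmeas (fun y => enorm m.+1 (fiber mu y)) X).
Proof.
move=> pm uX hX; set f := fun y => _; set t := (2 ^ m.+1)%N.
have pf y : nonneg (fiber mu y) by apply/allP => p; rewrite mem_filter => /andP[_ /(allP pm)].
(* Factors already expanded are kept in [qs] as measures on single levels, so that Hoelder is
   applied once, to complete tuples; the remaining factors on the right have to reach minus the sum
   of their levels. *)
have H (bs : seq bool) (qs : seq (int * seq (G * R))) : (size qs + size bs)%N = t -> all pure qs ->
  convs (map snd qs ++ [seq sgn_meas b mu | b <- bs]) 0 <=
  (\prod_(q <- qs) enorm m.+1 q.2) * convs [seq sgn_meas b (wmeas f X) | b <- bs] (- \sum_(q <- qs) q.1).
  elim: bs qs => [|b bs IH] qs sz pq.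
    rewrite cats0 /convs /= -/(convs _) /dirac0 oppr_eq0; case: eqP => [_|/eqP h].
      rewrite mulr1; apply: le_trans (convs_hoelder (m := m) _ _ _) _; last by rewrite big_map.
        by move: sz; rewrite size_map addn0.
      by rewrite all_map; apply: sub_all pq => q /andP[].
    by rewrite mulr0 convs_pure_level // raddf0 eq_sym.
  rewrite convs_mid (conv_sgn_fibers _ _ _ uX hX).
  have -> : convs [seq sgn_meas b0 (wmeas f X) | b0 <- b :: bs] (- \sum_(q <- qs) q.1) =
      \sum_(y <- X) f y * convs [seq sgn_meas b0 (wmeas f X) | b0 <- bs]
        (- \sum_(q <- qs) q.1 - (if b then y else - y)).
    by case: (b); rewrite /= {1}/conv /= ?big_map.
  rewrite mulr_sumr; apply: ler_sum => y _.
  pose q : int * seq (G * R) := (if b then y else - y, sgn_meas b (fiber mu y)).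
  have pq' : all pure (rcons qs q).
    rewrite all_rcons pq andbT /pure /= nonneg_sgn pf /=; apply/allP => x.
    case: (b); first by rewrite mem_filter => /andP[].
    by case/mapP => w; rewrite mem_filter => /andP[/eqP <- _] -> /=; rewrite raddfN.
  have := IH (rcons qs q); rewrite size_rcons -sz addSnnS => /(_ erefl pq').
  rewrite map_rcons cat_rcons convs_mid -cats1 !big_cat !big_seq1 /= enorm_sgn // opprD mulrA.
  by [].
have := H (signs m.+1) [::]; rewrite big_nil mul1r big_nil oppr0 => h.
by apply: h => //; rewrite size_signs.
Qed.
End Tensor.

(** * Weighted AM-GM and Hoelder inequalities *)

Section WeightedMeans.
Variable R : realType.

(** exp lies above its tangent at w, the weighted mean of the logarithms, and the weighted average
    of the two tangent values is exp w. *)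
Lemma weighted_amgm (u v d : R) : 0 < u -> 0 < v -> 0 <= d <= 1 ->
  u `^ (1 - d) * v `^ d <= (1 - d) * u + d * v.
Proof.
move=> u0 v0 /andP[d0 d1]; rewrite /powR !gt_eqF // -expRD.
set w := _ + _.
have tangent (y : R) : 0 < y -> expR w * (1 + (ln y - w)) <= y.
  move=> y0; have E : expR w * expR (ln y - w) = y by rewrite -expRD addrC subrK lnK.
  by rewrite -[leRHS]E ler_wpM2l ?expR_ge0 // expR_ge1Dx.
have hu := tangent u u0; have hv := tangent v v0.
have d1' : 0 <= 1 - d by rewrite subr_ge0.
apply: le_trans (lerD (ler_wpM2l d1' hu) (ler_wpM2l d0 hv)).
have -> : (1 - d) * (expR w * (1 + (ln u - w))) + d * (expR w * (1 + (ln v - w))) =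
   expR w * (1 + ((1 - d) * ln u + d * ln v - w)) by ring.
by rewrite -/w subrr addr0 mulr1.
Qed.

Lemma hoelder_powR (I : eqType) (r : seq I) (a b : I -> R) (d : R) : 0 < d < 1 ->
  (forall i, 0 <= a i) -> (forall i, 0 <= b i) ->
  \sum_(i <- r) a i `^ (1 - d) * b i `^ d <=
  (\sum_(i <- r) a i) `^ (1 - d) * (\sum_(i <- r) b i) `^ d.
Proof.
move=> /andP[d0 d1] a0 b0; have d1' : 0 < 1 - d by rewrite subr_gt0.
set A := \sum_(i <- r) a i; set B := \sum_(i <- r) b i.
have A0 : 0 <= A by apply: sumr_ge0.
have B0 : 0 <= B by apply: sumr_ge0.
have [hA|hA] := eqVneq A 0.
  rewrite big_seq big1 => [|i hi]; first by rewrite mulr_ge0 ?powR_ge0.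
  have /eqP -> : a i == 0.
    by rewrite eq_le a0 andbT -hA /A (big_rem i) //= lerDl sumr_ge0.
  by rewrite powR0 ?mul0r // gt_eqF.
have [hB|hB] := eqVneq B 0.
  rewrite big_seq big1 => [|i hi]; first by rewrite mulr_ge0 ?powR_ge0.
  have /eqP -> : b i == 0.
    by rewrite eq_le b0 andbT -hB /B (big_rem i) //= lerDl sumr_ge0.
  by rewrite mulrC powR0 ?mul0r // gt_eqF.
have Ap : 0 < A by rewrite lt_def hA.
have Bp : 0 < B by rewrite lt_def hB.
set P := A `^ (1 - d) * B `^ d; have Pp : 0 < P by rewrite mulr_gt0 // powR_gt0.
have step i : a i `^ (1 - d) * b i `^ d <= P * ((1 - d) * (a i / A) + d * (b i / B)).
  have [->|ai] := eqVneq (a i) 0.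
    rewrite powR0 ?(gt_eqF d1') // !mul0r mulr0 add0r.
    by apply: mulr_ge0; [exact: ltW | apply: mulr_ge0; [exact: ltW | exact: divr_ge0]].
  have [->|bi] := eqVneq (b i) 0.
    rewrite powR0 ?(gt_eqF d0) // mul0r !mulr0 addr0.
    by apply: mulr_ge0; [exact: ltW | apply: mulr_ge0; [exact: ltW | exact: divr_ge0]].
  have aip : 0 < a i by rewrite lt_def ai a0.
  have bip : 0 < b i by rewrite lt_def bi b0.
  have -> : a i `^ (1 - d) * b i `^ d = P * ((a i / A) `^ (1 - d) * (b i / B) `^ d).
    have e1 : a i `^ (1 - d) = A `^ (1 - d) * (a i / A) `^ (1 - d).
      by rewrite -powRM ?divr_ge0 // mulrC divfK.
    have e2 : b i `^ d = B `^ d * (b i / B) `^ d by rewrite -powRM ?divr_ge0 // mulrC divfK.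
    by rewrite e1 e2 /P mulrACA.
  rewrite ler_pM2l //; apply: weighted_amgm; rewrite ?divr_gt0 //.
  by rewrite !ltW.
apply: le_trans (ler_sum _ (fun i _ => step i)) _.
rewrite -mulr_sumr big_split /= -!mulr_sumr -!mulr_suml -/A -/B !divff //.
by rewrite !mulr1 subrK mulr1.
Qed.
End WeightedMeans.

(** * Exponent vectors and the induction over the primes *)

Section Multiplicative.
Variables (R : realType) (n : nat).
Implicit Types (A : seq int).

(** Turns products of nonzero integers into sums in a group. Signs are lost, and coordinates at
    non-prime indices are 0; with n the largest |a|, equal vectors mean equality up to sign. *)
Definition valuations (a : int) : {ffun 'I_n.+1 -> int} := [ffun i : 'I_n.+1 => (lev i a)%:Z].

Definition coord (p : nat) (x : {ffun 'I_n.+1 -> int}) : int := x (inord p).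

Lemma coord_is_zmod p : zmod_morphism (coord p).
Proof. by move=> x y; rewrite /coord !ffunE. Qed.
HB.instance Definition _ p := GRing.isZmodMorphism.Build _ _ (coord p) (coord_is_zmod p).

Lemma coord_valuations p a : (p <= n)%N -> coord p (valuations a) = (lev p a)%:Z.
Proof. by move=> h; rewrite /coord ffunE inordK. Qed.

Lemma size_abs_const_le2 A : uniq A -> (forall a b, a \in A -> b \in A -> `|a|%N = `|b|%N) ->
  (size A <= 2)%N.
Proof.
case: A => // a0 A uA hA; apply: (@uniq_leq_size _ _ [:: a0; - a0]) => // a ha.
have := hA a a0 ha (mem_head _ _); rewrite !inE; lia.
Qed.

(** The factor 2^d pays for the pairs a, -a, which valuations do not separate. *)
Definition mult_bound (d : R) (A : seq int) (D : R) : R :=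
  2 `^ d * (size A)%:R `^ (1 - d) * D `^ (2 * d).

Lemma fiber_unif p A j : (p <= n)%N ->
  fiber (coord p) (unif R valuations A) j%:Z = unif R valuations (fib p j A).
Proof.
by move=> pn; rewrite /fiber /unif filter_map; congr map; apply: eq_filter => a /=; rewrite coord_valuations.
Qed.

Lemma sum_size_fib p B A : (forall a, a \in A -> (lev p a < B)%N) ->
  \sum_(0 <= j < B) (size (fib p j A))%:R = (size A)%:R :> R.
Proof.
move=> hA; rewrite -natr_sum; congr _%:R.
under eq_bigr do rewrite size_filter -sum1_count big_mkcond.
rewrite exchange_big /= -sum1_size !big_seq; apply: eq_bigr => a ha.
rewrite (bigD1_seq (lev p a)) ?iota_uniq ?mem_index_iota ?hA //= eqxx big1 // => j.
by rewrite eq_sym => /negbTE ->.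
Qed.

(** Induction over the primes, with [onedim] applied to the norms f_j of the fibres. In its first
    term the exponent s with (1 - d) s = 1 makes the size factor additive over the fibres, and every
    fibre has dimension at most D. In the second, Hoelder with exponents 1 - d and d and the split
    branch of [qdim] bound the sum of the f_j by W L^d; the t-th power costs L^(d t) = L^k, which (1
    - 1/4000)^i absorbs. *)
Theorem enorm_valuations_le m k i (L : R) B ps A : admissible R m k i -> (0 < k)%N -> 0 < L ->
  (1 - 4000^-1) ^+ i * L ^+ k <= 1 -> all (fun p => p <= n)%N ps -> uniq A ->
  (forall a, a \in A -> a != 0 /\ forall p, p \in ps -> (lev p a < B)%N) ->
  (forall a b, a \in A -> b \in A -> (forall p, p \in ps -> lev p a = lev p b) -> `|a|%N = `|b|%N) ->
  enorm m.+1 (unif R valuations A) <= mult_bound (k%:R / (2 ^ m.+1)%:R) A (qdim L B ps A).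
Proof.
move=> adm k0 L0 hlam; set t := (2 ^ m.+1)%N; set d : R := _ / _.
have [kt _ _] := adm; rewrite -/t in kt.
have tp : 0 < t%:R :> R by rewrite ltr0n expn_gt0.
have k0' : 0 < k%:R :> R by rewrite ltr0n.
have t0 : (0 < t)%N by rewrite expn_gt0.
have nkt : (0 < t - k)%N by clear - kt t0; lia.
have dt : d * t%:R = k%:R by rewrite /d divfK // gt_eqF.
have dp : 0 < d by rewrite divr_gt0.
have d1 : d < 1 by rewrite ltr_pdivrMr // mul1r ltr_nat; clear - nkt; lia.
have d1t : (1 - d) * t%:R = (t - k)%:R by rewrite mulrBl mul1r dt natrB //; clear - nkt; lia.
elim: ps A => [|p ps IH] A.
  move=> _ uA hA sep /=; case: (eqVneq A [::]) => [->|An] /=.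
    by rewrite /unif /= enorm_nil /mult_bound !mulr_ge0 ?powR_ge0.
  have s2 : (size A <= 2)%N by apply: size_abs_const_le2 => // a b ha hb; apply: sep.
  have s0 : 0 < (size A)%:R :> R by rewrite ltr0n lt0n size_eq0.
  apply: le_trans (enorm_le_mass _ (nonneg_unif _ _ _)) _.
  rewrite mass_unif /mult_bound powR1 mulr1.
  have {1}-> : (size A)%:R = (size A)%:R `^ d * (size A)%:R `^ (1 - d) :> R.
    by rewrite -powRD ?(gt_eqF s0) ?implybT // addrC subrK powRr1 // ltW.
  rewrite ler_wpM2r ?powR_ge0 //; apply: ge0_ler_powR; rewrite ?nnegrE ?ler0n //; first exact: ltW.
  by rewrite ler_nat.
move=> /andP[pn psn] uA hA sep; set D := qdim L B (p :: ps) A.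
have D0 : 0 <= D := qdim_ge0 _ _ _ _.
pose X := [seq j%:Z | j <- index_iota 0 B].
have uX : uniq X by rewrite map_inj_uniq ?iota_uniq // => x y [].
have levB a : a \in A -> (lev p a < B)%N by case/hA => _; apply; rewrite inE eqxx.
have hX (x : {ffun 'I_n.+1 -> int} * R) : x \in unif R valuations A -> coord p x.1 \in X.
  case/mapP => a ha -> /=; rewrite coord_valuations // map_f // mem_index_iota /=.
  exact: levB.
set W := mult_bound d A D; have W0 : 0 <= W by rewrite /W /mult_bound !mulr_ge0 ?powR_ge0.
apply: (@le_root _ t) => //.
rewrite enormX ?nonneg_unif //.
apply: le_trans (energy_le_fibers _ (nonneg_unif _ _ _) uX hX) _.
apply: le_trans (onedim adm uX _) _ => [y|]; first exact: enorm_ge0.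
rewrite -/t; set s : R := t%:R / _.
pose f j := enorm m.+1 (unif R valuations (fib p j A)).
pose w j := mult_bound d (fib p j A) (qdim L B ps (fib p j A)).
have fw j : f j <= w j.
  apply: IH => //; first by rewrite filter_uniq.
    move=> a; rewrite mem_filter => /andP[_ /hA[h1 h2]]; split=> // r hr.
    by apply: h2; rewrite inE hr orbT.
  move=> a b; rewrite !mem_filter => /andP[/eqP ea ha] /andP[/eqP eb hb] h.
  by apply: sep => // r; rewrite inE => /orP[/eqP ->|/h //]; rewrite ea eb.
have f0 j : 0 <= f j by apply: enorm_ge0.
have w0 j : 0 <= w j := le_trans (f0 j) (fw j).
have sA := sum_size_fib levB.
rewrite !big_map.
under eq_bigr do rewrite fiber_unif // -/(f _).
under [X in _ * X ^+ _]eq_bigr do rewrite fiber_unif // -/(f _).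
have s0 : 0 <= s by rewrite divr_ge0.
have ds : (1 - d) * s = 1.
  by rewrite /s mulrA d1t divff // pnatr_eq0 -lt0n.
rewrite ge_max; apply/andP; split.
  apply: (@le_trans _ _ ((W `^ s) ^+ (t - k))); last first.
    by rewrite -powR_mulrn ?powR_ge0 // -powRrM /s divfK ?pnatr_eq0 -?lt0n // powR_mulrn.
  apply: ler_expX; first by apply: sumr_ge0 => j _; apply: powR_ge0.
  have -> : W `^ s = 2 `^ (d * s) * D `^ (2 * d * s) * (size A)%:R.
    rewrite /W /mult_bound !powRM ?mulr_ge0 ?powR_ge0 // -!powRrM ds powRr1 // mulrAC.
    by [].
  rewrite -sA mulr_sumr !big_nat; apply: ler_sum => j /andP[_ jB].
  apply: (@le_trans _ _ (w j `^ s)); first by apply: ge0_ler_powR; rewrite ?nnegrE.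
  rewrite /w /mult_bound !powRM ?mulr_ge0 ?powR_ge0 // -!powRrM ds powRr1 // mulrAC.
  rewrite ler_wpM2r // ler_wpM2l ?powR_ge0 //.
  apply: ge0_ler_powR; rewrite ?nnegrE ?qdim_ge0 // ?qdim_fib //.
  by apply: mulr_ge0 => //; apply: mulr_ge0 => //; apply: ltW.
have hsum : \sum_(0 <= j < B) f j <= W * L `^ d.
  apply: (@le_trans _ _ (\sum_(0 <= j < B) 2 `^ d *
     ((size (fib p j A))%:R `^ (1 - d) * (qdim L B ps (fib p j A) ^+ 2) `^ d))).
    apply: ler_sum => j _; apply: (le_trans (fw j)).
    by rewrite /w /mult_bound -mulrA powRrM powR_mulrn ?qdim_ge0.
  rewrite -mulr_sumr /W /mult_bound -!mulrA ler_wpM2l ?powR_ge0 //.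
  apply: le_trans (hoelder_powR _ _ _ _) _; rewrite ?dp //.
    by move=> j; apply: sqr_ge0.
  rewrite sA ler_wpM2l ?powR_ge0 // mulrC powRrM powR_mulrn // -powRM ?sqr_ge0 ?(ltW L0) //.
  apply: ge0_ler_powR; rewrite ?nnegrE ?(ltW dp) //.
  - by apply: sumr_ge0 => j _; apply: sqr_ge0.
  - by rewrite mulr_ge0 ?sqr_ge0 // ltW.
  - exact: sum_qdim_fib.
have sf0 : 0 <= \sum_(0 <= j < B) f j by apply: sumr_ge0.
have lam0 : 0 <= (1 - 4000^-1) ^+ i :> R by apply: exprn_ge0; clear; lra.
apply: (@le_trans _ _ ((1 - 4000^-1) ^+ i * (W * L `^ d) ^+ t)).
  by rewrite ler_wpM2l // ler_expX.
have -> : (W * L `^ d) ^+ t = W ^+ t * L ^+ k.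
  by rewrite exprMn -[L `^ d ^+ t]powR_mulrn ?powR_ge0 // -powRrM dt powR_mulrn // ltW.
by rewrite mulrCA ler_piMr // exprn_ge0.
Qed.
End Multiplicative.

(** * Splitting a zero-free set *)

Section Decomposition.
Variable R : realType.
Implicit Types A : seq int.

Lemma lev_large p a n : a != 0 -> (`|a| <= n)%N -> (n < p)%N -> lev p a = 0%N.
Proof.
move=> a0 an np; apply/eqP; rewrite -leqn0 leqNgt; apply/negP => h.
have : (p %| `|a|)%N.
  move: h; rewrite /lev logn_gt0 mem_primes => /and3P[_ _ h]; exact: h.
move/dvdn_leq; lia.
Qed.

(** All primes up to the largest |a| are queried, so that the valuations determine an element up to
    sign; every valuation of a is below |a|, hence below n + 1. The same primes and the same price
    t'^2 serve the removal and the multiplicative bound. *)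
Lemma decomposition m' m k i (q : R) A : admissible R m k i -> (0 < k)%N ->
  (1 - 4000^-1) ^+ i * ((2 ^ m'.+1) ^ 2)%:R ^+ k <= 1 :> R ->
  uniq A -> 0 \notin A -> 1 <= q -> (size A)%:R <= q ^+ 8 ->
  exists n (P : pred int),
    enorm m'.+1 (unif R id [seq a <- A | P a]) <= 8 / q * (size A)%:R /\
    enorm m.+1 (unif R (@valuations n) [seq a <- A | ~~ P a]) <=
      mult_bound (k%:R / (2 ^ m.+1)%:R) A (2 * q ^+ 2).
Proof.
move=> adm k0 hlam uA A0 q1 szA.
pose n := \max_(a <- A) `|a|%N; exists n.
have an a : a \in A -> (`|a| <= n)%N.
  by move=> ha; apply: (@leq_bigmax_seq _ A xpredT (fun a : int => `|a|%N) a).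
have anz a : a \in A -> a != 0 by move=> ha; apply: contraNneq A0 => <-.
pose ps := [seq p <- iota 0 n.+1 | prime p].
have pps : all prime ps by apply: filter_all.
have hA a : a \in A -> a != 0 /\ forall p, p \in ps -> (lev p a < n.+1)%N.
  move=> ha; split=> [|p _]; first exact: anz.
  have a0 : (0 < `|a|)%N by rewrite absz_gt0 anz.
  by rewrite ltnS; apply: leq_trans (an _ ha); apply: ltnW; apply: ltn_logl.
have [P [hP1 hP2]] := greedy_removal m' uA q1 szA pps hA.
have q0 : 0 < q by apply: lt_le_trans q1.
exists P; split.
  apply: (le_trans hP1); rewrite ler_wpM2l ?divr_ge0 ?(ltW q0) // ler_nat size_filter.
  exact: count_size.
have L0 : 0 < ((2 ^ m'.+1) ^ 2)%:R :> R by rewrite ltr0n !expn_gt0.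
have psn : all (fun p => p <= n)%N ps.
  by apply/allP => p; rewrite mem_filter mem_iota add0n ltnS => /and3P[].
have uC : uniq [seq a <- A | ~~ P a] by apply: filter_uniq.
apply: (le_trans (enorm_valuations_le (n := n) (B := n.+1) (ps := ps) adm k0 L0 hlam psn uC _ _)).
- by move=> a; rewrite mem_filter => /andP[_]; apply: hA.
- move=> a b; rewrite !mem_filter => /andP[_ ha] /andP[_ hb] h.
  have [a0 b0] := (anz _ ha, anz _ hb).
  apply: eqn_from_log; rewrite ?absz_gt0 // => p.
  rewrite -/(lev p a) -/(lev p b); have [pn|pn] := leqP p n; last first.
    by rewrite !(lev_large _ _ pn) ?an.
  have [pp|pp] := boolP (prime p).
    by apply: h; rewrite mem_filter pp mem_iota add0n ltnS.
  by rewrite /lev (lognE p `|a|) (lognE p `|b|) (negbTE pp).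
rewrite /mult_bound; set d : R := _ / _.
have d0 : 0 <= d by rewrite divr_ge0.
have d1 : d <= 1.
  have [kt _ _] := adm; rewrite ler_pdivrMr ?ltr0n ?expn_gt0 // mul1r ler_nat.
  by apply: leq_trans kt; rewrite leq_pmull.
have q20 : 0 <= 2 * q ^+ 2 by rewrite mulr_ge0 // exprn_ge0 // ltW.
apply: ler_pM; rewrite ?mulr_ge0 ?powR_ge0 //.
  rewrite ler_wpM2l ?powR_ge0 //; apply: ge0_ler_powR; rewrite ?nnegrE ?subr_ge0 //.
  by rewrite ler_nat size_filter count_size.
by apply: ge0_ler_powR; rewrite ?nnegrE ?qdim_ge0 // mulr_ge0.
Qed.
End Decomposition.

(** * Counting solutions *)

Section Counting.
Variables (R : realType) (G : zmodType) (phi : int -> G).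

Definition signed_sum (bs : seq bool) (tau : seq int) : G :=
  \sum_(p <- zip bs tau) (if p.1 then phi p.2 else - phi p.2).

Lemma sum_choices (bs : seq bool) (Ls : seq (seq int)) z : size bs = size Ls ->
  \sum_(tau <- choices Ls) (signed_sum bs tau == z)%:R =
  convs [seq sgn_meas p.1 (unif R phi p.2) | p <- zip bs Ls] z.
Proof.
elim: Ls bs z => [|X Ls IH] [|b bs] z //=.
  by move=> _; rewrite big_seq1 /signed_sum /= big_nil /convs /= /dirac0 eq_sym.
move=> [sz]; rewrite big_allpairs_dep.
have -> : conv (sgn_meas b (unif R phi X)) (convs [seq sgn_meas p.1 (unif R phi p.2) | p <- zip bs Ls]) z
  = \sum_(x <- X) convs [seq sgn_meas p.1 (unif R phi p.2) | p <- zip bs Ls] (z - (if b then phi x else - phi x)).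
  by case: b; rewrite /conv /= ?big_map; apply: eq_bigr => x _; rewrite mul1r.
apply: eq_bigr => x _; rewrite -IH //; apply: eq_bigr => tau _.
by rewrite /signed_sum /= big_cons /= [in RHS]eq_sym subr_eq eq_sym addrC.
Qed.

Lemma size_choices_mem (Ls : seq (seq int)) tau : tau \in choices Ls ->
  size tau = size Ls /\ forall j, (j < size Ls)%N -> nth 0 tau j \in nth [::] Ls j.
Proof.
elim: Ls tau => [|X Ls IH] tau /=; first by rewrite inE => /eqP ->.
move=> /allpairsP[[x t] [/= hx /IH[h1 h2] ->]] /=; split; first by rewrite h1.
by case=> //= j; apply: h2.
Qed.

Lemma signed_sum_split s tau : size tau = (2 * s)%N ->
  signed_sum (nseq s true ++ nseq s false) tau =
  \sum_(x <- take s tau) phi x - \sum_(x <- drop s tau) phi x.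
Proof.
move=> sz; rewrite -{1}(cat_take_drop s tau) /signed_sum zip_cat ?size_nseq ?size_takel //; last by rewrite sz; lia.
have H b (t : seq int) j : size t = j ->
    \sum_(p <- zip (nseq j b) t) (if p.1 then phi p.2 else - phi p.2) =
    \sum_(x <- t) (if b then phi x else - phi x).
  by elim: t j => [|x t IH] [|j] //= => [|[/IH h]]; rewrite ?big_nil // !big_cons h.
have s1 : size (take s tau) = s by rewrite size_takel // sz leq_pmull.
have s2 : size (drop s tau) = s by rewrite size_drop sz mul2n -addnn addnK.
by rewrite big_cat /= (H _ _ _ s1) (H _ _ _ s2) sumrN.
Qed.

(** Hoelder bounds t copies of X uniformly in the target, so all other variables can be frozen at
    the cost of their masses, at most N each. Signs do not affect the norm, hence the copies may lie
    on either side of the equation. *)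
Lemma convs_many_copies m (bLs : seq (bool * seq int)) (X : seq int) N z :
  (2 ^ m.+1 <= count (fun p => p.2 == X) bLs)%N -> all (fun p => size p.2 <= N)%N bLs ->
  convs [seq sgn_meas p.1 (unif R phi p.2) | p <- bLs] z <=
  enorm m.+1 (unif R phi X) ^+ (2 ^ m.+1) * N%:R ^+ (size bLs - 2 ^ m.+1).
Proof.
set t := (2 ^ m.+1)%N; set Q := fun p : bool * seq int => p.2 == X.
set F := fun p : bool * seq int => sgn_meas p.1 (unif R phi p.2) => ht hN.
set l1 := take t (seq.filter Q bLs); set l2 := drop t (seq.filter Q bLs) ++ seq.filter (predC Q) bLs.
have pe : perm_eq bLs (l2 ++ l1).
  rewrite perm_sym perm_catC /l1 /l2 catA cat_take_drop; exact/permPl/perm_filterC.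
have s1 : size l1 = t by rewrite size_takel // size_filter.
have s2 : (size bLs - t)%N = size l2.
  by rewrite (perm_size pe) size_cat s1 addnK.
have nnF l : all nonneg (map F l).
  by rewrite all_map; apply/allP => p _ /=; rewrite nonneg_sgn nonneg_unif.
rewrite (convs_perm (perm_map F pe)) map_cat convs_cat mulrC.
have h1 y : convs (map F l1) y <= enorm m.+1 (unif R phi X) ^+ t.
  apply: le_trans (convs_hoelder (m := m) _ _ (nnF _)) _; first by rewrite size_map s1.
  rewrite big_map big_seq (eq_bigr (fun=> enorm m.+1 (unif R phi X))); last first.
    by move=> p /mem_take; rewrite mem_filter => /andP[/eqP <- _]; rewrite enorm_sgn // nonneg_unif.
  by rewrite -big_seq big_const_seq count_predT iter_mulr mulr1 s1.
apply: le_trans (foldr_conv_le_mass _ (nnF _) h1) _.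
rewrite ler_wpM2r ?exprn_ge0 ?enorm_ge0 // s2 big_map.
have : all (fun p => size p.2 <= N)%N l2 by move: hN; rewrite (perm_all _ pe) all_cat => /andP[].
elim: l2 {pe s2} => [|p l IH] /=; first by rewrite big_nil.
move=> /andP[hp /IH h]; rewrite big_cons exprS; apply: ler_pM => //.
- by rewrite mass_ge0 // nonneg_sgn nonneg_unif.
- by apply: prodr_ge0 => r _; rewrite mass_ge0 // nonneg_sgn nonneg_unif.
- by rewrite mass_sgn mass_unif ler_nat.
Qed.

(** [ev] only has to imply the linear relation between the images: equality of products is relaxed
    to equality of exponent vectors, which can only add solutions. *)
Lemma count_solutions_le m s (As : seq {fset int}) (X : {fset int}) N (ev : pred (seq int)) :
  size As = (2 * s)%N -> (2 ^ m.+1 <= count (pred1 X) As)%N -> all (fun Y : {fset int} => #|` Y| <= N)%N As ->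
  (forall tau, tau \in tuples_of As -> ev tau ->
     \sum_(x <- take s tau) phi x = \sum_(x <- drop s tau) phi x) ->
  (count ev (tuples_of As))%:R <=
    enorm m.+1 (unif R phi (enum_fset X)) ^+ (2 ^ m.+1) * N%:R ^+ (2 * s - 2 ^ m.+1).
Proof.
move=> sz hc hN hev; pose bs := nseq s true ++ nseq s false.
set Ls := [seq enum_fset A | A <- As]; have sLs : size Ls = (2 * s)%N by rewrite size_map.
have sbs : size bs = size Ls by rewrite size_cat !size_nseq sLs; lia.
apply: (@le_trans _ _ (\sum_(tau <- choices Ls) (signed_sum bs tau == 0)%:R)).
  rewrite -natr_sum ler_nat -sum1_count big_mkcond /= !big_seq; apply: leq_sum => tau htau.
  case: ifP => // he; have [st _] := size_choices_mem htau.
  by rewrite signed_sum_split ?st ?sLs // (hev _ htau he) subrr eqxx.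
rewrite sum_choices //.
have szz : size (zip bs Ls) = (2 * s)%N by rewrite size_zip sbs minnn.
rewrite -szz; apply: convs_many_copies.
  apply: (leq_trans hc).
  rewrite -(count_map (fun p : bool * seq int => p.2) (pred1 (enum_fset X))) -/(unzip2 _) unzip2_zip ?sbs //.
  rewrite count_map; apply: sub_count => Y /= /eqP ->; exact: eqxx.
have : all (fun Y : seq int => size Y <= N)%N (unzip2 (zip bs Ls)).
  by rewrite unzip2_zip ?sbs // all_map; apply: sub_all hN => Y.
by rewrite all_map.
Qed.
End Counting.

Section Products.
Variable n : nat.

Lemma valuationsM a b : a != 0 -> b != 0 -> valuations n (a * b) = valuations n a + valuations n b.
Proof.
move=> a0 b0; apply/ffunP => j; rewrite !ffunE /lev abszM lognM ?absz_gt0 //.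
Qed.

Lemma valuations_prod (t : seq int) : all (fun x => x != 0) t ->
  valuations n (\prod_(x <- t) x) = \sum_(x <- t) valuations n x.
Proof.
elim: t => [_|x t IH /= /andP[x0 ht]].
  by rewrite !big_nil; apply/ffunP => j; rewrite !ffunE /lev /= logn1.
rewrite !big_cons valuationsM ?IH //.
by rewrite prodf_seq_neq0; apply: sub_all ht.
Qed.

(** A zero-free right side makes the common product nonzero, hence the left side is zero-free too.
    This lets M_s(B, C) be treated although B may contain 0. *)
Lemma prod_eq_valuations (t1 t2 : seq int) : all (fun x => x != 0) t2 ->
  \prod_(x <- t1) x = \prod_(x <- t2) x ->
  \sum_(x <- t1) valuations n x = \sum_(x <- t2) valuations n x.
Proof.
move=> h2 e; have h1 : all (fun x => x != 0) t1.
  have : \prod_(x <- t2) x != 0 by rewrite prodf_seq_neq0; apply: sub_all h2.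
  by rewrite -e prodf_seq_neq0; apply: sub_all.
by rewrite -!valuations_prod // e.
Qed.
End Products.

(** * Numerical choice of the parameters *)

Section NumericalChoices.
Variable R : realType.

Lemma bernoulli_add (y : R) n : 0 <= y -> 1 + n%:R * y <= (1 + y) ^+ n.
Proof.
move=> y0; elim: n => [|n IH]; first by rewrite mul0r addr0 expr0.
rewrite exprS; apply: (@le_trans _ _ ((1 + y) * (1 + n%:R * y))); last by rewrite ler_wpM2l // addr_ge0.
have : 0 <= n%:R * y * y by rewrite !mulr_ge0.
by rewrite -natr1; lra.
Qed.

(** Bernoulli gives (1 + 1/c)^c >= 2, and (1 - 1/c^2)^c <= 1. *)
Lemma half_power (c : nat) : (0 < c)%N -> (1 - c%:R^-1) ^+ c * 2 <= 1 :> R.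
Proof.
move=> c0; have cp : 0 < c%:R :> R by rewrite ltr0n.
have ci : 0 <= (c%:R^-1 : R) <= 1 by rewrite invr_ge0 ler0n /= invf_le1 // ler1n.
have /andP[y0 y1] := ci.
have h : 2 <= (1 + c%:R^-1) ^+ c :> R.
  by apply: le_trans (bernoulli_add c y0); rewrite mulfV ?gt_eqF.
apply: (@le_trans _ _ ((1 - c%:R^-1) ^+ c * (1 + c%:R^-1) ^+ c)).
  by rewrite ler_wpM2l // exprn_ge0 // subr_ge0.
rewrite -exprMn; apply: exprn_ile1.
  by rewrite mulr_ge0 ?subr_ge0 // addr_ge0.
have : 0 <= c%:R^-1 * c%:R^-1 :> R by rewrite mulr_ge0.
lra.
Qed.

Lemma half_power_exp (c j K : nat) : (0 < c)%N -> (K <= j)%N ->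
  (1 - c%:R^-1) ^+ (c * j) * 2 ^+ K <= 1 :> R.
Proof.
move=> c0 Kj; have h := half_power c0.
have y0 : 0 <= 1 - c%:R^-1 :> R by rewrite subr_ge0 invf_le1 ?ltr0n // ler1n.
rewrite exprM; apply: (@le_trans _ _ (((1 - c%:R^-1) ^+ c) ^+ j * 2 ^+ j)).
  by rewrite ler_wpM2l ?exprn_ge0 // ler_weXn2l // ler1n.
by rewrite -exprMn; apply: exprn_ile1 => //; rewrite mulr_ge0 // exprn_ge0.
Qed.

Lemma expR1_le4 : expR 1 <= 4 :> R.
Proof.
have h : 1 / 2 <= expR (- (1 / 2)) :> R by apply: le_trans (expR_ge1Dx _); lra.
have e := expRxMexpNx_1 (1 / 2 : R).
have h2 : expR (1 / 2) <= 2 :> R.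
  by have := ler_wpM2l (expR_ge0 (1 / 2)) h; rewrite e; lra.
have -> : (1 : R) = 1 / 2 + 1 / 2 by lra.
rewrite expRD; apply: (@le_trans _ _ (2 * 2)); last lra.
by apply: ler_pM => //; apply: expR_ge0.
Qed.

(** With r = 4 3^i, m = 8 r and X = 2^r one has t = 2 X^8, while exp r <= 4^r = X^2 and the bracket
    is at most 45 X^2; X >= 16 then leaves ample room. *)
Lemma admissible_params k i : (0 < k)%N -> (k <= i)%N -> admissible R (8 * (4 * 3 ^ i)) k i.
Proof.
move=> k0 ki; set r := (4 * 3 ^ i)%N; set m := (8 * r)%N.
have kr : (k <= r)%N.
  apply: (leq_trans ki); apply: leq_trans (leq_pmull _ (isT : (0 < 4)%N)).
  by apply: ltnW; apply: ltn_expl.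
have r4 : (4 <= r)%N.
  by apply: leq_pmulr; rewrite expn_gt0.
have r2 : (r < 2 ^ r)%N by apply: ltn_expl.
have em : (2 ^ m.+1 = 2 * (2 ^ r) ^ 8)%N by rewrite expnS -expnM /m [(8 * r)%N]mulnC.
have mE : m = (8 * r)%N by [].
rewrite /admissible -/r -/m; clearbody m r; split.
- apply: (@leq_trans (3 * r)); first by rewrite leq_mul2l kr.
  rewrite em; apply: (@leq_trans (2 * (2 ^ r) ^ 2)).
    have : (4 * r <= 2 ^ r * 2 ^ r)%N by apply: leq_mul; [apply: leq_trans r4 (ltnW r2) | apply: ltnW].
    by rewrite -mulnn; lia.
  by rewrite leq_mul2l /= leq_pexp2l // expn_gt0.
- by rewrite em; apply: (leq_trans (ltnW r2)); apply: leq_trans (leq_pmull _ (isT : (0 < 2)%N));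
  rewrite -{1}[(2 ^ r)%N]expn1 leq_pexp2l // expn_gt0.
have e1 : expR r%:R <= ((2 ^ r) ^ 2)%:R :> R.
  have -> : r%:R = r%:R * 1 :> R by rewrite mulr1.
  rewrite expRM_natl -expnM mulnC expnM natrX; apply: ler_expX; rewrite ?expR_ge0 //.
  exact: expR1_le4.
set X : R := (2 ^ r)%:R.
have X16 : 16 <= X by rewrite (ler_nat R 16); apply: (leq_pexp2l (isT : (0 < 2)%N) r4).
have rX : r%:R <= X by rewrite ler_nat ltnW.
have kX : k%:R <= X by apply: le_trans rX; rewrite ler_nat.
have {}e1 : expR r%:R <= X ^+ 2 by rewrite -natrX.
have E8 : ((2 ^ r) ^ 8)%:R = X ^+ 8 by rewrite natrX.
rewrite em natrM E8 mE.
have X2 : X <= X ^+ 2 by rewrite expr2 ler_peMl //; lra.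
have h : 4 * k%:R * ((8 * r)%:R + 2 + r%:R) + k%:R <= 45 * X ^+ 2.
  apply: (@le_trans _ _ (4 * X * (8 * X + 2 + X) + X)).
    apply: lerD => //; apply: ler_pM; rewrite ?mulr_ge0 ?addr_ge0 ?ler0n //.
      by rewrite ler_pM2l.
    by rewrite natrM !lerD // ler_pM2l.
  by move: X2; rewrite !expr2 => X2; lra.
apply: (@le_trans _ _ (X ^+ 2 * (45 * X ^+ 2))).
  apply: ler_pM => //.
have X4 : 16 ^+ 4 <= X ^+ 4 by apply: ler_expX.
have -> : X ^+ 2 * (45 * X ^+ 2) = 45 * X ^+ 4 by ring.
have -> : 3 / 4 * (2 * X ^+ 8) = 3 / 2 * X ^+ 4 * X ^+ 4 by field.
have X40 : 0 <= X ^+ 4 by apply: exprn_ge0; lra.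
apply: ler_wpM2r => //; lra.
Qed.

End NumericalChoices.

(** * The theorem for a fixed exponent k/2 *)

Section FixedExponent.
Variable R : realType.

Lemma additive_saving (N : nat) (Z : R) (k t s : nat) : (4 * k <= t)%N -> (0 < t)%N -> (t <= s)%N ->
  0 <= Z -> Z <= 9 * N%:R `^ (7 / 8) ->
  Z ^+ t * N%:R ^+ (2 * s - t) <= 9 ^+ t * N%:R `^ ((2 * s)%:R - k%:R / 2).
Proof.
move=> kt t0 ts Z0 hZ; have [N0|N0] := posnP N.
  have -> : Z = 0 by apply/eqP; rewrite eq_le Z0 andbT (le_trans hZ) // N0 powR0 ?mulr0.
  by rewrite expr0n gtn_eqF // mul0r mulr_ge0 ?powR_ge0.
have Np : 0 < N%:R :> R by rewrite ltr0n.
apply: (@le_trans _ _ ((9 * N%:R `^ (7 / 8)) ^+ t * N%:R ^+ (2 * s - t))).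
  by rewrite ler_wpM2r ?exprn_ge0 // ler_expX.
rewrite exprMn -mulrA ler_wpM2l ?exprn_ge0 // -!powR_mulrn ?powR_ge0 // -powRrM -powRD ?(gt_eqF Np) ?implybT //.
apply: ler_powR; first by rewrite ler1n.
have ts2 : (t <= 2 * s)%N by clear - ts; lia.
rewrite natrB //; have : 4 * k%:R <= t%:R :> R by rewrite -natrM ler_nat.
lra.
Qed.

Lemma multiplicative_saving (N : nat) (Y : R) (k t s : nat) : (k < t)%N -> (t <= s)%N ->
  0 <= Y -> Y <= 2 `^ (3 * (k%:R / t%:R)) * N%:R `^ (1 - k%:R / t%:R / 2) ->
  Y ^+ t * N%:R ^+ (2 * s - t) <= 8 ^+ k * N%:R `^ ((2 * s)%:R - k%:R / 2).
Proof.
move=> kt ts Y0; set d : R := _ / _ => hY.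
have t0 : (0 < t)%N by apply: leq_ltn_trans kt.
have tp : 0 < t%:R :> R by rewrite ltr0n.
have dt : d * t%:R = k%:R by rewrite /d divfK // gt_eqF.
have d1 : d <= 1 by rewrite ler_pdivrMr // mul1r ler_nat ltnW.
have [N0|N0] := posnP N.
  have -> : Y = 0.
    apply/eqP; rewrite eq_le Y0 andbT (le_trans hY) // N0 powR0 ?mulr0 //.
    by rewrite gt_eqF //; lra.
  by rewrite expr0n gtn_eqF // mul0r mulr_ge0 ?powR_ge0.
have Np : 0 < N%:R :> R by rewrite ltr0n.
apply: (le_trans (ler_wpM2r (exprn_ge0 _ (ler0n R N)) (ler_expX t Y0 hY))).
rewrite exprMn -mulrA; apply: ler_pM; rewrite ?mulr_ge0 ?exprn_ge0 ?powR_ge0 //.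
  rewrite -[(_ `^ _) ^+ t]powR_mulrn ?powR_ge0 // -powRrM -mulrA dt.
  have -> : 3 * k%:R = (3 * k)%:R :> R by rewrite natrM.
  by rewrite powR_mulrn // exprM ler_expX //; lra.
rewrite -!powR_mulrn ?powR_ge0 // -powRrM -powRD ?(gt_eqF Np) ?implybT //.
apply: ler_powR; first by rewrite ler1n.
have ts2 : (t <= 2 * s)%N by clear - ts; lia.
rewrite natrB //; lra.
Qed.

Local Open Scope fset_scope.

Lemma fixed_exponent (m k i s : nat) : admissible R m k i -> (0 < k)%N ->
  ((1 - 4000^-1) ^+ i * ((2 ^ k.+2) ^ 2)%:R ^+ k <= 1 :> R)%R ->
  (2 ^ m.+1 <= s)%N -> (2 ^ k.+2 <= s)%N ->
  exists K : R, (0 < K)%R /\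
    forall A : {fset int}, exists B C : {fset int},
      [disjoint B & C] /\ A = B `|` C /\
      let bound := (K * (#|` A|%:R : R) `^ ((2 * s)%:R - k%:R / 2))%R in
      ((E1 s B)%:R <= bound)%R /\ ((M1 s C)%:R <= bound)%R /\
      ((E2 s B C)%:R <= bound)%R /\ ((M2 s B C)%:R <= bound)%R /\
      (0%R \notin A ->
        forall As : seq {fset int}, size As = (2 * s)%N ->
          all (fun X => (X == B) || (X == C)) As ->
          ((Egen s As)%:R <= bound)%R \/ ((Mgen s As)%:R <= bound)%R).
Proof.
move=> adm k0 hlam ms ks.
set t := (2 ^ m.+1)%N; set t' := (2 ^ k.+2)%N.
exists (9 ^+ t' + 8 ^+ k)%R; split; first by rewrite addr_gt0 ?exprn_gt0.
move=> A; set N := #|` A|.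
pose A0 := [seq a <- enum_fset A | a != 0%R].
have uA0 : uniq A0 by rewrite filter_uniq // fset_uniq.
have szA0 : (size A0 <= N)%N by rewrite size_filter count_size.
(* Guards the empty set: for N = 0 the power is 0, but q >= 1 is required. *)
pose q : R := Num.max 1%R (N%:R `^ (1 / 8)).
have q1 : (1 <= q)%R by rewrite le_max lexx.
have qN : (N%:R <= q ^+ 8)%R.
  apply: (@le_trans _ _ ((N%:R `^ (1 / 8)) ^+ 8)%R); last by apply: ler_expX; rewrite ?powR_ge0 // le_max lexx orbT.
  by rewrite -powR_mulrn ?powR_ge0 // -powRrM divfK // powRr1.
have qpos : (0 < N)%N -> q = N%:R `^ (1 / 8).
  by move=> N0; apply/max_idPr; rewrite -[leLHS](powRr0 N%:R) ler_powR // ler1n.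
have A00 : 0%R \notin A0 by rewrite mem_filter eqxx.
have szq : ((size A0)%:R <= q ^+ 8)%R by apply: le_trans qN; rewrite ler_nat.
have [n [P [hB hC]]] := decomposition (m' := k.+1) adm k0 hlam uA0 A00 q1 szq.
(* 0 has to go to B: it would spoil every multiplicative count. *)
pose B := [fset a in A | (a == 0%R) || P a]; pose C := [fset a in A | (a != 0%R) && ~~ P a].
have BC : [disjoint B & C].
  apply/fdisjointP => a; rewrite !inE /= => /andP[_ h]; rewrite negb_and negb_and !negbK h orbT //.
have ABC : A = B `|` C.
  by apply/fsetP => a; rewrite !inE; case: (a \in A); case: (a == 0%R); case: (P a).
have sB : (#|` B| <= N)%N by apply: fsubset_leq_card; rewrite ABC fsubsetUl.
have sC : (#|` C| <= N)%N by apply: fsubset_leq_card; rewrite ABC fsubsetUr.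
have C0 a : a \in C -> a != 0%R by rewrite !inE => /and3P[].
set Z := enorm k.+2 (unif R id (enum_fset B)); set Y := enorm m.+1 (unif R (@valuations n) (enum_fset C)).
have kt : (k < t)%N by case: adm => h _ _; have := expn_gt0 2 m.+1; rewrite -/t in h *; clear - h k0; lia.
set d : R := k%:R / t%:R in hC *.
have d0 : (0 <= d)%R by rewrite divr_ge0.
have d1 : (d < 1)%R by rewrite ltr_pdivrMr ?ltr0n ?expn_gt0 // mul1r ltr_nat.
have szq' : (8 / q * (size A0)%:R <= 8 * N%:R `^ (7 / 8))%R.
  have [N0|N0] := posnP N.
    have -> : size A0 = 0%N by apply/eqP; rewrite -leqn0 -N0.
    by rewrite mulr0 mulr_ge0 ?powR_ge0.
  have Np : (0 < N%:R :> R)%R by rewrite ltr0n.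
  rewrite -mulrA ler_pM2l // mulrC ler_pdivrMr; last by apply: lt_le_trans q1.
  rewrite qpos // -powRD ?(gt_eqF Np) ?implybT // (_ : 7 / 8 + 1 / 8 = 1)%R; last by field.
  by rewrite powRr1 // ler_nat.
(* 9 = 8 + 1: by the triangle inequality the element 0, if it lies in B, adds at most 1 to the
   norm. *)
have hZ : (Z <= 9 * N%:R `^ (7 / 8))%R.
  pose f0 := [seq a <- enum_fset B | a == 0%R]; pose f1 := [seq a <- enum_fset B | a != 0%R].
  have pB : perm_eq (enum_fset B) (f0 ++ f1) by rewrite perm_sym; apply/permPl/perm_filterC.
  have p1 : perm_eq f1 [seq a <- A0 | P a].
    apply: uniq_perm; rewrite ?filter_uniq ?fset_uniq // => a.
    by rewrite !mem_filter !inE; case: (a == 0%R); rewrite ?andbF //= andbC.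
  rewrite /Z (enorm_unif_perm _ _ _ pB) /unif map_cat.
  apply: le_trans (enorm_cat _ _ _) _; rewrite ?nonneg_unif //.
  rewrite (_ : 9 = 1 + 8)%R; last by ring.
  rewrite mulrDl mul1r; apply: lerD; last by rewrite (enorm_unif_perm _ _ _ p1); apply: le_trans szq'.
  apply: le_trans (enorm_le_mass _ (nonneg_unif _ _ _)) _; rewrite mass_unif.
  have [N0|N0] := posnP N.
    rewrite (_ : size f0 = 0%N) ?powR_ge0 //; apply/eqP; rewrite -leqn0 -N0.
    by apply: leq_trans sB; rewrite size_filter count_size.
  apply: (@le_trans _ _ 1%R).
    rewrite (ler_nat R _ 1); apply: (@uniq_leq_size _ _ [:: 0%R]).
      by rewrite filter_uniq // fset_uniq.
    by move=> a; rewrite mem_filter => /andP[h _]; rewrite inE.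
  by rewrite -[leLHS](powRr0 N%:R) ler_powR // ler1n.
have hY : (Y <= 2 `^ (3 * d) * N%:R `^ (1 - d / 2))%R.
  have pC : perm_eq (enum_fset C) [seq a <- A0 | ~~ P a].
    apply: uniq_perm; rewrite ?filter_uniq ?fset_uniq // => a.
    by rewrite !mem_filter !inE; case: (a == 0%R); rewrite ?andbF //= andbC.
  rewrite /Y (enorm_unif_perm _ _ _ pC); apply: (le_trans hC); rewrite /mult_bound.
  have [N0|N0] := posnP N.
    have -> : size A0 = 0%N by apply/eqP; rewrite -leqn0 -N0.
    by rewrite powR0 ?mulr0 ?mul0r ?mulr_ge0 ?powR_ge0 // gt_eqF // subr_gt0.
  have Np : (0 < N%:R :> R)%R by rewrite ltr0n.
  have -> : (2 * q ^+ 2) `^ (2 * d) = 2 `^ (2 * d) * N%:R `^ (d / 2).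
    rewrite powRM ?exprn_ge0 ?(le_trans ler01 q1) // qpos // -powR_mulrn ?powR_ge0 // -!powRrM.
    by congr (_ * _ `^ _)%R; field.
  have e2 : (2 `^ (3 * d) = 2 `^ d * 2 `^ (2 * d) :> R)%R.
    by rewrite -powRD ?pnatr_eq0 ?implybT //; congr (_ `^ _)%R; ring.
  have eN : (N%:R `^ (1 - d / 2) = N%:R `^ (1 - d) * N%:R `^ (d / 2))%R.
    by rewrite -powRD ?(gt_eqF Np) ?implybT //; congr (_ `^ _)%R; field.
  rewrite e2 eN [leRHS]mulrACA.
  apply: ler_pM; rewrite ?mulr_ge0 ?powR_ge0 //.
  rewrite ler_wpM2l ?powR_ge0 //; apply: ge0_ler_powR; rewrite ?nnegrE ?ler0n ?ler_nat //.
  by rewrite subr_ge0 ltW.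
have t'4 : (4 * k <= t')%N by rewrite /t' expnS expnS mulnA leq_mul2l /= ltnW // ltn_expl.
exists B, C; split=> //; split=> //=.
set bound := (_ * _)%R.
have hE (As : seq {fset int}) (ev : pred (seq int)) : size As = (2 * s)%N -> (t' <= count (pred1 B) As)%N ->
    all (fun Y : {fset int} => #|` Y| <= N)%N As ->
    (forall tau, tau \in tuples_of As -> ev tau ->
       (\sum_(x <- take s tau) x = \sum_(x <- drop s tau) x)%R) ->
    ((count ev (tuples_of As))%:R <= bound)%R.
  move=> h1 h2 h3 h4; apply: le_trans (count_solutions_le R (phi := id) (m := k.+1) h1 h2 h3 h4) _.
  apply: le_trans (additive_saving t'4 _ ks (enorm_ge0 _ _) hZ) _; first by rewrite expn_gt0.
  by rewrite /bound ler_wpM2r ?powR_ge0 // lerDl exprn_ge0.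
have hM (As : seq {fset int}) (ev : pred (seq int)) : size As = (2 * s)%N -> (t <= count (pred1 C) As)%N ->
    all (fun Y : {fset int} => #|` Y| <= N)%N As ->
    (forall tau, tau \in tuples_of As -> ev tau ->
       (\prod_(x <- take s tau) x = \prod_(x <- drop s tau) x)%R) ->
    (forall tau, tau \in tuples_of As -> all (fun x => x != 0%R) (drop s tau)) ->
    ((count ev (tuples_of As))%:R <= bound)%R.
  move=> h1 h2 h3 h4 h5.
  apply: le_trans (count_solutions_le R (phi := @valuations n) (m := m) h1 h2 h3 _) _.
    by move=> tau ht hev; apply: prod_eq_valuations; [apply: h5 | apply: h4].
  apply: le_trans (multiplicative_saving kt ms (enorm_ge0 _ _) hY) _.
  by rewrite /bound ler_wpM2r ?powR_ge0 // lerDr exprn_ge0.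
have s0 : (0 < s)%N by apply: leq_trans ks; rewrite expn_gt0.
have cnt (x y : {fset int}) j : (j <= count (pred1 x) (nseq j x ++ nseq j y))%N.
  by rewrite count_cat count_nseq /= eqxx mul1n leq_addr.
have cntr (x y : {fset int}) j : (j <= count (pred1 y) (nseq j x ++ nseq j y))%N.
  by rewrite count_cat !count_nseq /= eqxx mul1n leq_addl.
have nn (x : {fset int}) : nseq (2 * s) x = nseq s x ++ nseq s x by rewrite -nseqD mul2n addnn.
have sz2 (x y : {fset int}) : size (nseq s x ++ nseq s y) = (2 * s)%N.
  by rewrite size_cat !size_nseq addnn mul2n.
have all2 (x y : {fset int}) : (#|` x| <= N)%N -> (#|` y| <= N)%N ->
    all (fun Y : {fset int} => #|` Y| <= N)%N (nseq s x ++ nseq s y).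
  by move=> hx hy; rewrite all_cat !all_nseq hx hy !orbT.
(* In M_s(C) and M_s(B, C) the second half consists of copies of C, which avoids 0. *)
have dropC (x : {fset int}) tau : tau \in tuples_of (nseq s x ++ nseq s C) ->
    all (fun x => x != 0%R) (drop s tau).
  move=> /size_choices_mem[st hst]; apply/(all_nthP 0%R) => j; rewrite size_drop nth_drop => hj.
  rewrite size_map sz2 in st.
  have js : (j < s)%N by move: hj; rewrite st; clear; lia.
  have jA : (s + j < size (nseq s x ++ nseq s C))%N by rewrite sz2; clear - js; lia.
  have := hst (s + j)%N; rewrite size_map (nth_map fset0) // => /(_ jA).
  rewrite nth_cat size_nseq (_ : (s + j < s)%N = false); last by clear; lia.
  by rewrite addKn nth_nseq js => /C0.
split.
  rewrite /E1 nn; apply: hE.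
  - exact: sz2.
  - exact: leq_trans ks (cnt _ _ _).
  - exact: all2.
  - by move=> tau _ h; apply/eqP.
split.
  rewrite /M1 nn; apply: hM.
  - exact: sz2.
  - exact: leq_trans ms (cnt _ _ _).
  - exact: all2.
  - by move=> tau _ h; apply/eqP.
  - exact: dropC.
split.
  apply: hE.
  - exact: sz2.
  - exact: leq_trans ks (cnt _ _ _).
  - exact: all2.
  - by move=> tau _ h; apply/eqP.
split.
  apply: hM.
  - exact: sz2.
  - exact: leq_trans ms (cntr _ _ _).
  - exact: all2.
  - by move=> tau _ h; apply/eqP.
  - exact: dropC.
move=> A0' As szAs hAs.
have hN : all (fun Y : {fset int} => #|` Y| <= N)%N As.
  by apply: sub_all hAs => X /orP[] /eqP ->.
have [hb|hb] := leqP s (count (pred1 B) As).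
  by left; apply: hE => //; [exact: leq_trans ks hb | by move=> tau _ h; apply/eqP].
right; apply: hM => //; [|by move=> tau _ h; apply/eqP|].
  apply: (leq_trans ms); have h : (size As <= count (pred1 B) As + count (pred1 C) As)%N.
    rewrite -count_predUI; apply: leq_trans (leq_addr _ _).
    by rewrite (_ : count _ _ = size As) //; apply/eqP; rewrite -all_count.
  by move: h hb; rewrite szAs; clear; lia.
move=> tau /size_choices_mem[st hst]; apply/(all_nthP 0%R) => j; rewrite size_drop nth_drop => hj.
have jA : (s + j < size As)%N by move: hj; rewrite st size_map szAs; clear; lia.
have := hst (s + j)%N; rewrite size_map (nth_map fset0) // => /(_ jA) h.
have := allP hAs _ (mem_nth fset0 jA); set X := nth _ _ _ in h *.
move=> hX; have XA : nth 0%R tau (s + j) \in A.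
  rewrite ABC inE; case/orP: hX => /eqP <-; by rewrite h ?orbT.
by apply: contraNneq A0' => <-.
Qed.
End FixedExponent.

(** The price L^k = 2^((2k+4) k) is absorbed by i = 4000 (2k+4) k factors 1 - 1/4000, since 4000 of
    them at least halve. Then m + 1 <= 2^(2i+6), and (2k+4) k <= 6 k^2 gives 2i + 6 <= D k^2. *)
Lemma exists_params (R : realType) : exists D : nat, (4 <= D)%N /\
  forall k, (0 < k)%N -> exists m i, [/\ admissible R m k i,
    (1 - 4000^-1) ^+ i * ((2 ^ k.+2) ^ 2)%:R ^+ k <= 1 :> R,
    (k.+2 <= m.+1)%N & (m.+1 <= 2 ^ (D * k ^ 2))%N].
Proof.
have [c ec] : exists c : nat, c = 4000%N by exists 4000%N.
have c1 : (0 < c)%N by rewrite ec.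
have -> : 4000 = c%:R :> R by rewrite ec.
clear ec; exists (12 * c + 6)%N; split; first by clear; lia.
move=> k k0; set i := (c * ((2 * k + 4) * k))%N; set m := (8 * (4 * 3 ^ i))%N.
have ki : (k <= i)%N.
  apply: (@leq_trans ((2 * k + 4) * k)); last by rewrite leq_pmull.
  by rewrite leq_pmull // addn_gt0 orbT.
have i3 : (i < 3 ^ i)%N by apply: ltn_expl.
exists m, i; split.
- exact: admissible_params.
- rewrite -natrX -!expnM natrX; apply: half_power_exp => //.
  by rewrite mulnA leq_mul2r; apply/orP; right; clear; lia.
- by rewrite ltnS /m; move: (3 ^ i)%N i3 ki k0 => p; clear; lia.
- apply: (@leq_trans (2 ^ (2 * i + 6))).
    have h : (3 ^ i <= 2 ^ (2 * i))%N by rewrite expnM leq_exp2r // (leq_trans k0 ki).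
    rewrite expnD /m; have : (1 <= 2 ^ (2 * i))%N by rewrite expn_gt0.
    move: (2 ^ (2 * i))%N (3 ^ i)%N h => p q; rewrite (_ : 2 ^ 6 = 64)%N //; clear; lia.
  rewrite leq_pexp2l // mulnDl; apply: leq_add; last by rewrite -[leqLHS]muln1 leq_mul2l /= expn_gt0 k0.
  rewrite /i -mulnn [(12 * c)%N]mulnC mulnCA -[leqRHS]mulnA leq_mul2l; apply/orP; right.
  rewrite !mulnA leq_mul2r; apply/orP; right; clear - k0; lia.
Qed.

Local Open Scope fset_scope.

Theorem theorem2p1 (R : realType) :
  exists c : R, 0 < c /\
  exists s0 : nat, forall s : nat, (s0 <= s)%N ->
  exists gamma : R,
    c * Num.sqrt (ln (ln (s%:R : R)) / ln (ln (ln (s%:R : R)))) <= gamma /\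
    exists K : R, 0 < K /\
    forall A : {fset int},
    exists B C : {fset int},
      [disjoint B & C] /\ A = B `|` C /\
      let bound := K * (#|` A|%:R : R) `^ ((2 * s)%:R - gamma) in
      (E1 s B)%:R <= bound /\ (M1 s C)%:R <= bound /\
      (E2 s B C)%:R <= bound /\ (M2 s B C)%:R <= bound /\
      (0 \notin A ->
        forall As : seq {fset int}, size As = (2 * s)%N ->
          all (fun X => (X == B) || (X == C)) As ->
          (Egen s As)%:R <= bound \/ (Mgen s As)%:R <= bound).
Proof.
have [D [D4 hD]] := exists_params R.
have Dp : (0 < D%:R :> R)%R by rewrite ltr0n; apply: leq_trans D4.
have sDp : (0 < Num.sqrt D%:R :> R)%R by rewrite sqrtr_gt0.
exists (4 * Num.sqrt D%:R)^-1%R; split; first by rewrite invr_gt0 mulr_gt0.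
(* s > exp (exp D) makes T = ln ln s exceed D, so that x >= 1 and k >= 1. *)
exists (Num.truncn (expR (expR D%:R : R))).+1 => s hs.
have sE : (expR (expR D%:R) < s%:R :> R)%R.
  by apply: (lt_le_trans (truncnS_gt _)); rewrite ler_nat.
have s0 : (0 < s%:R :> R)%R by apply: lt_trans sE; apply: expR_gt0.
have lE : (expR D%:R < ln (s%:R : R))%R by rewrite -ltr_expR lnK.
have l0 : (0 < ln (s%:R : R))%R by apply: lt_trans lE; apply: expR_gt0.
set T := ln (ln (s%:R : R)).
have TD : (D%:R < T)%R by rewrite -ltr_expR lnK.
have T0 : (0 < T)%R by apply: lt_trans TD.
have lT : (1 <= ln T)%R.
  rewrite -ler_expR lnK ?posrE //; apply: le_trans (expR1_le4 R) _.
  by apply: le_trans (ltW TD); rewrite (ler_nat R 4).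
set x := Num.sqrt (T / D%:R).
have x1 : (1 <= x)%R.
  by rewrite -[leLHS]sqrtr1 ler_sqrt ?divr_ge0 ?(ltW T0) ?(ltW Dp) // ler_pdivlMr // mul1r ltW.
have x0 : (0 <= x)%R by apply: sqrtr_ge0.
pose k := Num.truncn x.
have k0 : (0 < k)%N by rewrite truncn_gt0.
have kx : (k%:R <= x)%R by rewrite truncn_le.
have xk : (x < k%:R + 1)%R by rewrite natr1; apply: truncnS_gt.
have Dk : ((D * k ^ 2)%:R <= T)%R.
  rewrite natrM natrX mulrC -ler_pdivlMr //.
  have -> : (T / D%:R = x ^+ 2)%R by rewrite sqr_sqrtr // divr_ge0 // ltW.
  by apply: ler_expX.
have [m [i [adm hlam km mD]]] := hD k k0.
(* ln 2 <= 1 turns D k^2 <= ln ln s into 2^(2^(D k^2)) <= s, in two passes. *)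
have ms : (2 ^ m.+1 <= s)%N.
  apply: (@leq_trans (2 ^ (2 ^ (D * k ^ 2)))); first by rewrite leq_pexp2l.
  have pl (e : nat) (y : R) : (0 < y)%R -> (e%:R <= ln y)%R -> ((2 ^ e)%:R <= y)%R.
    move=> y0 h; have p2 : (0 < (2 ^ e)%:R :> R)%R by rewrite ltr0n expn_gt0.
    rewrite -ler_ln ?posrE //; apply: le_trans h.
    by rewrite natrX lnXn // -[leLHS]mulr_natl ler_piMr // ln2_le1.
  by rewrite -(ler_nat R); apply: (pl) => //; apply: (pl).
have ks : (2 ^ k.+2 <= s)%N by apply: leq_trans ms; rewrite leq_pexp2l.
exists (k%:R / 2)%R; split; last exact: fixed_exponent adm k0 hlam ms ks.
(* Since ln T >= 1, it is enough to reach sqrt T; then x < k + 1 <= 2k gives x / 4 <= k / 2. *)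
apply: (@le_trans _ _ ((4 * Num.sqrt D%:R)^-1 * Num.sqrt T)%R).
  rewrite ler_wpM2l ?invr_ge0 ?mulr_ge0 ?sqrtr_ge0 // ler_sqrt ?(ltW T0) //.
  by rewrite ler_pdivrMr ?(lt_le_trans ltr01) // ler_peMr // ltW.
have -> : ((4 * Num.sqrt D%:R)^-1 * Num.sqrt T = x / 4)%R.
  rewrite /x sqrtrM ?(ltW T0) // sqrtrV ?(ltW Dp) //.
  by field; rewrite gt_eqF.
have k1 : (1 <= k%:R :> R)%R by rewrite ler1n.
clear - k1 xk; lra.
Qed.
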